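(* Let $b$ be an affine, divergence-free velocity field with $b(x)\neq 0$ for all $x\in\Omega$, and let $0<\varepsilon\le\frac12\left(1-\frac{B_\infty}{b_\infty}\right)$, where $b_\infty:=\|2b-b(0)\|_{L^\infty(\Omega)}$ and $B_\infty:=\|b-b(0)\|_{L^\infty(\Omega)}$. Let $f\in H^s(\Omega)$ with $s\in[0,1]$. Let $u\in V$ be the unique solution of $a(u,v)=(f,v)_{L^2(\Omega)}$ for all $v\in V$, and let $u_H\in V_H$ be the unique solution of $a(u_H,v_H)=(\Pi_H f,v_H)_{L^2(\Omega)}$ for all $v_H\in V_H$. Then $$\|u-u_H\|_{V,\varepsilon}\le C_{stab}\|f-\Pi_Hf\|_{L^2(\Omega)}\le C\,C_{stab}\,H^s\|f\|_{H^s(\Omega)},$$ where $C$ and $C_{stab}$ are positive constants independent of $\varepsilon$ and $H$, and $C_{stab}$ is the stability constant described in the context.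
   Context: $\Omega\subset\mathbb{R}^d$, $d\in\{1,2,3\}$, is a bounded polygonal domain, $0<\varepsilon\le 1$, $b\in L^\infty(\Omega;\mathbb{R}^d)$ with $\operatorname{div} b=0$, $V:=H^1_0(\Omega)$, and $$a(u,v):=\varepsilon\int_\Omega\nabla u\cdot\nabla v\,dx+\int_\Omega(b\cdot\nabla u)\,v\,dx\qquad(u,v\in V).$$ The norm is $\|v\|_{V,\varepsilon}^2:=\varepsilon\|\nabla v\|_{L^2(\Omega)}^2+\|v\|_{L^2(\Omega)}^2$. The solution operator $\mathcal{A}^{-1}:L^2(\Omega)\to V$ maps $g\in L^2(\Omega)$ to the unique $w\in V$ with $a(w,v)=(g,v)_{L^2(\Omega)}$ for all $v\in V$ (it exists by Lax--Milgram, since $a(v,v)=\varepsilon\|\nabla v\|_{L^2(\Omega)}^2$). $b(0)$ denotes the value at the origin of the affine map $b$. $C_{stab}>0$ denotes the $\varepsilon$-independent constant of the stability estimate: for all $0<\varepsilon\le\frac12(1-B_\infty/b_\infty)$ and all $g\in L^2(\Omega)$, $\|\mathcal{A}^{-1}g\|_{V,\varepsilon}\le C_{stab}\|g\|_{L^2(\Omega)}$. $\mathcal{T}_H$ is a shape-regular (triangular or quadrilateral) mesh of $\Omega$ with mesh size $H=\max_{T\in\mathcal{T}_H}\operatorname{diam}(T)$; $\mathbb{P}^0(\mathcal{T}_H):=\operatorname{span}\{\mathbf{1}_T: T\in\mathcal{T}_H\}$ is the space of $\mathcal{T}_H$-piecewise constants ($\mathbf{1}_T$ the characteristic function of $T$);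 $\Pi_H:L^2(\Omega)\to\mathbb{P}^0(\mathcal{T}_H)$ is the $L^2$-orthogonal projection, $\Pi_Hv|_T=\frac1{|T|}\int_Tv\,dx$; and $V_H:=\mathcal{A}^{-1}\mathbb{P}^0(\mathcal{T}_H)=\operatorname{span}\{\mathcal{A}^{-1}\mathbf{1}_T: T\in\mathcal{T}_H\}$. *)

(* Defs.v *)
From HB Require Import structures.
From mathcomp Require Import all_boot all_order all_algebra.
From mathcomp Require Import all_classical all_reals all_analysis.

Set Implicit Arguments.
Unset Strict Implicit.
Unset Printing Implicit Defensive.

Import Order.TTheory GRing.Theory Num.Theory.
Import numFieldNormedType.Exports.

Local Open Scope classical_set_scope.
Local Open Scope ring_scope.

Fact rV_display : measure_display. Proof. exact: default_measure_display. Qed.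

(* The sigma-algebra on R^n is generated by the coordinates, i.e. it is the
   Borel sigma-algebra. *)
Section rV_measurable.
Context {R : realType} (n : nat).

Let coor (i : 'I_n) (x : 'rV[R]_n) : measurableTypeR R := x ord0 i.

Let rV_set0 : g_sigma_preimage coor set0.
Proof. exact: sigma_algebra0. Qed.

Let rV_setC A : g_sigma_preimage coor A -> g_sigma_preimage coor (~` A).
Proof. exact: sigma_algebraC. Qed.

Let rV_bigcup (F : _^nat) : (forall i, g_sigma_preimage coor (F i)) ->
  g_sigma_preimage coor (\bigcup_i (F i)).
Proof. exact: sigma_algebra_bigcup. Qed.

HB.instance Definition _ := @isMeasurable.Build rV_display
  'rV[R]_n (g_sigma_preimage coor) rV_set0 rV_setC rV_bigcup.

End rV_measurable.

Section rV_measurable_fun.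
Context {R : realType}.

Lemma measurable_coor n (i : 'I_n) :
  measurable_fun [set: 'rV[R]_n]
    (fun x : 'rV[R]_n => x ord0 i : measurableTypeR R).
Proof.
move=> _ A mA; rewrite setTI; apply: sub_sigma_algebra.
case: n i => [[]//|n] i.
rewrite -bigcup_mkord_ord; exists i; first exact: ltn_ord.
by exists A => //; rewrite inord_val setTI.
Qed.

Lemma measurable_fun_rV n d (T : measurableType d) (f : T -> 'rV[R]_n) :
  (forall i, measurable_fun [set: T] (fun x => f x ord0 i : measurableTypeR R)) ->
  measurable_fun [set: T] f.
Proof.
move=> mf; have sub : preimage_set_system [set: T] f measurable `<=` measurable.
  rewrite /measurable/= -g_sigma_preimage_comp.
  apply: smallest_sub; first exact: sigma_algebra_measurable.
  case: n f mf => [|n] f mf; first by rewrite big_ord0.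
  rewrite -bigcup_mkord_ord; apply: bigcup_sub => i Ii.
  by move=> A [B mB <-]; exact: mf.
by move=> _ A mA; apply: sub; exists A.
Qed.

End rV_measurable_fun.

Section lebesgue_rV.
Context {R : realType}.

Definition cons_rV n (p : measurableTypeR R * 'rV[R]_n) : 'rV[R]_n.+1 :=
  row_mx (p.1%:M : 'rV[R]_1) p.2.

Lemma measurable_cons_rV n : measurable_fun setT (@cons_rV n).
Proof.
apply: measurable_fun_rV => i.
have [j ->|j ->] := @split_ordP 1 n i.
  apply: (eq_measurable_fun (fun p : measurableTypeR R * 'rV[R]_n => p.1)).
    by move=> p _; rewrite /cons_rV (@row_mxEl _ 1 1 n) mxE (ord1 j) eqxx mulr1n.
  exact: measurable_fst.
apply: (eq_measurable_fun
  (fun p : measurableTypeR R * 'rV[R]_n => p.2 ord0 j : measurableTypeR R)).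
  by move=> p _; rewrite /cons_rV (@row_mxEr _ 1 1 n).
by apply: (measurableT_comp (measurable_coor j)); exact: measurable_snd.
Qed.

Definition uncons_rV n (x : 'rV[R]_n.+1) : measurableTypeR R * 'rV[R]_n :=
  (x ord0 ord0, \row_j x ord0 (rshift 1 j)).

Lemma measurable_uncons_rV n : measurable_fun setT (@uncons_rV n).
Proof.
apply/measurable_fun_pairP; split; first exact: measurable_coor.
apply: measurable_fun_rV => i.
apply: (eq_measurable_fun
  (fun x : 'rV[R]_n.+1 => x ord0 (rshift 1 i) : measurableTypeR R)).
  by move=> x _ /=; rewrite mxE.
exact: measurable_coor.
Qed.

Lemma cons_rVK n : cancel (@cons_rV n) (@uncons_rV n).
Proof.
case=> a y; rewrite /cons_rV /uncons_rV /=; congr pair.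
  rewrite (_ : ord0 = lshift n (ord0 : 'I_1)); last exact: val_inj.
  by rewrite (@row_mxEl _ 1 1 n) mxE eqxx.
by apply/rowP => j; rewrite mxE (@row_mxEr _ 1 1 n).
Qed.

Section lebesgue_step.
Variables (n : nat) (m : {sigma_finite_measure set 'rV[R]_n -> \bar R}).

Definition lebesgue_step : set 'rV[R]_n.+1 -> \bar R :=
  pushforward (@lebesgue_measure R \x m)%E (@cons_rV n).

Let mcons A : measurable A -> measurable (@cons_rV n @^-1` A).
Proof. by move=> mA; rewrite -[X in measurable X]setTI; exact: measurable_cons_rV. Qed.

Let step0 : lebesgue_step set0 = 0%E.
Proof. by rewrite /lebesgue_step /pushforward preimage_set0 measure0. Qed.

Let step_ge0 A : (0 <= lebesgue_step A)%E.
Proof. by rewrite /lebesgue_step /pushforward; exact: measure_ge0. Qed.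

Let step_sigma_additive : semi_sigma_additive lebesgue_step.
Proof.
move=> F mF tF mUF; rewrite /lebesgue_step /pushforward preimage_bigcup.
apply: measure_semi_sigma_additive => [i||]; first exact: mcons.
- apply/trivIsetP => /= i j _ _ ij; rewrite -preimage_setI.
  by move/trivIsetP : tF => /(_ _ _ _ _ ij) ->//; rewrite preimage_set0.
- by rewrite -preimage_bigcup; exact: mcons.
Qed.

HB.instance Definition _ := isMeasure.Build _ _ _
  lebesgue_step step0 step_ge0 step_sigma_additive.

Let step_sigma_finite : sigma_finite setT lebesgue_step.
Proof.
have /sigma_finiteP[F [TF ndF Foo]] := sigma_finiteT (@lebesgue_measure R).
have /sigma_finiteP[G [TG ndG Goo]] := sigma_finiteT m.
exists (fun k => @uncons_rV n @^-1` (F k `*` G k)).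
  rewrite -preimage_bigcup (_ : \bigcup_k _ = setT) ?preimage_setT//.
  rewrite -setXTT TF TG predeqE => -[x y]; split.
    by move=> [k _ [/= ? ?]]; split; exists k.
  move=> [/= [i _ Fix] [j _ Gjy]]; exists (maxn i j) => //; split.
  - by move: x Fix; exact/subsetPset/ndF/leq_maxl.
  - by move: y Gjy; exact/subsetPset/ndG/leq_maxr.
move=> k; have [mF F_fin] := Foo k; have [mG G_fin] := Goo k; split.
  rewrite -[X in measurable X]setTI.
  by apply: measurable_uncons_rV => //; exact: measurableX.
rewrite /lebesgue_step /pushforward -comp_preimage.
rewrite (_ : _ \o _ = id) ?preimage_id; last first.
  by apply/funext => x /=; exact: cons_rVK.
by rewrite product_measure1E// lte_mul_pinfty// ge0_fin_numE.
Qed.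

HB.instance Definition _ := Measure_isSigmaFinite.Build _ _ _
  lebesgue_step step_sigma_finite.

End lebesgue_step.

(* Lebesgue measure on R^n, as an n-fold product of the one on R. *)
Fixpoint lebesgue_rV (n : nat) : {sigma_finite_measure set 'rV[R]_n -> \bar R} :=
  match n with
  | 0 => \d_(0 : 'rV[R]_0)
  | n'.+1 => lebesgue_step (lebesgue_rV n')
  end.

End lebesgue_rV.

Section euclidean.
Context {R : realType} {d : nat}.
Local Notation E := 'rV[R]_d.

Definition dot (x y : E) : R := \sum_(i < d) x ord0 i * y ord0 i.

(* The library norm `|x| on row vectors is the max-norm. *)
Definition enorm (x : E) : R := Num.sqrt (dot x x).

Definition diam (A : set E) : R :=
  sup [set r | exists x y, [/\ A x, A y & r = enorm (x - y)]].

Definition partial (i : 'I_d) (phi : E -> R) : E -> R :=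
  fun x => 'D_(delta_mx ord0 i) phi x.

Definition smooth (phi : E -> R) : Prop :=
  forall (s : seq 'I_d) (x : E), differentiable (foldr partial phi s) x.

Definition test_function (Omega : set E) (phi : E -> R) : Prop :=
  [/\ smooth phi, compact (closure [set x | phi x != 0]) &
      closure [set x | phi x != 0] `<=` Omega].

Definition div (b : E -> E) (x : E) : R :=
  \sum_(i < d) partial i (fun y => b y ord0 i) x.

Definition affine (b : E -> E) : Prop :=
  exists (A : 'M[R]_d) (c : E), forall x, b x = x *m A + c.

End euclidean.

(* Elements of L^2, H^1, H^s on Omega are represented by functions on R^d whose
   values outside Omega are irrelevant. *)
Section sobolev.
Context {R : realType} {d : nat}.
Local Notation E := 'rV[R]_d.
Local Notation leb := (@lebesgue_rV R d).
Variable Omega : set E.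

Definition L2 (v : E -> R) : Prop := v \_ Omega \in Lfun leb 2%:E.

Definition L2norm (v : E -> R) : R :=
  fine ('N[leb]_2%:E [EFin \o (v \_ Omega)])%E.

Definition L2inner (v w : E -> R) : R := \int[leb]_(x in Omega) (v x * w x).

Definition Linfnorm (F : E -> E) : R :=
  fine ('N[leb]_+oo [EFin \o ((enorm \o F) \_ Omega)])%E.

Definition is_weak_grad (v : E -> R) (G : E -> E) : Prop :=
  (forall i, L2 (fun x => G x ord0 i)) /\
  (forall phi, test_function Omega phi -> forall i : 'I_d,
     \int[leb]_(x in Omega) (v x * partial i phi x) =
     - \int[leb]_(x in Omega) (G x ord0 i * phi x)).

Definition weak_grad (v : E -> R) : E -> E := xget (fun=> 0) (is_weak_grad v).

Definition H1 (v : E -> R) : Prop := L2 v /\ exists G, is_weak_grad v G.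

Definition H1seminorm (v : E -> R) : R := L2norm (enorm \o weak_grad v).

Definition H1norm (v : E -> R) : R :=
  Num.sqrt (L2norm v ^+ 2 + H1seminorm v ^+ 2).

Definition H10 (v : E -> R) : Prop :=
  H1 v /\ forall e : R, 0 < e ->
    exists2 phi, test_function Omega phi & H1norm (v \- phi) < e.

(* Squared Slobodeckij seminorm; on the diagonal the integrand is 0 / 0 = 0. *)
Definition slobodeckij (s : R) (v : E -> R) : \bar R :=
  (\int[leb]_(x in Omega) \int[leb]_(y in Omega)
     ((v x - v y) ^+ 2 / enorm (x - y) `^ (d%:R + 2 * s))%:E)%E.

(* Only meant for 0 <= s <= 1. *)
Definition Hs (s : R) (v : E -> R) : Prop :=
  if s == 0 then L2 v
  else if s == 1 then H1 v
  else L2 v /\ (slobodeckij s v < +oo)%E.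

Definition Hsnorm (s : R) (v : E -> R) : R :=
  if s == 0 then L2norm v
  else if s == 1 then H1norm v
  else Num.sqrt (L2norm v ^+ 2 + fine (slobodeckij s v)).

End sobolev.

(* Polytopes, and hence mesh elements, are taken open. *)
Section mesh.
Context {R : realType} {d : nat}.
Local Notation E := 'rV[R]_d.
Local Notation leb := (@lebesgue_rV R d).

Definition hull (I : finType) (p : I -> E) : set E :=
  [set x | exists w : I -> R, [/\ forall i, 0 <= w i, \sum_i w i = 1 &
                                  x = \sum_i w i *: p i]].

Definition is_simplex (T : set E) : Prop :=
  exists p : 'I_d.+1 -> E,
    \matrix_(i < d) (p (lift ord0 i) - p ord0) \in unitmx /\
    T = interior (hull p).

(* Convex polytope with the vertices of the cube {0,1}^d, in which each face
   s i = c of the cube spans a supporting hyperplane containing no further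
   vertex: an interval, a convex quadrilateral or a convex hexahedron for
   d = 1, 2, 3. *)
Definition is_quadrilateral (T : set E) : Prop :=
  exists p : {ffun 'I_d -> bool} -> E,
    (forall (i : 'I_d) (c : bool), exists (nu : E) (alpha : R),
       forall s : {ffun 'I_d -> bool},
         if s i == c then dot nu (p s) = alpha else dot nu (p s) < alpha) /\
    T = interior (hull p).

Definition polygonal_domain (Omega : set E) : Prop :=
  [/\ Omega !=set0, open Omega, connected Omega, bounded_set Omega &
      interior (closure Omega) = Omega /\
      exists (N : nat) (S : 'I_N -> set E),
        (forall k, is_simplex (S k)) /\
        closure Omega = \bigcup_k closure (S k)].

Definition is_mesh (Omega : set E) (N : nat) (T : 'I_N -> set E) : Prop :=
  [/\ (forall k, is_simplex (T k)) \/ (forall k, is_quadrilateral (T k)),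
      trivIset setT T &
      closure Omega = \bigcup_k closure (T k)].

Definition shape_regular (sigma : R) (N : nat) (T : 'I_N -> set E) : Prop :=
  forall k, exists (x : E) (r : R),
    [/\ 0 < r, [set y | enorm (y - x) < r] `<=` T k & diam (T k) <= sigma * r].

Definition mesh_size (N : nat) (T : 'I_N -> set E) : R :=
  \big[Num.max/0]_(k < N) diam (T k).

Definition PiH (N : nat) (T : 'I_N -> set E) (v : E -> R) : E -> R :=
  fun x => \sum_(k < N)
    (fine (leb (T k)))^-1 * (\int[leb]_(y in T k) v y) * \1_(T k) x.

End mesh.

Section convection_diffusion.
Context {R : realType} {d : nat}.
Local Notation E := 'rV[R]_d.
Local Notation leb := (@lebesgue_rV R d).
Variables (Omega : set E) (b : E -> E).

Definition bilin (eps : R) (u v : E -> R) : R :=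
  eps * \int[leb]_(x in Omega) dot (weak_grad Omega u x) (weak_grad Omega v x) +
  \int[leb]_(x in Omega) (dot (b x) (weak_grad Omega u x) * v x).

Definition Vnorm (eps : R) (v : E -> R) : R :=
  Num.sqrt (eps * H1seminorm Omega v ^+ 2 + L2norm Omega v ^+ 2).

Definition solves (eps : R) (g w : E -> R) : Prop :=
  H10 Omega w /\ forall v, H10 Omega v -> bilin eps w v = L2inner Omega g v.

Definition Ainv (eps : R) (g : E -> R) : E -> R := xget (fun=> 0) (solves eps g).

Definition VH (eps : R) (N : nat) (T : 'I_N -> set E) (v : E -> R) : Prop :=
  H10 Omega v /\ exists c : 'I_N -> R,
    ae_eq leb Omega v (fun x => \sum_(k < N) c k * Ainv eps (\1_(T k)) x).

Definition solvesH (eps : R) (N : nat) (T : 'I_N -> set E)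
    (g w : E -> R) : Prop :=
  VH eps T w /\ forall v, VH eps T v -> bilin eps w v = L2inner Omega g v.

Definition b_infty : R := Linfnorm Omega (fun x => 2 *: b x - b 0).
Definition B_infty : R := Linfnorm Omega (fun x => b x - b 0).

Definition admissible (eps : R) : Prop :=
  0 < eps <= 2^-1 * (1 - B_infty / b_infty).

Definition stability_constant (C : R) : Prop :=
  0 < C /\ forall eps, admissible eps -> forall g, L2 Omega g ->
    Vnorm eps (Ainv eps g) <= C * L2norm Omega g.

End convection_diffusion.

(* Main.v *)
Require Import Defs.
From HB Require Import structures.
From mathcomp Require Import all_boot all_order all_algebra.
From mathcomp Require Import all_classical all_reals all_analysis.
From mathcomp Require Import lra ring.
From mathcomp Require Import measurable_realfun.

(** The discrete space is the image of the piecewise constants under the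
solution operator, so it contains the solution of the continuous problem with
data Pi_H f.  That function solves the discrete problem as well, and discrete
solutions are unique because convection by a divergence-free field does not
contribute to a (v, v); hence u_H = A^-1 (Pi_H f) and
u - u_H = A^-1 (f - Pi_H f), and the first inequality is the stability
estimate (galerkin_error).

Stability speaks of A^-1, which is a choice among the solutions, so existence
is needed.  The space H^1_0 is realised as the closure, in a product of copies
of L^2, of the pairs (phi, grad phi) with phi a test function (H10_graph); it
is complete by Riesz-Fischer (l2_complete).  The theorem of Lax-Milgram
(lax_milgram) applies there by the Poincare inequality (poincare) and the
skew-symmetry of convection (skew), both of which pass from test functions to
the closure by continuity.  That weak gradients are unique almost everywhere
is the fundamental lemma of the calculus of variations (test_ae_eq0).

For the second inequality the mesh elements are open convex sets whose
boundaries are null sets (lebesgue_convex_boundary), so that integrals over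
the domain split over the mesh (ge0_integral_mesh).  On an element T the mean
value is the best constant, which settles s = 0; moreover the squared error is
at most |T|^-1 times the double integral over T x T of (f x - f y)^2
(PiH_error_double).  For 0 < s < 1 this is compared with the kernel of the
Slobodeckij seminorm by means of |x - y| <= diam T, and shape regularity
bounds diam T ^ d by a multiple of |T|.  For s = 1 the substitution y = x + h
turns the double integral into squared norms of the increments f (. + h) - f,
which are at most |h| times the norm of the weak gradient
(translation_estimate).  That estimate is proved by duality, translating test
functions within the convex set T instead of approximating f by smooth
functions. *)

Set Implicit Arguments.
Unset Strict Implicit.
Unset Printing Implicit Defensive.

Import Order.TTheory GRing.Theory Num.Theory.
Import numFieldNormedType.Exports.

Local Open Scope classical_set_scope.
Local Open Scope ring_scope.

(** * Hilbert spaces up to null vectors *)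

(** The vectors form a subset of a module and the inner product need not be
definite: elements of L^2 are represented by functions, and the null vectors
are the functions that vanish almost everywhere. *)
Record hilbert (R : realType) (X : lmodType R) := Hilbert {
  hdom : set X;
  hip : X -> X -> R;
  hdom0 : hdom 0;
  hdom_lin : forall a x y, hdom x -> hdom y -> hdom (a *: x + y);
  hipC : forall x y, hip x y = hip y x;
  hip_lin : forall a x y z, hdom x -> hdom y -> hdom z ->
    hip (a *: x + y) z = a * hip x z + hip y z;
  hip_ge0 : forall x, hdom x -> 0 <= hip x x;
  hip_complete : forall u : nat -> X, (forall n, hdom (u n)) ->
    (forall e, 0 < e -> exists N, forall m n, (N <= m)%N -> (N <= n)%N ->
       hip (u m - u n) (u m - u n) < e) ->
    exists2 x, hdom x & forall e, 0 < e -> exists N, forall n, (N <= n)%N ->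
       hip (u n - x) (u n - x) < e }.

Section hilbert_theory.
Context {R : realType} {X : lmodType R} (H : hilbert X).
Local Notation dom := (hdom H).
Local Notation ip := (hip H).
Implicit Types x y z : X.

Definition hnorm x : R := Num.sqrt (ip x x).
Local Notation nm := hnorm.

Lemma hdomZ a x : dom x -> dom (a *: x).
Proof. by move=> dx; rewrite -[_ *: _]addr0; apply: hdom_lin => //; exact: hdom0. Qed.

Lemma hdomD x y : dom x -> dom y -> dom (x + y).
Proof. by move=> dx dy; rewrite -[x]scale1r; exact: hdom_lin. Qed.

Lemma hdomB x y : dom x -> dom y -> dom (x - y).
Proof. by move=> dx dy; apply: hdomD => //; rewrite -scaleN1r; exact: hdomZ. Qed.

Lemma hip0l z : dom z -> ip 0 z = 0.
Proof.
move=> dz; have := hip_lin (-1) (hdom0 H) (hdom0 H) dz.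
rewrite scaler0 addr0; lra.
Qed.

Lemma hipZl a x z : dom x -> dom z -> ip (a *: x) z = a * ip x z.
Proof.
move=> dx dz; have := hip_lin a dx (hdom0 H) dz.
by rewrite addr0 hip0l // addr0.
Qed.

Lemma hipDl x y z : dom x -> dom y -> dom z -> ip (x + y) z = ip x z + ip y z.
Proof. by move=> dx dy dz; have := hip_lin 1 dx dy dz; rewrite scale1r mul1r. Qed.

Lemma hipDr x y z : dom x -> dom y -> dom z -> ip z (x + y) = ip z x + ip z y.
Proof. by move=> dx dy dz; rewrite hipC hipDl // !(hipC _ z). Qed.

Lemma hipZr a x z : dom x -> dom z -> ip z (a *: x) = a * ip z x.
Proof. by move=> dx dz; rewrite hipC hipZl // hipC. Qed.

Lemma hipBl x y z : dom x -> dom y -> dom z -> ip (x - y) z = ip x z - ip y z.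
Proof.
move=> dx dy dz; rewrite hipDl //; last by rewrite -scaleN1r; exact: hdomZ.
by rewrite -scaleN1r hipZl // mulN1r.
Qed.

Lemma hipBr x y z : dom x -> dom y -> dom z -> ip z (x - y) = ip z x - ip z y.
Proof. by move=> dx dy dz; rewrite hipC hipBl // !(hipC _ z). Qed.

Lemma hip_quad t x y : dom x -> dom y ->
  ip (x + t *: y) (x + t *: y) = ip x x + 2 * t * ip x y + t ^+ 2 * ip y y.
Proof.
move=> dx dy; have dty := hdomZ t dy.
rewrite hipDl ?hipDr ?hipZl ?hipZr //; last exact: hdomD.
by rewrite (hipC _ y x); ring.
Qed.

(** The common source of the Cauchy-Schwarz inequalities below: the polynomial is
evaluated at its minimiser, and a vanishing leading coefficient, as it occurs
for null vectors, forces the linear term to vanish. *)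
Lemma quad_disc (a b c : R) : (forall t : R, 0 <= a + 2 * t * b + t ^+ 2 * c) ->
  b ^+ 2 <= a * c.
Proof.
move=> h; have a0 : 0 <= a by have := h 0; rewrite expr0n /=; lra.
have [c0|c0] := eqVneq c 0.
  have [->|b0] := eqVneq b 0; first by rewrite expr0n /= c0 mulr0.
  have := h (- (a + 1) / (2 * b)).
  rewrite c0 mulr0 addr0 (_ : 2 * _ * b = - (a + 1)); last by field.
  lra.
have cge : 0 < c.
  rewrite lt_neqAle eq_sym c0 /= leNgt; apply/negP => cl.
  (* At both t and - t, so that b drops out; t >= 1 gives t ^+ 2 >= t. *)
  have k0 : 0 <= (a + 1) / - c by rewrite divr_ge0 // ?oppr_ge0 ?ltW //; lra.
  have kc : (a + 1) / - c * c = - (a + 1) by field.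
  set k := (a + 1) / - c in k0 kc.
  have := h (1 + k); have := h (- (1 + k)).
  rewrite sqrrN (_ : (1 + k) ^+ 2 * c = c + 2 * (k * c) + k * (k * c)); last by ring.
  rewrite kc; have := mulr_ge0 k0 a0; nra.
have := h (- b / c).
rewrite -(pmulr_lge0 _ cge).
have -> : (a + 2 * (- b / c) * b + (- b / c) ^+ 2 * c) * c = a * c - b ^+ 2 by field.
by rewrite subr_ge0.
Qed.

Lemma hnorm_ge0 x : 0 <= nm x.
Proof. exact: sqrtr_ge0. Qed.

Lemma hnorm_sqr x : dom x -> nm x ^+ 2 = ip x x.
Proof. by move=> dx; rewrite sqr_sqrtr // hip_ge0. Qed.

Lemma hip_CS x y : dom x -> dom y -> `|ip x y| <= nm x * nm y.
Proof.
move=> dx dy; rewrite -(@ler_pXn2r _ 2) // ?nnegrE ?mulr_ge0 ?hnorm_ge0 //.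
rewrite exprMn !hnorm_sqr // real_normK ?num_real //.
apply: quad_disc => t; rewrite -hip_quad //.
by apply: hip_ge0; apply: hdomD => //; exact: hdomZ.
Qed.

Lemma hnormD x y : dom x -> dom y -> nm (x + y) <= nm x + nm y.
Proof.
move=> dx dy; rewrite -(@ler_pXn2r _ 2) // ?nnegrE ?addr_ge0 ?hnorm_ge0 //.
rewrite hnorm_sqr; last exact: hdomD.
have := hip_quad 1 dx dy; rewrite scale1r => ->.
have := hip_CS dx dy; rewrite ler_norml => /andP[_].
rewrite sqrrD !hnorm_sqr //; nra.
Qed.

Lemma hnormZ a x : dom x -> nm (a *: x) = `|a| * nm x.
Proof.
move=> dx; rewrite /hnorm hipZl // ?hipZr //; last exact: hdomZ.
by rewrite mulrA -expr2 sqrtrM ?sqr_ge0 // sqrtr_sqr.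
Qed.

Lemma hnormN x : dom x -> nm (- x) = nm x.
Proof. by move=> dx; rewrite -scaleN1r hnormZ // normrN1 mul1r. Qed.

Lemma hnormBC x y : dom x -> dom y -> nm (x - y) = nm (y - x).
Proof. by move=> dx dy; rewrite -opprB hnormN //; exact: hdomB. Qed.

Lemma hnorm_lt x (e : R) : dom x -> 0 <= e -> (nm x < e) = (ip x x < e ^+ 2).
Proof.
move=> dx e0; rewrite -hnorm_sqr //.
by rewrite ltr_pXn2r // nnegrE // hnorm_ge0.
Qed.

(** A minimising sequence of ip x x - 2 * l x is Cauchy by the parallelogram
identity, and ip w = l is the Euler-Lagrange equation of its limit w. *)
Theorem riesz (l : X -> R) (C : R) :
  (forall a x y, dom x -> dom y -> l (a *: x + y) = a * l x + l y) ->
  (forall x, dom x -> `|l x| <= C * nm x) ->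
  exists2 w, dom w & forall x, dom x -> ip w x = l x.
Proof.
move=> llin lC.
have C0 x : dom x -> `|l x| <= `|C| * nm x.
  by move=> dx; rewrite (le_trans (lC _ dx)) // ler_wpM2r ?hnorm_ge0 ?ler_norm.
pose J x := ip x x - 2 * l x.
pose D := [set J x | x in dom].
have Jlb x : dom x -> - C ^+ 2 <= J x.
  move=> dx; rewrite /J -hnorm_sqr //.
  have := C0 _ dx; rewrite ler_norml => /andP[_ h].
  have := sqr_ge0 (nm x - `|C|).
  rewrite sqrrB real_normK ?num_real //; nra.
have Dlb : has_inf D.
  split; first by exists (J 0), 0 => //; exact: hdom0.
  by exists (- C ^+ 2) => _ [x dx <-]; exact: Jlb.
pose m := inf D.
have mJ x : dom x -> m <= J x.
  by move=> dx; apply: ge_inf; [exact: Dlb.2 | exists x].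
have near n : exists x, dom x /\ J x < m + n.+1%:R^-1.
  have [|_ [x dx <-] h] := @inf_adherent _ D n.+1%:R^-1 _ Dlb.
    by rewrite invr_gt0 ltr0n.
  by exists x.
have [u hu] := choice near.
have du n : dom (u n) by have [] := hu n.
have Ju n : J (u n) < m + n.+1%:R^-1 by have [] := hu n.
(* The parallelogram identity, J being at least m at the midpoint. *)
have midpt x y : dom x -> dom y ->
    ip (x - y) (x - y) <= 2 * ((J x - m) + (J y - m)).
  move=> dx dy; have dxy := hdomD dx dy; have d0 := hdom0 H.
  have := mJ _ (hdomZ 2^-1 dxy).
  rewrite /J hipZl // ?hipZr //; last exact: hdomZ.
  rewrite -[2^-1 *: _]addr0 llin ?hdom0 //.
  have l0 : l 0 = 0.
    by have := llin (-1) 0 0 (hdom0 H) (hdom0 H); rewrite scaler0 addr0; lra.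
  rewrite l0 addr0.
  have := llin 1 x y dx dy; rewrite scale1r mul1r => ->.
  rewrite !hipBl ?hipBr //; last exact: hdomB.
  rewrite !hipDl ?hipDr // (hipC _ y x); lra.
have small (e : R) : 0 < e -> exists N, forall n, (N <= n)%N -> n.+1%:R^-1 < e.
  move=> e0.
  have := near_infty_natSinv_lt (PosNum e0) => -[N _ hN].
  by exists N => n Nn; exact: hN.
have cau (e : R) : 0 < e -> exists N, forall m n, (N <= m)%N -> (N <= n)%N ->
   ip (u m - u n) (u m - u n) < e.
  move=> e0; have [|N hN] := small (e / 4); first by rewrite divr_gt0.
  exists N => i j Ni Nj; apply: le_lt_trans (midpt _ _ (du i) (du j)) _.
  have := hN _ Ni; have := hN _ Nj; have := Ju i; have := Ju j.
  by move: (_^-1) (_^-1) => p q; lra.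
have [w dw hw] := hip_complete du cau.
exists w => // x dx.
have est n : (ip (u n) x - l x) ^+ 2 <= n.+1%:R^-1 * ip x x.
  apply: quad_disc => t.
  have := mJ _ (hdomD (du n) (hdomZ t dx)).
  have := Ju n.
  rewrite /J hip_quad // [u n + _]addrC llin //.
  by move: (n.+1%:R^-1) => p; lra.
have bnd (e : R) : 0 < e -> (ip w x - l x) ^+ 2 <= 2 * (e * ip x x + e * ip x x).
  move=> e0.
  have [N1 h1] := hw _ e0; have [N2 h2] := small _ e0.
  have := est (maxn N1 N2).
  have := h1 _ (leq_maxl N1 N2); have := h2 _ (leq_maxr N1 N2).
  set n := maxn N1 N2 => n2 n1 es.
  have dd := hdomB (du n) dw.
  have cs := hip_CS dd dx.
  have : ip (u n - w) x ^+ 2 <= e * ip x x.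
    rewrite -[leLHS]real_normK ?num_real // (le_trans (_ : _ <= (nm (u n - w) * nm x) ^+ 2)) //.
      by rewrite ler_pXn2r // nnegrE // mulr_ge0 // hnorm_ge0.
    rewrite exprMn !hnorm_sqr //; apply: ler_wpM2r; first exact: hip_ge0.
    exact: ltW.
  rewrite hipBl // => h3.
  have h4 : (ip (u n) x - l x) ^+ 2 <= e * ip x x.
    by apply: le_trans es _; apply: ler_wpM2r; [exact: hip_ge0 | exact: ltW].
  have := sqr_ge0 ((ip (u n) x - ip w x) + (ip (u n) x - l x)).
  nra.
apply/eqP; rewrite -subr_eq0 -sqrf_eq0 eq_le sqr_ge0 andbT.
apply/ler_addgt0Pr => e e0; rewrite add0r.
have p : 0 < e / (4 * (ip x x + 1)).
  by rewrite divr_gt0 // mulr_gt0 // ltr_wpDl // hip_ge0.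
apply: le_trans (bnd _ p) _.
have q0 := hip_ge0 dx.
have -> : 2 * (e / (4 * (ip x x + 1)) * ip x x + e / (4 * (ip x x + 1)) * ip x x) =
  e * (ip x x / (ip x x + 1)) by field; lra.
rewrite -[leRHS]mulr1; apply: ler_wpM2l; first exact: ltW.
rewrite ler_pdivrMr; lra.
Qed.

End hilbert_theory.

Section lax_milgram.
Context {R : realType} {X : lmodType R} (H : hilbert X).
Local Notation dom := (hdom H).
Local Notation ip := (hip H).
Local Notation nm := (hnorm H).
Variables (a : X -> X -> R) (M alpha : R).
Hypothesis a_linl : forall c x y z, dom x -> dom y -> dom z ->
  a (c *: x + y) z = c * a x z + a y z.
Hypothesis a_linr : forall c x y z, dom x -> dom y -> dom z ->
  a z (c *: x + y) = c * a z x + a z y.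
Hypothesis a_bnd : forall x y, dom x -> dom y -> `|a x y| <= M * nm x * nm y.
Hypothesis alpha_gt0 : 0 < alpha.
Hypothesis a_coer : forall x, dom x -> alpha * ip x x <= a x x.

(** Let T x and r represent a x and l.  The form ip (T x) (T y) is an inner
product equivalent to ip, and a vector w that represents v |-> ip r (T v) in
it satisfies ip (T w - r) (T v) = 0 for all v; with v = T w - r, coercivity
shows that T w - r is a null vector. *)
Theorem lax_milgram (l : X -> R) (C : R) :
  (forall c x y, dom x -> dom y -> l (c *: x + y) = c * l x + l y) ->
  (forall x, dom x -> `|l x| <= C * nm x) ->
  exists2 w, dom w & forall v, dom v -> a w v = l v.
Proof.
move=> llin lC.
have Tex x : exists y, dom x -> dom y /\ forall v, dom v -> ip y v = a x v.
  have [dx|ndx] := pselect (dom x); last by exists 0.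
  have [| |y dy hy] := @riesz _ _ H (a x) (M * nm x); last by exists y.
  - by move=> c y z dy dz; exact: a_linr.
  - by move=> y dy; exact: a_bnd.
have [T hT] := choice Tex.
have dT x : dom x -> dom (T x) by move=> /hT[].
have TE x v : dom x -> dom v -> ip (T x) v = a x v by move=> /hT[_]; apply.
(* An equivalent inner product, by boundedness (Thi) and coercivity (Tlow). *)
pose ip' x y := ip (T x) (T y).
have Tlow x : dom x -> alpha ^+ 2 * ip x x <= ip' x x.
  move=> dx; rewrite /ip'; have := hip_CS (dT _ dx) dx; rewrite TE // => cs.
  have {cs} := le_trans (ler_norm _) cs.
  move/(le_trans (a_coer dx)); rewrite -!hnorm_sqr //; last exact: dT.
  have := hnorm_ge0 H x; have := hnorm_ge0 H (T x).
  set p := nm x; set q := nm (T x) => q0 p0 h.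
  rewrite -exprMn ler_pXn2r // ?nnegrE ?mulr_ge0 ?(ltW alpha_gt0) //.
  have [->|p1] := eqVneq p 0; first by rewrite mulr0.
  have {}p1 : 0 < p by rewrite lt_neqAle eq_sym p1.
  by rewrite -(ler_pM2r p1) -mulrA -expr2.
have Thi x : dom x -> ip' x x <= M ^+ 2 * ip x x.
  move=> dx; have dTx := dT _ dx; rewrite /ip' -!hnorm_sqr //.
  have : nm (T x) ^+ 2 <= M * nm x * nm (T x).
    by rewrite hnorm_sqr // TE // (le_trans (ler_norm _)) // a_bnd.
  set q := nm (T x); set p := nm x => h.
  have := sqr_ge0 (q - M * p); nra.
have ip'C x y : ip' x y = ip' y x by rewrite /ip' hipC.
have ip'lin c x y z : dom x -> dom y -> dom z ->
    ip' (c *: x + y) z = c * ip' x z + ip' y z.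
  move=> dx dy dz; have dTz := dT _ dz; rewrite /ip' !TE ?a_linl //.
  exact: hdom_lin.
have ip'ge x : dom x -> 0 <= ip' x x by move=> dx; apply: hip_ge0; exact: dT.
have a2 : 0 < alpha ^+ 2 by exact: exprn_gt0.
have ip'comp (u : nat -> X) : (forall n, dom (u n)) ->
    (forall e, 0 < e -> exists N, forall m n, (N <= m)%N -> (N <= n)%N ->
       ip' (u m - u n) (u m - u n) < e) ->
    exists2 x, dom x & forall e, 0 < e -> exists N, forall n, (N <= n)%N ->
       ip' (u n - x) (u n - x) < e.
  move=> du cu; have [|x dx hx] := @hip_complete _ _ H u du.
    move=> e e0; have [|N hN] := cu (alpha ^+ 2 * e); first exact: mulr_gt0.
    exists N => m n Nm Nn; rewrite -(ltr_pM2l a2).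
    exact: le_lt_trans (Tlow _ (hdomB (du m) (du n))) (hN _ _ Nm Nn).
  exists x => // e e0.
  have M0 : 0 < M ^+ 2 + 1 by rewrite ltr_wpDl // sqr_ge0.
  have [|N hN] := hx (e / (M ^+ 2 + 1)); first exact: divr_gt0.
  exists N => n Nn; have := hN _ Nn; have dd := hdomB (du n) dx.
  rewrite ltr_pdivlMr //; apply: le_lt_trans; apply: le_trans (Thi _ dd) _.
  rewrite mulrC ler_wpM2l ?hip_ge0 // lerDl //.
pose H' := Hilbert (@hdom0 _ _ H) (@hdom_lin _ _ H) ip'C ip'lin ip'ge ip'comp.
have [r dr hr] := riesz llin lC.
have [| |w dw hw] := @riesz _ _ H' (fun v => ip r (T v)) (nm r).
- move=> c x y dx dy /=; rewrite !(hipC H r) !TE ?a_linl //.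
  exact: hdom_lin.
- move=> x dx /=; apply: le_trans (hip_CS dr (dT _ dx)) _.
  by rewrite ler_wpM2l ?hnorm_ge0.
exists w => // v dv; rewrite /= in dw hw.
have dTw := dT _ dw; have dz := hdomB dTw dr; have dTz := dT _ dz.
set z := T w - r in dz.
have z0 : ip z (T z) = 0.
  by rewrite {1}/z hipBl //; have := hw _ dz; rewrite /ip' => ->; rewrite subrr.
have zz : ip z z = 0.
  apply/eqP; rewrite eq_le hip_ge0 // andbT -(ler_pM2l alpha_gt0) mulr0.
  by rewrite (le_trans (a_coer dz)) // -TE // hipC z0.
have zv : ip z v = 0.
  apply/eqP; rewrite -normr_eq0 eq_le normr_ge0 andbT.
  by rewrite (le_trans (hip_CS dz dv)) // /hnorm zz sqrtr0 mul0r.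
by move: zv; rewrite /z hipBl // TE // hr // => /eqP; rewrite subr_eq0 => /eqP.
Qed.
End lax_milgram.

Section closure.
Context {R : realType} {X : lmodType R} (H : hilbert X) (S : set X).
Local Notation nm := (hnorm H).
Hypothesis S0 : S 0.
Hypothesis S_lin : forall a x y, S x -> S y -> S (a *: x + y).
Hypothesis S_dom : S `<=` hdom H.

Definition hclosure : set X :=
  [set x | hdom H x /\ forall e, 0 < e -> exists2 y, S y & nm (x - y) < e].

Lemma sub_hclosure : S `<=` hclosure.
Proof.
move=> x Sx; split; first exact: S_dom.
by move=> e e0; exists x => //; rewrite subrr /hnorm hip0l ?sqrtr0 //; exact: hdom0.
Qed.

Let dom0 : hclosure 0.
Proof. exact: sub_hclosure. Qed.

Let dom_lin a x y : hclosure x -> hclosure y -> hclosure (a *: x + y).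
Proof.
move=> [dx hx] [dy hy]; split; first exact: hdom_lin.
move=> e e0.
have a0 : 0 < `|a| + 1 by rewrite ltr_wpDl.
have [|x' Sx' xx'] := hx (e / 2 / (`|a| + 1)); first by rewrite !divr_gt0.
have [|y' Sy' yy'] := hy (e / 2); first by rewrite divr_gt0.
exists (a *: x' + y'); first exact: S_lin.
have dxx : hdom H (x - x') by apply: hdomB => //; exact: S_dom.
have dyy : hdom H (y - y') by apply: hdomB => //; exact: S_dom.
have -> : a *: x + y - (a *: x' + y') = a *: (x - x') + (y - y').
  by rewrite scalerBr opprD addrACA.
apply: le_lt_trans (hnormD (hdomZ a dxx) dyy) _.
rewrite hnormZ // [ltRHS](splitr e) ler_ltD //.
move: xx'; rewrite ltr_pdivlMr // => /ltW; apply: le_trans.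
by rewrite mulrC ler_wpM2l ?hnorm_ge0 // lerDl.
Qed.

Let complete (u : nat -> X) : (forall n, hclosure (u n)) ->
  (forall e, 0 < e -> exists N, forall m n, (N <= m)%N -> (N <= n)%N ->
     hip H (u m - u n) (u m - u n) < e) ->
  exists2 x, hclosure x & forall e, 0 < e -> exists N, forall n, (N <= n)%N ->
     hip H (u n - x) (u n - x) < e.
Proof.
move=> du cu.
have [|x dx hx] := @hip_complete _ _ H u _ cu; first by move=> n; case: (du n).
exists x => //; split=> // e e0.
have [|N hN] := hx ((e / 2) ^+ 2); first by rewrite exprn_gt0 // divr_gt0.
have := hN N (leqnn N).
have dd : hdom H (u N - x) by apply: hdomB => //; case: (du N).
have e2 : 0 < e / 2 by rewrite divr_gt0.
rewrite -hnorm_lt ?(ltW e2) // => h.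
have [_ /(_ _ e2)[y Sy uy]] := du N.
exists y => //; have dy := S_dom Sy.
rewrite -(subrKA (u N)) (splitr e).
apply: le_lt_trans (hnormD _ _) _; first by apply: hdomB => //; case: (du N).
  by apply: hdomB => //; case: (du N).
by rewrite ltrD // hnormBC //; case: (du N).
Qed.

Definition hilbert_closure : hilbert X :=
  Hilbert dom0 dom_lin (@hipC _ _ H)
    (fun a x y z (dx : hclosure x) (dy : hclosure y) (dz : hclosure z) =>
       hip_lin a dx.1 dy.1 dz.1)
    (fun x (dx : hclosure x) => hip_ge0 dx.1) complete.

End closure.

(** * Square-integrable functions *)

Section square_integrable.
Context d (T : measurableType d) (R : realType).
Variables (mu : {measure set T -> \bar R}) (D : set T).
Hypothesis mD : measurable D.
Implicit Types f g : T -> R.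

Definition sqint f : Prop :=
  measurable_fun D f /\ mu.-integrable D (fun x => (f x ^+ 2)%:E).

Definition l2ip f g : R := \int[mu]_(x in D) (f x * g x).

Lemma sqint_mul f g : sqint f -> sqint g ->
  mu.-integrable D (EFin \o (fun x => f x * g x)).
Proof.
move=> [mf If] [mg Ig].
apply: (le_integrable mD _ _ (integrableD mD If Ig)).
  by apply/measurable_EFinP; exact: measurable_funM.
move=> x _ /=; rewrite lee_fin [leRHS]ger0_norm ?addr_ge0 ?sqr_ge0 //.
by rewrite ler_norml; have := sqr_ge0 (f x + g x); have := sqr_ge0 (f x - g x);
   move=> h1 h2; apply/andP; split; nra.
Qed.

Lemma sqint0 : sqint (fun=> 0).
Proof.
split; first exact: measurable_cst.
by under eq_fun do rewrite expr0n /=; exact: integrable0.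
Qed.

Lemma sqint_lin a f g : sqint f -> sqint g -> sqint (fun x => a * f x + g x).
Proof.
move=> sf sg; have [mf If] := sf; have [mg Ig] := sg.
have mfg : measurable_fun D (fun x => a * f x + g x).
  by apply: measurable_funD => //; exact: measurable_funM.
split=> //.
have := integrableD mD (integrableZl mD (2 * a ^+ 2) If) (integrableZl mD 2 Ig).
apply: (le_integrable mD).
  by apply/measurable_EFinP; exact: measurable_funX.
move=> x _ /=; rewrite lee_fin !ger0_norm ?sqr_ge0 //; last first.
  by rewrite addr_ge0 // mulr_ge0 ?sqr_ge0 // mulr_ge0 ?sqr_ge0.
have := sqr_ge0 (a * f x - g x); nra.
Qed.

Lemma sqintZ a f : sqint f -> sqint (fun x => a * f x).
Proof. by move=> sf; have := sqint_lin a sf sqint0; under eq_fun do rewrite addr0. Qed.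

Lemma sqintB f g : sqint f -> sqint g -> sqint (fun x => f x - g x).
Proof.
by move=> sf sg; have := sqint_lin (-1) sg sf; under eq_fun do rewrite mulN1r addrC.
Qed.

Lemma sqint_bounded_mul (M : R) g f : measurable_fun D g ->
  (forall x, D x -> `|g x| <= M) -> sqint f -> sqint (fun x => g x * f x).
Proof.
move=> mg gM [mf If]; split; first exact: measurable_funM.
have := integrableZl mD (M ^+ 2) If; apply: (le_integrable mD).
  by apply/measurable_EFinP; apply: measurable_funX; exact: measurable_funM.
move=> x Dx /=; rewrite lee_fin ger0_norm ?sqr_ge0 // ger0_norm; last by rewrite mulr_ge0 ?sqr_ge0.
rewrite exprMn.
rewrite ler_wpM2r ?sqr_ge0 // -[leLHS]real_normK ?num_real //.
by rewrite ler_pXn2r // ?nnegrE ?gM //; exact: le_trans (gM _ Dx).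
Qed.

Lemma l2ipC f g : l2ip f g = l2ip g f.
Proof. by apply: eq_Rintegral => x _; rewrite mulrC. Qed.

Lemma l2ip_lin a f g h : sqint f -> sqint g -> sqint h ->
  l2ip (fun x => a * f x + g x) h = a * l2ip f h + l2ip g h.
Proof.
move=> sf sg sh; rewrite /l2ip -RintegralZl //; last exact: sqint_mul.
rewrite -RintegralD //; last exact: sqint_mul.
  by apply: eq_Rintegral => x _; rewrite mulrDl mulrA.
have := integrableZl mD a (sqint_mul sf sh); apply: eq_integrable => // x _.
Qed.

Lemma l2ip_ge0 f : 0 <= l2ip f f.
Proof. by apply: Rintegral_ge0 => x _; rewrite -expr2 sqr_ge0. Qed.

Lemma l2ip_EFin f : sqint f -> (l2ip f f)%:E = (\int[mu]_(x in D) (f x ^+ 2)%:E)%E.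
Proof.
move=> [_ If]; rewrite /l2ip /Rintegral fineK; first by [].
exact: integrable_fin_num.
Qed.

(** Riesz-Fischer.  Along a fast subsequence v with increments h_k the function
C = sum_k 4^k h_k^2 is integrable.  Where C is finite, |h_k| <= sqrt C / 2^k,
so that v converges there, and C dominates the error. *)
Lemma l2_complete (u : nat -> T -> R) : (forall n, sqint (u n)) ->
  (forall e, 0 < e -> exists N, forall m n, (N <= m)%N -> (N <= n)%N ->
     l2ip (fun x => u m x - u n x) (fun x => u m x - u n x) < e) ->
  exists2 v, sqint v & forall e, 0 < e -> exists N, forall n, (N <= n)%N ->
     l2ip (fun x => u n x - v x) (fun x => u n x - v x) < e.
Proof.
move=> su cu.
(* The factor 4^k is spent on the weights of C, the factor 2^(k+1) makes the
   integral of C finite. *)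
pose dl k : R := (4 ^+ k * 2 ^+ k.+1)^-1.
have dl0 k : 0 < dl k by rewrite invr_gt0 mulr_gt0 // exprn_gt0.
have [N0 hN0] := choice (fun k => cu _ (dl0 k)).
pose N k := (\sum_(j < k.+1) (N0 j).+1)%N.
have NN0 k : (N0 k <= N k)%N by rewrite /N big_ord_recr /= addnS ltnW // ltnS leq_addl.
have Nmono k : (N k <= N k.+1)%N by rewrite /N [leqRHS]big_ord_recr /= leq_addr.
pose v k := u (N k).
have sv k : sqint (v k) by exact: su.
pose h k x := v k.+1 x - v k x.
have sh k : sqint (h k) by exact: sqintB.
pose g k x : \bar R := (4 ^+ k * h k x ^+ 2)%:E.
have mg k : measurable_fun D (g k).
  apply/measurable_EFinP; apply: measurable_funM => //.
  by apply: measurable_funX; case: (sh k).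
have g0 k x : (0 <= g k x)%E by rewrite lee_fin mulr_ge0 ?sqr_ge0 // exprn_ge0.
pose C x : \bar R := (\sum_(k <oo) g k x)%E.
have mC : measurable_fun D C by apply: ge0_emeasurable_sum => //.
have C0 x : (0 <= C x)%E by apply: nneseries_ge0.
have Cfin : (\int[mu]_(x in D) C x < +oo)%E.
  rewrite integral_nneseries //.
  apply: (@le_lt_trans _ _ (\sum_(k <oo) (1 / (2 ^ (k + 1))%:R)%:E)%E); last first.
    by rewrite (cvg_lim _ (@cvg_geometric_eseries_half R 1 0)) // ltry.
  apply: lee_nneseries => [k _|k _]; first by move=> _; apply: integral_ge0.
  under eq_integral do rewrite /g EFinM.
  have [_ Ih] := sh k.
  rewrite integralZl // -l2ip_EFin // -EFinM lee_fin.
  have := hN0 k (N k.+1) (N k) (leq_trans (NN0 k) (Nmono k)) (NN0 k).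
  move=> /ltW /(ler_wpM2l (exprn_ge0 k (ler0n R 4))) /le_trans; apply.
  rewrite /dl invfM mulrA divff ?gt_eqF ?exprn_gt0 // mul1r div1r addn1 natrX.
  by [].
have IC : mu.-integrable D C.
  apply/integrableP; split=> //.
  by under eq_integral do rewrite gee0_abs //.
pose A := D `&` [set x | (C x < +oo)%E].
have mA : measurable A by apply: emeasurable_fun_infty_o.
pose w k x := v k x * \1_A x.
have gC k x : (g k x <= C x)%E.
  by apply: le_trans (nneseries_lim_ge k.+1 _) => //; rewrite big_nat_recr //= leeDr // sume_ge0.
have stepA x k : A x -> `|h k x| <= Num.sqrt (fine (C x)) * 2^-1 ^+ k.
  move=> [Dx]; rewrite /= => Cx.
  have cfin : C x \is a fin_num by rewrite ge0_fin_numE.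
  have gk : 4 ^+ k * h k x ^+ 2 <= fine (C x) by rewrite -lee_fin fineK //; exact: gC.
  rewrite -(@ler_pXn2r _ 2) // ?nnegrE ?mulr_ge0 ?sqrtr_ge0 ?exprn_ge0 //.
  rewrite real_normK ?num_real // exprMn sqr_sqrtr ?fine_ge0 //.
  rewrite -exprM mulnC exprM (_ : 2^-1 ^+ 2 = 4^-1); last by field.
  by rewrite exprVn ler_pdivlMr ?exprn_gt0 // mulrC.
have tailA x k j : A x ->
    `|v (k + j)%N x - v k x| <= 2 * Num.sqrt (fine (C x)) * (2^-1 ^+ k - 2^-1 ^+ (k + j)).
  move=> Ax; elim: j => [|j IH]; first by rewrite addn0 !subrr normr0 mulr0.
  rewrite addnS -(subrKA (v (k + j)%N x)).
  apply: le_trans (ler_normD _ _) _.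
  have := stepA x (k + j)%N Ax; rewrite /h exprS.
  set c := Num.sqrt _ in IH *; set q := 2^-1 ^+ (k + j) in IH * => h1.
  lra.
have half0 (e : R) : 0 < e -> exists k, 2^-1 ^+ k < e.
  move=> e0; have /cvgrPdist_lt/(_ _ e0) : (fun n => (2^-1 : R) ^+ n) @ \oo --> 0.
    by apply: cvg_expr; rewrite ger0_norm; lra.
  by move=> [k _ /(_ k (leqnn _))]; rewrite sub0r normrN ger0_norm ?exprn_ge0 //; exists k.
have cvgw x : cvgn (w ^~ x).
  have [Ax|nAx] := pselect (A x); last first.
    rewrite (_ : w ^~ x = fun=> 0); first exact: is_cvg_cst.
    by apply/funext => k; rewrite /w indicE memNset // mulr0.
  rewrite (_ : w ^~ x = v ^~ x); last first.
    by apply/funext => k; rewrite /w indicE mem_set // mulr1.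
  apply: cauchy_cvg; apply: cauchy_exP => e e0 /=.
  have c0 : 0 < 2 * Num.sqrt (fine (C x)) + 1 by rewrite ltr_wpDl // mulr_ge0 ?sqrtr_ge0.
  have [|k hk] := half0 (e / (2 * Num.sqrt (fine (C x)) + 1)); first exact: divr_gt0.
  exists (v k x); exists k => // m /= km; rewrite /ball /= distrC.
  have := tailA x k (m - k)%N Ax; rewrite subnKC // => /le_lt_trans; apply.
  move: hk; rewrite ltr_pdivlMr //.
  have : 0 <= (2^-1 : R) ^+ m by rewrite exprn_ge0.
  have : 0 <= Num.sqrt (fine (C x)) by exact: sqrtr_ge0.
  have : 0 <= (2^-1 : R) ^+ k by rewrite exprn_ge0.
  nra.
pose lm x := limn (w ^~ x).
have cvglm x : w ^~ x @ \oo --> lm x by exact: cvgw.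
have mlm : measurable_fun D lm.
  apply: (measurable_fun_cvg (h := w)) => // k.
  by apply: measurable_funM; [case: (sv k) | exact: measurable_indic].
have bnd k x : D x -> (((v k x - lm x) ^+ 2)%:E <= (4 * 4^-1 ^+ k)%:E * C x)%E.
  move=> Dx; have [Cx|] := ltP (C x) +oo%E; last first.
    rewrite leye_eq => /eqP ->; rewrite gt0_muley ?leey //.
  have Ax : A x by [].
  have cfin : C x \is a fin_num by rewrite ge0_fin_numE.
  have c0 := sqrtr_ge0 (fine (C x)).
  have h1 : `|v k x - lm x| <= 2 * Num.sqrt (fine (C x)) * 2^-1 ^+ k.
    have h2 : `|v k x - w n x| @[n --> \oo] --> `|v k x - lm x|.
      by apply: cvg_norm; apply: cvgB; [exact: cvg_cst | exact: cvglm].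
    apply: (cvgr_to_le h2).
    exists k => // m /= km; rewrite /w indicE mem_set // mulr1 distrC.
    have := tailA x k (m - k)%N Ax; rewrite subnKC // => /le_trans; apply.
    have : 0 <= (2^-1 : R) ^+ m by rewrite exprn_ge0.
    nra.
  rewrite -(fineK cfin) -EFinM lee_fin -[leLHS]real_normK ?num_real //.
  apply: le_trans (_ : (2 * Num.sqrt (fine (C x)) * 2^-1 ^+ k) ^+ 2 <= _).
    by rewrite ler_pXn2r // nnegrE // !mulr_ge0 ?exprn_ge0.
  rewrite !exprMn sqr_sqrtr ?fine_ge0 // -exprM mulnC exprM.
  rewrite (_ : 2^-1 ^+ 2 = 4^-1); last by field.
  rewrite (_ : 2 ^+ 2 = 4); last by ring.
  by rewrite -mulrA [fine _ * _]mulrC mulrA.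
have sd k : sqint (fun x => v k x - lm x).
  split; first by apply: measurable_funB => //; case: (sv k).
  apply: (le_integrable mD _ _ (integrableZl mD (4 * 4^-1 ^+ k) IC)).
    by apply/measurable_EFinP; apply: measurable_funX; apply: measurable_funB => //; case: (sv k).
  move=> x Dx; rewrite gee0_abs ?lee_fin ?sqr_ge0 //.
  by apply: le_trans (bnd _ _ Dx) _; rewrite lee_abs.
have slm : sqint lm.
  have := sqintB (sv 0%N) (sd 0%N).
  by under eq_fun do rewrite opprB addrC subrK.
exists lm => // e e0.
have IC0 : 0 <= fine (\int[mu]_(x in D) C x)%E by apply: fine_ge0; exact: integral_ge0.
set I := fine _ in IC0.
have tl k : l2ip (fun x => v k x - lm x) (fun x => v k x - lm x) <= 4 * 4^-1 ^+ k * I.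
  rewrite -lee_fin l2ip_EFin // EFinM /I fineK; last exact: integrable_fin_num.
  rewrite -integralZl //; apply: ge0_le_integral => //.
  - by move=> x _; rewrite lee_fin sqr_ge0.
  - by apply/measurable_EFinP; apply: measurable_funX; case: (sd k).
  - exact: measurable_funeM.
  - by move=> x Dx; exact: bnd.
have [N1 hN1] := cu (e / 4) (divr_gt0 e0 (ltr0Sn _ 3)).
have [k1 hk1] := half0 (e / 4 / (4 * I + 1)) (divr_gt0 (divr_gt0 e0 (ltr0Sn _ 3)) (ltr_wpDl (mulr_ge0 (ler0n _ 4) IC0) ltr01)).
exists N1 => n N1n.
pose k := (k1 + N1)%N.
have Nk : (N1 <= N k)%N.
  have kN j : (j <= N j)%N.
    elim: j => // j IH; rewrite /N big_ord_recr /= -/(N j) addnS ltnS.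
    exact: leq_trans IH (leq_addr _ _).
  exact: leq_trans (leq_addl _ _) (kN _).
have dA : sqint (fun x => u n x - v k x) by exact: sqintB.
have dB := sd k.
have -> : (fun x => u n x - lm x) = (fun x => 1 * (u n x - v k x) + (v k x - lm x)).
  by apply/funext => x; rewrite mul1r subrKA.
have dAB := sqint_lin 1 dA dB.
rewrite l2ip_lin // mul1r ![l2ip _ (fun x => 1 * _ + _)]l2ipC !l2ip_lin // !mul1r.
have hA := hN1 _ _ N1n Nk.
have hB : l2ip (fun x => v k x - lm x) (fun x => v k x - lm x) < e / 4.
  apply: le_lt_trans (tl k) _.
  have I1 : 0 < 4 * I + 1 by lra.
  move: hk1; rewrite ltr_pdivlMr //; apply: le_lt_trans.
  rewrite (_ : 4 * _ * I = 4^-1 ^+ k * (4 * I)); last by ring.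
  apply: ler_pM; rewrite ?mulr_ge0 ?exprn_ge0 //; last by rewrite lerDl.
  apply: (@le_trans _ _ (2^-1 ^+ k)).
    by apply: lerXn2r; rewrite ?nnegrE //; lra.
  by rewrite /k exprD ler_piMr ?exprn_ge0 // exprn_ile1 //; lra.
have := l2ip_ge0 (fun x => (-1) * (u n x - v k x) + (v k x - lm x)).
rewrite l2ip_lin //; last exact: sqint_lin.
rewrite ![l2ip _ (fun x => -1 * _ + _)]l2ipC !l2ip_lin //.
rewrite -/(v k) in hA; rewrite (l2ipC (fun x => v k x - lm x) (fun x => u n x - v k x)).
lra.
Qed.
End square_integrable.

Section l2_family.
Context d (T : measurableType d) (R : realType) (I : finType).
Variables (mu : {measure set T -> \bar R}) (D : set T).
Hypothesis mD : measurable D.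
Local Notation X := (I -> T -> R).

Let dom : set X := [set x | forall i, sqint mu D (x i)].
Let ip (x y : X) : R := \sum_i l2ip mu D (x i) (y i).

Let dom0 : dom 0.
Proof. by move=> i; exact: sqint0. Qed.

Let dom_lin a (x y : X) : dom x -> dom y -> dom (a *: x + y).
Proof. by move=> dx dy i; exact: (sqint_lin mD a (dx i) (dy i)). Qed.

Let ipC x y : ip x y = ip y x.
Proof. by apply: eq_bigr => i _; rewrite l2ipC. Qed.

Let ip_lin a (x y z : X) : dom x -> dom y -> dom z ->
  ip (a *: x + y) z = a * ip x z + ip y z.
Proof.
move=> dx dy dz; rewrite /ip mulr_sumr -big_split /=.
by apply: eq_bigr => i _; exact: (l2ip_lin mD a (dx i) (dy i) (dz i)).
Qed.

Let ip_ge0 x : dom x -> 0 <= ip x x.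
Proof. by move=> _; apply: sumr_ge0 => i _; exact: l2ip_ge0. Qed.

Let complete (u : nat -> X) : (forall n, dom (u n)) ->
  (forall e, 0 < e -> exists N, forall m n, (N <= m)%N -> (N <= n)%N ->
     ip (u m - u n) (u m - u n) < e) ->
  exists2 x, dom x & forall e, 0 < e -> exists N, forall n, (N <= n)%N ->
     ip (u n - x) (u n - x) < e.
Proof.
move=> du cu.
have comp i : exists v, sqint mu D v /\ forall e, 0 < e -> exists N, forall n,
    (N <= n)%N -> l2ip mu D (fun x => u n i x - v x) (fun x => u n i x - v x) < e.
  have [||v sv hv] := @l2_complete _ _ _ mu D mD (fun n => u n i).
  - by move=> n; exact: du.
  - move=> e e0; have [N hN] := cu e e0; exists N => m n Nm Nn.
    apply: le_lt_trans (hN _ _ Nm Nn).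
    by rewrite /ip (bigD1 i) //= lerDl sumr_ge0 // => j _; exact: l2ip_ge0.
  - by exists v.
have [v hv] := choice comp.
exists v => [i|e e0]; first by case: (hv i).
have e1 : 0 < e / (#|I|%:R + 1) by rewrite divr_gt0 // ltr_wpDl.
have [N hN] := choice (fun i => (hv i).2 _ e1).
exists (\max_i N i) => n Nn.
apply: (@le_lt_trans _ _ (\sum_(i in I) e / (#|I|%:R + 1))).
  apply: ler_sum => i _; apply: ltW; apply: hN.
  by apply: leq_trans Nn; exact: leq_bigmax.
rewrite sumr_const -[ltLHS]mulr_natr -mulrA -[ltRHS]mulr1 ltr_pM2l //.
by rewrite mulrC ltr_pdivrMr ?mul1r ?ltrDl // ltr_wpDl.
Qed.

Definition l2_hilbert : hilbert X :=
  Hilbert dom0 dom_lin ipC ip_lin ip_ge0 complete.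

Lemma l2_hnorm_sqr (x : X) : hnorm l2_hilbert x ^+ 2 = \sum_i l2ip mu D (x i) (x i).
Proof. by rewrite sqr_sqrtr //; apply: sumr_ge0 => i _; exact: l2ip_ge0. Qed.

End l2_family.

(** * Lebesgue measure and the divergence theorem on R^n *)

Section rV_borel.
Context {R : realType} {n : nat}.
Implicit Types (c x : 'rV[R]_n) (r : R).

Lemma rV_ballE c r : 0 < r ->
  ball c r = [set x | forall i, `|x ord0 i - c ord0 i| < r].
Proof.
move=> r0; apply/seteqP; split=> x /=.
  by move=> [_ h] i; have := h ord0 i; rewrite /ball /= distrC.
by move=> h; split => // i j; rewrite !(ord1 i) /ball /= distrC.
Qed.

Lemma measurable_rV_box (A : 'I_n -> set (measurableTypeR R)) :
  (forall i, measurable (A i)) ->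
  measurable [set x : 'rV[R]_n | forall i, A i (x ord0 i)].
Proof.
move=> mA; rewrite (_ : [set x | _] =
    \big[setI/setT]_(i < n) [set x : 'rV[R]_n | A i (x ord0 i)]); last first.
  apply/seteqP; split=> x /=.
    by move=> h; rewrite -bigcap_seq => i _; exact: h.
  by rewrite -bigcap_seq => h i; apply: (h i); rewrite /= mem_index_enum.
apply: bigsetI_measurable => i _.
have := @measurable_coor R n i measurableT (A i) (mA i).
by rewrite setTI.
Qed.

Lemma rV_ball_measurable c r : 0 < r -> measurable (ball c r).
Proof.
move=> r0; rewrite rV_ballE //.
apply: (measurable_rV_box (A := fun i => [set t : R | `|t - c ord0 i| < r])) => i.
rewrite (_ : [set t | _] = `](c ord0 i - r), (c ord0 i + r)[%classic).
  exact: measurable_itv.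
by apply/seteqP; split=> t /=; rewrite in_itv /= ltr_distl.
Qed.

Lemma rat_rV_dense c r : 0 < r -> exists q : 'rV[rat]_n,
  forall i, `|c ord0 i - ratr (q ord0 i)| < r.
Proof.
move=> r0.
have ex i : exists q : rat, `|c ord0 i - ratr q| < r.
  have [|q] := @rat_in_itvoo R (c ord0 i - r) (c ord0 i + r); first by lra.
  by rewrite in_itv /= -ltr_distl distrC => h; exists q.
have [q hq] := choice ex.
by exists (\row_i q i) => i; rewrite mxE.
Qed.

Definition cube c r : set 'rV[R]_n := [set x | forall i, `|x ord0 i - c ord0 i| <= r].

(** Rational centres and radii 1 / (k + 1) suffice.  The closed cubes have to lie
in U as well, for bump functions living on them to be test functions of U. *)
Lemma open_bigcup_balls (U : set 'rV[R]_n) : open U ->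
  exists B : nat -> set 'rV[R]_n, U = \bigcup_k B k /\
    forall k, B k = set0 \/ exists c r, [/\ 0 < r, B k = ball c r & cube c r `<=` U].
Proof.
move=> oU.
pose cc (p : 'rV[rat]_n * nat) : 'rV[R]_n := \row_i ratr (p.1 ord0 i).
pose rr (p : 'rV[rat]_n * nat) : R := p.2.+1%:R^-1.
have rr0 p : 0 < rr p by rewrite invr_gt0.
pose B k := if unpickle k is Some p then
   if `[< cube (cc p) (rr p) `<=` U >] then ball (cc p) (rr p) else set0 else set0.
have hB k : B k = set0 \/ exists c r, [/\ 0 < r, B k = ball c r & cube c r `<=` U].
  rewrite /B; case: unpickle => [p|]; last by left.
  by case: asboolP => h; [right; exists (cc p), (rr p) | left].
exists B; split=> //; apply/seteqP; split=> x; last first.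
  move=> [k _]; have [->//|[c [r [r0 -> cU]]]] := hB k.
  by rewrite rV_ballE // => xc; apply: cU => i; exact: ltW.
move=> Ux; have : nbhs x U by rewrite nbhsE; exists U.
rewrite -nbhs_ballE => -[e /= e0 eU].
have [k kP] : exists k, k.+1%:R^-1 < e / 4.
  have e4 : 0 < e / 4 by rewrite divr_gt0.
  by have [N _ /(_ N (leqnn _)) hN] := near_infty_natSinv_lt (PosNum e4); exists N.
have [q hq] := rat_rV_dense x (rr0 (0 : 'rV[rat]_n, k)).
pose p := (q, k); have kp : rr p < e / 4 by [].
clear kP; exists (pickle p) => //=.
rewrite /B pickleK; have xp : ball (cc p) (rr p) x.
  by rewrite rV_ballE // => i; rewrite mxE; exact: hq.
rewrite asboolT // => y yp; apply: eU.
have y2 : ball (cc p) (2 * rr p) y.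
  have r0 := rr0 p; rewrite rV_ballE; last by rewrite mulr_gt0.
  by move=> i; apply: le_lt_trans (yp i) _; rewrite mulr2n mulrDl mul1r ltrDl.
apply: (@le_ball _ _ _ (rr p + 2 * rr p)); first by lra.
by apply: ball_triangle y2; exact: ball_sym.
Qed.

Lemma open_rV_measurable (U : set 'rV[R]_n) : open U -> measurable U.
Proof.
move=> /open_bigcup_balls[B [-> hB]]; apply: bigcup_measurable => k _.
by have [->//|[c [r [r0 -> _]]]] := hB k; exact: rV_ball_measurable.
Qed.

Lemma closed_rV_measurable (F : set 'rV[R]_n) : closed F -> measurable F.
Proof.
by move=> cF; rewrite -(setCK F); apply: measurableC; apply: open_rV_measurable; rewrite openC.
Qed.

Lemma continuous_rV_measurable (f : 'rV[R]_n -> R) : continuous f ->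
  measurable_fun setT f.
Proof.
move=> cf; apply: (measurability _ (RGenOInfty.measurableE R)).
move=> _ [_ [a ->] <-]; rewrite setTI; apply: open_rV_measurable.
by apply: open_comp => //; exact: interval_open.
Qed.

Lemma measurable_affine_rV r c : measurable_fun setT (fun x => r *: x + c).
Proof.
apply: measurable_fun_rV => i; under eq_fun do rewrite !mxE.
apply: measurable_funD => //; apply: measurable_funM => //; exact: measurable_coor.
Qed.

End rV_borel.

Section integral_rV.
Context {R : realType}.
Local Notation leb := (@lebesgue_rV R).
Local Notation leb1 := (@lebesgue_measure R).

Lemma ge0_integral_rVS n (f : 'rV[R]_n.+1 -> \bar R) : measurable_fun setT f ->
  (forall x, 0 <= f x)%E ->
  (\int[leb n.+1]_x f x = \int[leb1]_a \int[leb n]_y f (cons_rV (a, y)))%E.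
Proof.
move=> mf f0.
have mc := @measurable_cons_rV R n.
have := @ge0_integral_pushforward _ _ _ _ R _ mc (leb1 \x leb n)%E setT f measurableT mf (fun y _ => f0 y).
rewrite preimage_setT => ->.
rewrite fubini_tonelli1; [by []|exact: (measurableT_comp mf mc)|by move=> x; exact: f0].
Qed.

Lemma integral_rVS n (f : 'rV[R]_n.+1 -> R) : (leb n.+1).-integrable setT (EFin \o f) ->
  (\int[leb n.+1]_x (f x)%:E = \int[leb1]_a \int[leb n]_y (f (cons_rV (a, y)))%:E)%E
  /\ (\int[leb n.+1]_x (f x)%:E = \int[leb n]_y \int[leb1]_a (f (cons_rV (a, y)))%:E)%E.
Proof.
move=> If; have [mf foo] := integrableP _ _ _ If.
have mc := @measurable_cons_rV R n.
have Ic : (leb1 \x leb n)%E.-integrable setT ((EFin \o f) \o (@cons_rV R n)).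
  apply/integrableP; split; first exact: (measurableT_comp mf mc).
  have ma : measurable_fun setT (abse \o (EFin \o f)) by exact: measurableT_comp.
  move: foo; have := @ge0_integral_pushforward _ _ _ _ R _ mc (leb1 \x leb n)%E
    setT _ measurableT ma (fun y _ => abse_ge0 _).
  by rewrite preimage_setT => ->.
have := @integral_pushforward _ _ _ _ R _ mc (leb1 \x leb n)%E setT (EFin \o f) mf.
rewrite preimage_setT => /(_ Ic measurableT) /= E.
split; rewrite [LHS]E.
  by rewrite -(integral12_prod_meas1 Ic).
by rewrite -(integral21_prod_meas1 Ic).
Qed.

(** The scaled image measure agrees with the Lebesgue measure on half-open
intervals, hence everywhere. *)
Lemma ge0_integral_affine1 (l c : R) (g : measurableTypeR R -> \bar R) : 0 < l ->
  measurable_fun setT g -> (forall x, 0 <= g x)%E ->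
  (\int[leb1]_x g (l * x + c)%R = (l^-1)%:E * \int[leb1]_x g x)%E.
Proof.
move=> l0 mg g0.
pose phi : measurableTypeR R -> measurableTypeR R := fun x => l * x + c.
have mphi : measurable_fun setT phi.
  by apply: measurable_funD => //; exact: measurable_funM.
have l00 : (0 <= l) by exact: ltW.
have [pf pfE] : exists pf : {measure set (measurableTypeR R) -> \bar R},
    (forall A, pf A = leb1 (phi @^-1` A)) /\
    (\int[pf]_x g x = \int[leb1]_x g (phi x))%E.
  unshelve eexists (pushforward leb1 phi); first exact: mphi.
  split=> //.
  by rewrite (@ge0_integral_pushforward _ _ _ _ R phi mphi leb1 setT g measurableT mg (fun y _ => g0 y)) preimage_setT.
have mE A : measurable A -> leb1 A = mscale (NngNum l00) pf A.
  apply: lebesgue_measure_unique => X [[a b] _ <-] /=.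
  rewrite /mscale /= pfE.1.
  have -> : phi @^-1` `]a, b] = `]((a - c) / l), ((b - c) / l)]%classic.
    apply/seteqP; split=> x /=; rewrite !in_itv /= /phi ltr_pdivrMr // ler_pdivlMr //;
    move=> /andP[h1 h2]; apply/andP; split; lra.
  rewrite !lebesgue_measure_itv /= !lte_fin.
  rewrite ltr_pM2r ?invr_gt0 // ltrD2r; case: ifPn => _; last by rewrite mule0.
  rewrite -!EFinB -EFinM; congr EFin; field; exact: lt0r_neq0.
have -> : (\int[leb1]_x g x = \int[mscale (NngNum l00) pf]_x g x)%E.
  by apply: eq_measure_integral => A mA _; exact: mE.
by rewrite ge0_integral_mscale //= muleA -EFinM mulVf ?gt_eqF // mul1e pfE.2.
Qed.

(** One coordinate at a time, by Tonelli. *)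
Lemma ge0_integral_affine n (l : R) (c : 'rV[R]_n) (g : 'rV[R]_n -> \bar R) : 0 < l ->
  measurable_fun setT g -> (forall x, 0 <= g x)%E ->
  (\int[leb n]_x g (l *: x + c)%R = (l ^- n)%:E * \int[leb n]_x g x)%E.
Proof.
move=> l0; elim: n => [|n IH] in c g *.
  move=> mg g0; rewrite expr0 invr1 mul1e; apply: eq_integral => x _.
  by congr g; apply/rowP => -[].
move=> mg g0.
rewrite !ge0_integral_rVS //; last first.
  by apply: (measurableT_comp mg); exact: measurable_affine_rV.
have [G [GE mG G0]] : exists G : measurableTypeR R -> \bar R,
    [/\ forall a, G a = (\int[leb n]_y g (cons_rV (a, y)))%E,
        measurable_fun setT G & forall a, (0 <= G a)%E].
  exists (fun a => \int[leb n]_y g (cons_rV (a, y)))%E; split=> //.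
    have : measurable_fun setT (g \o @cons_rV R n).
      by apply: (measurableT_comp mg); exact: measurable_cons_rV.
    by move=> h; exact: (@measurable_fun_fubini_tonelli_F _ _ _ _ R (leb n) _ h (fun p => g0 _)).
  by move=> a; apply: integral_ge0 => y _; exact: g0.
pose c' : 'rV[R]_n := \row_j c ord0 (rshift 1 j).
have E (a : R) (y : 'rV[R]_n) :
    l *: cons_rV (a, y) + c = cons_rV (l * a + c ord0 ord0, l *: y + c').
  apply/rowP => i; rewrite mxE [X in X + _]mxE /cons_rV.
  have [j ->|j ->] := @split_ordP 1 n i.
    rewrite !(@row_mxEl _ 1 1 n) (ord1 j) !mxE eqxx !mulr1n.
    by congr (_ + c _ _); exact: val_inj.
  by rewrite !(@row_mxEr _ 1 1 n) !mxE.
transitivity (\int[leb1]_a ((l ^- n)%:E * G (l * a + c ord0 ord0)%R)%E)%E.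
  apply: eq_integral => a _; rewrite GE -(IH c').
  - by apply: eq_integral => y _; rewrite E.
  - apply: (measurableT_comp mg); apply: (measurableT_comp (@measurable_cons_rV R n)).
    exact: pair1_measurable.
  - by move=> y; exact: g0.
have mGa : measurable_fun setT (fun a : measurableTypeR R => G (l * a + c ord0 ord0)%R).
  apply: (measurableT_comp mG).
  by apply: measurable_funD => //; exact: measurable_funM.
have ln0 : (0 <= (l ^- n)%:E)%E by rewrite lee_fin invr_ge0 exprn_ge0 // ltW.
rewrite (ge0_integralZl leb1 measurableT mGa (fun _ _ => G0 _) ln0) //.
rewrite (ge0_integral_affine1 (c ord0 ord0) l0 mG G0).
rewrite muleA -EFinM -invfM -exprSr; congr (_ * _)%E.
by apply: eq_integral => a _; rewrite GE.
Qed.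
End integral_rV.

Section cube_measure.
Context {R : realType}.
Local Notation leb := (@lebesgue_rV R).

Lemma lebesgue_rV_ball n (c : 'rV[R]_n) (r : R) : 0 < r ->
  leb n (ball c r) = ((2 * r) ^+ n)%:E.
Proof.
move=> r0; elim: n => [|n IH] in c *.
  rewrite expr0 /= diracE mem_set //= rV_ballE // => -[] //.
pose c' : 'rV[R]_n := \row_j c ord0 (rshift 1 j).
transitivity ((@lebesgue_measure R \x leb n)%E (@cons_rV R n @^-1` ball c r)); first by [].
have -> : @cons_rV R n @^-1` ball c r =
    `](c ord0 ord0 - r), (c ord0 ord0 + r)[%classic `*` ball c' r.
  rewrite !rV_ballE //; apply/seteqP; split=> -[a y] /=.
    move=> h; split.
      rewrite in_itv /= -ltr_distl; have := h (lshift n (ord0 : 'I_1)).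
      rewrite /cons_rV (@row_mxEl _ 1 1 n) mxE eqxx mulr1n /=.
      by congr (`|_ - c _ _| < r); exact: val_inj.
    by move=> i; rewrite mxE; have := h (rshift 1 i); rewrite /cons_rV (@row_mxEr _ 1 1 n).
  move=> [ha hy] i; rewrite /cons_rV.
  have [j ->|j ->] := @split_ordP 1 n i.
    rewrite (@row_mxEl _ 1 1 n) (ord1 j) mxE eqxx mulr1n /=.
    move: ha; rewrite in_itv /= -ltr_distl.
    by congr (`|_ - c _ _| < r); exact: val_inj.
  by have := hy j; rewrite mxE (@row_mxEr _ 1 1 n).
rewrite product_measure1E //; last exact: rV_ball_measurable.
have E1 : lebesgue_measure `](c ord0 ord0 - r), (c ord0 ord0 + r)[%classic = (2 * r)%:E.
  rewrite lebesgue_measure_itv /= lte_fin ifT; last by lra.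
  by rewrite -EFinB; congr EFin; ring.
by rewrite exprS EFinM -(IH c') -E1.
Qed.

Lemma bounded_rV_ball n (A : set 'rV[R]_n) : bounded_set A ->
  exists2 r : R, 0 < r & A `<=` ball 0 r.
Proof.
move=> [M [_ hM]]; exists (`|M| + 2); first by rewrite ltr_wpDl.
move=> x Ax; rewrite mx_norm_ball /ball_ /= sub0r normrN.
have : `|x| <= `|M| + 1 by apply: hM => //; rewrite (le_lt_trans (ler_norm _)) // ltrDl.
by move/le_lt_trans; apply; rewrite ltrD2l ltr1n.
Qed.

Lemma bounded_rV_lty n (A : set 'rV[R]_n) : measurable A -> bounded_set A ->
  (leb n A < +oo)%E.
Proof.
move=> mA /bounded_rV_ball[r r0 Ar].
apply: le_lt_trans (le_measure _ _ _ Ar) _; rewrite ?inE //.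
  exact: rV_ball_measurable.
by rewrite [ltLHS](lebesgue_rV_ball 0 r0) ltry.
Qed.

End cube_measure.

Section divergence.
Context {R : realType}.
Local Notation leb := (@lebesgue_rV R).

Definition vanish_outside n (L : R) (g : 'rV[R]_n -> R) :=
  forall x : 'rV[R]_n, (exists j, L < `|x ord0 j|) -> g x = 0.

Lemma continuous_vanish_integrable n L (g : 'rV[R]_n -> R) : continuous g ->
  vanish_outside L g -> (leb n).-integrable setT (EFin \o g).
Proof.
move=> cg gL.
pose K := [set x : 'rV[R]_n | forall i, `[-L, L]%classic (x ord0 i)].
have cK : compact K by apply: (@rV_compact _ _ (fun=> `[-L, L]%classic)) => _; exact: segment_compact.
have [M [_ hM]] : bounded_set (g @` K).
  apply: compact_bounded; apply: continuous_compact => //.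
  exact: continuous_subspaceT.
have mK : measurable K by apply: closed_rV_measurable; apply: compact_closed => //; exact: norm_hausdorff.
have Kfin : (leb n K < +oo)%E by apply: bounded_rV_lty => //; exact: compact_bounded.
have gM x : `|g x| <= (`|M| + 1) * \1_K x.
  have [Kx|nKx] := pselect (K x).
    rewrite indicE mem_set // mulr1; apply: hM; last by exists x.
    by rewrite (le_lt_trans (ler_norm _)) // ltrDl.
  rewrite indicE memNset // mulr0 gL ?normr0 //.
  move/existsNP: nKx => [i]; rewrite /= in_itv /= => /negP.
  by rewrite -ler_norml -ltNge; exists i.
apply: (@le_integrable _ _ _ (leb n) _ measurableT _ (fun x => ((`|M| + 1) * \1_K x)%:E)).
- by apply/measurable_EFinP; exact: continuous_rV_measurable.
- by move=> x _ /=; rewrite lee_fin (le_trans (gM x)) // ler_norm.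
- under eq_fun do rewrite EFinM.
  apply: integrableZl => //; apply/integrableP; split.
    by apply/measurable_EFinP; exact: measurable_indic.
  under eq_integral do rewrite gee0_abs ?lee_fin //.
  by rewrite integral_indic // setIT.
Qed.

Lemma continuous_consr n (a : R) : continuous (fun y : 'rV[R]_n => cons_rV (a, y)).
Proof.
move=> y A /nbhs_ballP[e /= e0 eA].
apply: (@filterS _ (nbhs y) _ (ball y e)); last exact: nbhsx_ballx.
move=> z; rewrite rV_ballE // => hz; apply: eA; rewrite rV_ballE // => i; rewrite /cons_rV.
have [j ->|j ->] := @split_ordP 1 n i.
  by rewrite !(@row_mxEl _ 1 1 n) subrr normr0.
by rewrite !(@row_mxEr _ 1 1 n).
Qed.

Lemma continuous_consl n (y : 'rV[R]_n) : continuous (fun a : R => cons_rV (a, y)).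
Proof.
move=> a A /nbhs_ballP[e /= e0 eA].
apply: (@filterS _ (nbhs a) _ (ball a e)); last exact: nbhsx_ballx.
move=> b hb; apply: eA; rewrite rV_ballE // => i; rewrite /cons_rV.
have [j ->|j ->] := @split_ordP 1 n i.
  by rewrite !(@row_mxEl _ 1 1 n) !mxE (ord1 j) eqxx !mulr1n distrC.
by rewrite !(@row_mxEr _ 1 1 n) subrr normr0.
Qed.

Lemma cons_shift0 n (h a : R) (y : 'rV[R]_n) :
  cons_rV (h + a, y) = h *: delta_mx ord0 (lshift n (ord0 : 'I_1)) + cons_rV (a, y).
Proof.
apply/rowP => i; rewrite [RHS]mxE [X in _ = X + _]mxE [X in _ = _ * X + _]mxE /cons_rV.
have [j ->|j ->] := @split_ordP 1 n i.
  by rewrite !(@row_mxEl _ 1 1 n) !mxE (ord1 j) !eqxx !mulr1n mulr1.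
by rewrite !(@row_mxEr _ 1 1 n) eq_rlshift andbF mulr0 add0r.
Qed.

Lemma cons_shiftS n (h a : R) (y : 'rV[R]_n) j :
  cons_rV (a, h *: delta_mx ord0 j + y) = h *: delta_mx ord0 (rshift 1 j) + cons_rV (a, y).
Proof.
apply/rowP => i; rewrite [RHS]mxE [X in _ = X + _]mxE [X in _ = _ * X + _]mxE /cons_rV.
have [k ->|k ->] := @split_ordP 1 n i.
  by rewrite !(@row_mxEl _ 1 1 n) eq_lrshift andbF mulr0 add0r.
rewrite !(@row_mxEr _ 1 1 n) !mxE.
by rewrite eq_rshift.
Qed.

Lemma partial_vanish n (i : 'I_n) (psi : 'rV[R]_n -> R) L :
  vanish_outside L psi -> vanish_outside L (partial i psi).
Proof.
move=> v x [j hj]; rewrite /partial.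
have E : \near x, psi x = (cst 0 : _ -> R) x.
  have : nbhs x (ball x (`|x ord0 j| - L)) by apply: nbhsx_ballx; rewrite subr_gt0.
  apply: filterS => y; rewrite rV_ballE ?subr_gt0 // => /(_ j) h.
  apply: v; exists j.
  have := ler_dist_dist (x ord0 j) (y ord0 j).
  rewrite [X in _ <= X -> _]distrC.
  have := ler_norm (`|x ord0 j| - `|y ord0 j|).
  lra.
by rewrite (near_eq_derive _ E) derive_cst.
Qed.

Lemma integral_derive1_eq0 (L : R) (F f : R -> R) : continuous f ->
  (forall x : R, is_derive x (1 : R) F (f x)) -> (forall x, L < `|x| -> F x = 0) ->
  (forall x, L < `|x| -> f x = 0) ->
  (\int[lebesgue_measure]_x (f x)%:E = 0)%E.
Proof.
move=> cf dF F0 f0.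
have cF : continuous F.
  by move=> x; apply: differentiable_continuous; apply/derivable1_diffP; have [] := dF x.
pose M := `|L| + 1.
have LM : L < M by rewrite (le_lt_trans (ler_norm _)) // ltrDl.
have M0 : 0 < M by rewrite ltr_wpDl.
transitivity (\int[lebesgue_measure]_(x in `[(-M)%R, M]) (f x)%:E)%E.
  rewrite [RHS]integral_mkcond; apply: eq_integral => x _; rewrite patchE.
  case: ifPn => //; rewrite notin_setE /= in_itv /= => /negP; rewrite -ler_norml -ltNge => h.
  by rewrite f0 // (lt_trans LM).
rewrite (@continuous_FTC2 _ f F) //.
- rewrite !F0 ?subrr //; first by rewrite -EFinB subrr.
  + by rewrite normrN ger0_norm // ltW.
  + by rewrite ger0_norm // ltW.
- lra.
- exact: continuous_subspaceT.
- split.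
  + by move=> x _; have [] := dF x.
  + by apply: cvg_at_right_filter; exact: cF.
  + by apply: cvg_at_left_filter; exact: cF.
- by move=> x _; rewrite derive1E; have [_] := dF x.
Qed.

(** Integrating first in the direction of differentiation reduces this to the
fundamental theorem of calculus on a line. *)
Theorem integral_partial_eq0 n (i : 'I_n) (psi : 'rV[R]_n -> R) L :
  (forall x, derivable psi x (delta_mx ord0 i)) -> continuous (partial i psi) ->
  vanish_outside L psi -> (\int[leb n]_x (partial i psi x)%:E = 0)%E.
Proof.
elim: n i psi => [[]//|n IH] i psi dpsi cpsi vpsi.
have vpart := partial_vanish i vpsi.
have Ip := continuous_vanish_integrable cpsi vpart.
have [E1 E2] := integral_rVS Ip.
have [j ij|j ij] := @split_ordP 1 n i.
  rewrite E2; apply: integral0_eq => y _.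
  have ii : i = lshift n (ord0 : 'I_1) by rewrite ij (ord1 j).
  have cs0 (a : R) : cons_rV (a, y) ord0 i = a.
    by rewrite ii /cons_rV (@row_mxEl _ 1 1 n) mxE eqxx mulr1n.
  apply: (@integral_derive1_eq0 L (fun a => psi (cons_rV (a, y)))).
  - by move=> a; apply: continuous_comp; [exact: continuous_consl | exact: cpsi].
  - move=> a; have E : (fun h : R => h^-1 *: ((psi \o (fun a : R => cons_rV (a, y)) \o shift a) (h *: (1 : R)) - psi (cons_rV (a, y)))) =
      (fun h : R => h^-1 *: ((psi \o shift (cons_rV (a, y))) (h *: delta_mx ord0 i) - psi (cons_rV (a, y)))).
      by apply/funext => h /=; rewrite [h *: 1]mulr1 cons_shift0 -ii.
    apply: DeriveDef; first by rewrite /derivable E; exact: dpsi.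
    by rewrite /partial /derive E.
  - by move=> a La; apply: vpsi; exists i; rewrite cs0.
  - by move=> a La; apply: vpart; exists i; rewrite cs0.
rewrite E1; apply: integral0_eq => a _.
have E y : (fun h : R => h^-1 *: ((psi \o (fun y => cons_rV (a, y)) \o shift y) (h *: delta_mx ord0 j) - psi (cons_rV (a, y)))) =
      (fun h : R => h^-1 *: ((psi \o shift (cons_rV (a, y))) (h *: delta_mx ord0 i) - psi (cons_rV (a, y)))).
  by apply/funext => h /=; rewrite cons_shiftS -ij.
have pE y : partial j (fun y => psi (cons_rV (a, y))) y = partial i psi (cons_rV (a, y)).
  by rewrite /partial /derive E.
under eq_integral do rewrite -pE.
apply: IH.
- by move=> y; rewrite /derivable E; exact: dpsi.
- rewrite (_ : partial _ _ = fun y => partial i psi (cons_rV (a, y))); last exact/funext.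
  by move=> y; apply: continuous_comp; [exact: continuous_consr | exact: cpsi].
- move=> y [k hk]; apply: vpsi; exists (rshift 1 k).
  by rewrite /cons_rV (@row_mxEr _ 1 1 n).
Qed.
End divergence.

(** * Bump functions and the fundamental lemma of the calculus of variations *)

Section flat_exp.
Context {R : realType}.

(** The classical flat function is the case k = 0; differentiation produces the
factors t^-k. *)
Definition flat (k : nat) (t : R) : R := if 0 < t then t ^- k * expR (- t^-1) else 0.

Lemma flat_le0 k t : t <= 0 -> flat k t = 0.
Proof. by rewrite /flat leNgt => /negbTE ->. Qed.

Lemma flat_ge0 k t : 0 <= flat k t.
Proof.
rewrite /flat; case: ifPn => // t0.
by rewrite mulr_ge0 ?expR_ge0 // invr_ge0 exprn_ge0 // ltW.
Qed.

(** Since exp (1 / t) exceeds a multiple of t^-(k+2).  The factor t^2 on the right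
yields the derivative 0 at the origin. *)
Lemma flat_bound k t : flat k t <= k.+2`!%:R * t ^+ 2.
Proof.
have [t0|t0] := leP t 0.
  by rewrite flat_le0 // mulr_ge0 ?sqr_ge0.
have f0 : 0 < (k.+2`!%:R : R) by rewrite ltr0n fact_gt0.
rewrite /flat t0 expRN ler_pdivrMr ?expR_gt0 //.
have := @expR_ge1Dxn R t^-1 k.+1; rewrite invr_ge0 ltW // => /(_ isT).
set e := expR _ => h.
have {}h : t^-1 ^+ k.+2 <= e * k.+2`!%:R.
  by rewrite -ler_pdivrMr // (le_trans _ h) // lerDr.
have -> : t ^- k = t^-1 ^+ k.+2 * t ^+ 2.
  by rewrite -addn2 exprD -mulrA -exprMn mulVf ?gt_eqF // expr1n mulr1 exprVn.
have -> : k.+2`!%:R * t ^+ 2 * e = e * k.+2`!%:R * t ^+ 2 by rewrite mulrC mulrA.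
by rewrite ler_wpM2r ?sqr_ge0.
Qed.

Lemma flat_is_derive k (t : R) :
  is_derive t (1 : R) (flat k) (flat k.+2 t - k%:R * flat k.+1 t).
Proof.
have [t0|t0|->] := ltgtP t 0.
- have E : \near t, (cst 0 : R -> R) t = flat k t.
    near=> s; rewrite flat_le0 //.
    by apply: ltW; near: s; exact: lt_nbhsl.
  rewrite !flat_le0 ?(ltW t0) // mulr0 subr0; apply: near_eq_is_derive; first exact: E.
- have E : \near t, ((fun t : R => t^-1) ^+ k * (fun t => expR (- t^-1))) t = flat k t.
    near=> s; rewrite mulrfctE exprfctE /flat ifT ?exprVn //.
    by near: s; exact: lt_nbhsr.
  apply: near_eq_is_derive; first exact: E.
  have tn0 : t != 0 by rewrite gt_eqF.
  have d1 : is_derive t 1 (fun t : R => t^-1) (- t ^- 2).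
    by have := @is_deriveV _ (@id R) t 1 1 tn0 (is_derive_id _ _); rewrite /GRing.scale /= mulr1.
  have d2 : is_derive t 1 (fun t => expR (- t^-1)) (t ^- 2 * expR (- t^-1)).
    have := @is_derive1_comp _ expR (fun t => - t^-1) t _ _ (is_derive_expR _) (is_deriveN d1).
    by rewrite opprK mulrC.
  have := is_deriveM (is_deriveX k d1) d2.
  move=> dd; apply: (is_derive_eq dd); clear dd.
  rewrite exprfctE /GRing.scale /= /flat t0.
  set e := expR _; rewrite -!exprVn; case: k {E} => [|k].
    by rewrite !mul0r mulr0 addr0 subr0 expr0 mul1r.
  rewrite /= !exprS; set u := t^-1; set v := u ^+ k; rewrite expr0; ring.
- rewrite !flat_le0 // mulr0 subr0.
  have c0 : (fun h : R => h^-1 *: ((flat k \o shift 0) (h *: (1 : R)) - flat k 0)) @ 0^' --> (0 : R).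
    apply/cvgrPdist_lt => e e0.
    have f0 : 0 < (k.+2`!%:R : R) by rewrite ltr0n fact_gt0.
    have d0 : 0 < e / k.+2`!%:R by exact: divr_gt0.
    near=> h; have h0 : h != 0 by near: h; exact: nbhs_dnbhs_neq.
    rewrite sub0r normrN /= [h *: 1]mulr1 addr0 (flat_le0 k (lexx 0)) subr0.
    rewrite normrM normfV ltr_pdivrMl ?normr_gt0 // ger0_norm ?flat_ge0 //.
    apply: le_lt_trans (flat_bound _ _) _.
    rewrite -[h ^+ 2]real_normK ?num_real // expr2 mulrCA ltr_pM2l ?normr_gt0 //.
    rewrite mulrC -ltr_pdivlMr //.
    by near: h; exact: dnbhs0_lt.
  apply: DeriveDef; first by apply/cvg_ex; exists 0.
  exact: cvg_lim c0.
Unshelve. all: by end_near. Qed.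

End flat_exp.

Section smooth_functions.
Context {R : realType} {n : nat}.
Local Notation E := 'rV[R]_n.
Implicit Types f g : E -> R.

(** A class closed under partial derivatives that contains the bump functions and
the components of affine fields: its members are smooth, without any need for
formulas for iterated derivatives. *)
Inductive elementary : (E -> R) -> Prop :=
| elem_cst c : elementary (fun=> c)
| elem_coord i : elementary (fun x => x ord0 i)
| elem_add f g : elementary f -> elementary g -> elementary (fun x => f x + g x)
| elem_mul f g : elementary f -> elementary g -> elementary (fun x => f x * g x)
| elem_flat k f : elementary f -> elementary (fun x => flat k (f x)).

Lemma partial_cst i (c : R) : partial i (fun _ : E => c) = fun=> 0.
Proof. by apply/funext => x; rewrite /partial derive_cst. Qed.

Lemma partialD i f g : (forall x, differentiable f x) -> (forall x, differentiable g x) ->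
  partial i (fun x => f x + g x) = fun x => partial i f x + partial i g x.
Proof.
move=> df dg; apply/funext => x.
by rewrite /partial (@deriveD _ _ _ f g) //; exact: diff_derivable.
Qed.

Lemma partialM i f g : (forall x, differentiable f x) -> (forall x, differentiable g x) ->
  partial i (fun x => f x * g x) = fun x => f x * partial i g x + g x * partial i f x.
Proof.
move=> df dg; apply/funext => x.
by rewrite /partial (@deriveM _ _ f g) //; exact: diff_derivable.
Qed.

Lemma partial_coord i j : partial i (fun x : E => x ord0 j) = fun=> (i == j)%:R.
Proof.
apply/funext => x; rewrite /partial /derive.
have E0 : (fun h : R => h^-1 *: (((fun x : E => x ord0 j) \o shift x) (h *: delta_mx ord0 i) - x ord0 j)) =
   (fun h => h^-1 *: (h * (i == j)%:R)).
  by apply/funext => h /=; rewrite !mxE eqxx addrK eq_sym.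
apply: cvg_lim => //; rewrite E0; apply: cvg_near_cst; near=> h.
have h0 : h != 0 by near: h; exact: nbhs_dnbhs_neq.
by rewrite /GRing.scale /= mulrA mulVf // mul1r.
Unshelve. all: by end_near. Qed.

Lemma flat_differentiable k t : differentiable (flat k : R -> R) t.
Proof. by apply/derivable1_diffP; have [] := @flat_is_derive R k t. Qed.

Lemma partial_flat i k f : (forall x, differentiable f x) ->
  partial i (fun x => flat k (f x)) =
  fun x => (flat k.+2 (f x) + - k%:R * flat k.+1 (f x)) * partial i f x.
Proof.
move=> df; apply/funext => x; rewrite /partial.
have dc : differentiable (flat k \o f) x.
  by apply: differentiable_comp => //; exact: flat_differentiable.
rewrite (deriveE _ dc) diff_comp //; last exact: flat_differentiable.
rewrite /= diff1E; last exact: flat_differentiable.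
rewrite derive1E; have [_ ->] := @flat_is_derive R k (f x).
by rewrite -deriveE // /GRing.scale /= mulrC mulNr.
Qed.

Lemma elementary_diff f : elementary f -> forall x, differentiable f x.
Proof.
elim=> {f} [c|i|f g _ IHf _ IHg|f g _ IHf _ IHg|k f _ IHf] x.
- exact: differentiable_cst.
- exact: differentiable_coord.
- exact: (@differentiableD _ _ _ f g).
- exact: (@differentiableM _ _ f g).
- by apply: (@differentiable_comp _ _ _ _ f (flat k)) => //; exact: flat_differentiable.
Qed.

Lemma elementary_partial i f : elementary f -> elementary (partial i f).
Proof.
elim=> {f} [c|j|f g ef IHf eg IHg|f g ef IHf eg IHg|k f ef IHf].
- by rewrite partial_cst; exact: elem_cst.
- by rewrite partial_coord; exact: elem_cst.
- by rewrite partialD; [exact: elem_add | exact: elementary_diff..].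
- rewrite partialM; [|exact: elementary_diff..].
  by apply: elem_add; exact: elem_mul.
- rewrite partial_flat; last exact: elementary_diff.
  apply: elem_mul => //; apply: elem_add; first exact: elem_flat.
  by apply: elem_mul; [exact: elem_cst | exact: elem_flat].
Qed.

Lemma elementary_smooth f : elementary f -> smooth f.
Proof.
move=> ef s x; apply: elementary_diff.
by elim: s => //= i s IH; exact: elementary_partial.
Qed.

Lemma elementary_prod (I : Type) (s : seq I) (F : I -> E -> R) :
  (forall i, elementary (F i)) -> elementary (fun x => \prod_(i <- s) F i x).
Proof.
move=> eF; elim: s => [|i s IH].
  rewrite (_ : (fun x => _) = fun=> 1); first exact: elem_cst.
  by apply/funext => x; rewrite big_nil.
rewrite (_ : (fun x => _) = fun x => F i x * \prod_(j <- s) F j x); first exact: elem_mul.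
by apply/funext => x; rewrite big_cons.
Qed.

Definition box (a b : E) : set E := [set x | forall i, a ord0 i < x ord0 i < b ord0 i].

(** For a < b coordinatewise the factors are all nonzero exactly inside the box
(k > 0), and flat 0 tends to 1 at infinity, so these functions approximate the
indicator of the box as k grows. *)
Definition box_bump (a b : E) (k : nat) (x : E) : R :=
  \prod_(i < n) flat 0 (k%:R * ((x ord0 i - a ord0 i) * (b ord0 i - x ord0 i))).

Lemma box_bump_smooth a b k : smooth (box_bump a b k).
Proof.
apply: elementary_smooth; apply: elementary_prod => i.
apply: elem_flat; apply: elem_mul; first exact: elem_cst.
have xa (c : R) : elementary (fun x : E => x ord0 i + c).
  by apply: elem_add; [exact: elem_coord | exact: elem_cst].
apply: elem_mul; first exact: xa.
rewrite (_ : (fun x => _) = fun x : E => b ord0 i + (-1) * x ord0 i).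
  apply: elem_add; first exact: elem_cst.
  by apply: elem_mul; [exact: elem_cst | exact: elem_coord].
by apply/funext => x; rewrite mulN1r.
Qed.

Lemma flat0_le1 (t : R) : flat 0 t <= 1.
Proof.
rewrite /flat; case: ifPn => // t0.
by rewrite expr0 invr1 mul1r -[leRHS]expR0 ler_expR oppr_le0 invr_ge0 ltW.
Qed.

Lemma box_bump_norm a b k x : `|box_bump a b k x| <= 1.
Proof.
rewrite /box_bump ger0_norm; last by apply: prodr_ge0 => i _; exact: flat_ge0.
rewrite [leRHS](_ : 1 = \prod_(i < n) 1 :> R); last by rewrite big1.
by apply: ler_prod => i _; rewrite flat_ge0 flat0_le1.
Qed.

Lemma box_bump_out (a b : E) k (x : E) : (forall i, a ord0 i < b ord0 i) -> ~ box a b x ->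
  box_bump a b k x = 0.
Proof.
move=> ab /existsNP[i /negP].
rewrite negb_and -!leNgt => h; rewrite /box_bump (bigD1 i) //= flat_le0 ?mul0r //.
rewrite mulr_ge0_le0 //; have := ab i; case/orP: h => h; nra.
Qed.

Lemma flat0_cvg (t : R) : 0 < t -> (fun k => flat 0 (k%:R * t)) @ \oo --> (1 : R).
Proof.
move=> t0.
have c : (fun k : nat => expR (- (t^-1 * k.+1%:R^-1))) @ \oo --> (1 : R).
  rewrite -[X in _ --> X]expR0 -oppr0 -[X in - X](mulr0 t^-1).
  apply: continuous_cvg; first exact: continuous_expR.
  apply: cvgN; apply: cvgMr; exact: cvg_harmonic.
rewrite -cvg_shiftS /=; move: c; apply: cvg_trans.
apply: near_eq_cvg; apply: nearW => k.
by rewrite /flat mulr_gt0 // ?ltr0n // expr0 invr1 mul1r invfM mulrC.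
Qed.

Lemma box_bump_cvg (a b : E) (x : E) : (forall i, a ord0 i < b ord0 i) ->
  (fun k => box_bump a b k x) @ \oo --> (\1_(box a b) x : R).
Proof.
move=> ab; have [bx|nbx] := pselect (box a b x); last first.
  rewrite indicE memNset //; apply: cvg_near_cst; apply: nearW => k.
  by rewrite box_bump_out.
rewrite indicE mem_set // /box_bump.
rewrite (_ : 1%:R = \prod_(i < n) 1 :> R); last by rewrite big1.
elim: (index_enum _) => [|i s IH].
  by under eq_fun do rewrite big_nil; rewrite big_nil; exact: cvg_cst.
under eq_fun do rewrite big_cons; rewrite big_cons.
apply: cvgM => //; apply: flat0_cvg; have /andP[h1 h2] := bx i.
by rewrite mulr_gt0 ?subr_gt0.
Qed.

End smooth_functions.

Section fundamental_lemma.
Context {R : realType} {n : nat}.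
Local Notation E := 'rV[R]_n.
Local Notation leb := (@lebesgue_rV R n).

Lemma test_functionI (U K : set E) (phi : E -> R) : smooth phi -> compact K ->
  K `<=` U -> (forall x, ~ K x -> phi x = 0) -> test_function U phi.
Proof.
move=> sphi cK KU out.
have clK : closed K by apply: compact_closed => //; exact: norm_hausdorff.
have sub : closure [set x | phi x != 0] `<=` K.
  rewrite closureE; apply: smallest_sub => // x /= px.
  by apply: contrapT => nK; move: px; rewrite out // eqxx.
split=> //; last exact: subset_trans KU.
by apply: (subclosed_compact _ cK sub); exact: closed_closure.
Qed.

Lemma test_function_out (U : set E) (phi : E -> R) x : test_function U phi -> ~ U x ->
  phi x = 0.
Proof.
move=> [_ _ sU] nU; apply: contrapT => /eqP px; apply: nU; apply: sU.
exact: subset_closure.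
Qed.

Lemma test_functionS (U V : set E) (phi : E -> R) : U `<=` V ->
  test_function U phi -> test_function V phi.
Proof. by move=> UV [s c sU]; split=> //; exact: subset_trans UV. Qed.

Definition orthant (a : E) : set E := [set x | forall i, a ord0 i < x ord0 i].

Let G := [set A : set E | exists a, A = orthant a].

(** The orthants form a pi-system, and intersecting one with a ball of the
max-norm yields a box. *)
Lemma orthant_generates : @measurable _ E = <<s G >>.
Proof.
apply/seteqP; split=> A; last first.
  apply: smallest_sub => {A}; first exact: sigma_algebra_measurable.
  move=> _ [a ->].
  rewrite (_ : orthant a = [set x | forall i, `](a ord0 i), +oo[%classic (x ord0 i)]).
    exact: (@measurable_rV_box R n (fun i => `](a ord0 i), +oo[%classic) (fun i => measurable_itv _)).
  by apply/seteqP; split=> x h i; have := h i; rewrite /= in_itv /= andbT.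
move=> mA.
have : measurable_fun setT (fun x : g_sigma_algebraType G => (x : E)).
  apply: measurable_fun_rV => i.
  apply: (measurability _ (RGenOInfty.measurableE R)).
  move=> _ [_ [t ->] <-]; rewrite setTI.
  rewrite (_ : _ @^-1` _ =
     \bigcup_k orthant (\row_j if j == i then t else - k%:R)).
    by apply: bigcup_measurable => k _; apply: sub_sigma_algebra; eexists.
  apply/seteqP; split=> x /=.
    rewrite in_itv /= andbT => tx.
    have [k hk] : exists k : nat, forall j, - k%:R < x ord0 j.
      exists (\max_j (Num.truncn (- x ord0 j)).+1)%N => j.
      rewrite ltrNl; apply: lt_le_trans (Num.Theory.truncnS_gt _) _.
      by rewrite ler_nat; exact: leq_bigmax.
    by exists k => // j; rewrite mxE; case: eqP => [->|].
  by move=> [k _ /(_ i)]; rewrite mxE eqxx in_itv /= andbT.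
by move=> /(_ measurableT A mA); rewrite setTI.
Qed.

Section local.
Variables (U : set E) (g : E -> R).
Hypothesis mU : measurable U.
Hypothesis Ig : leb.-integrable U (EFin \o g).
Hypothesis g0 : forall phi, test_function U phi ->
  \int[leb]_(x in U) (g x * phi x) = 0.

Let measurable_box (a b : E) : measurable (box a b).
Proof.
rewrite (_ : box a b = [set x | forall i, `](a ord0 i), (b ord0 i)[%classic (x ord0 i)]).
  exact: (@measurable_rV_box R n (fun i => `](a ord0 i), (b ord0 i)[%classic) (fun i => measurable_itv _)).
by apply/seteqP; split=> x h i; have := h i; rewrite /= in_itv.
Qed.

Let integral_box (a b : E) :
  [set x : E | forall i, a ord0 i <= x ord0 i <= b ord0 i] `<=` U ->
  (\int[leb]_(x in box a b) (g x)%:E = 0)%E.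
Proof.
move=> KU.
have [ab|nab] := pselect (forall i, a ord0 i < b ord0 i); last first.
  rewrite (_ : box a b = set0) ?integral_set0 //.
  apply/seteqP; split=> // x bx; case: nab => i.
  by have /andP[] := bx i; exact: lt_trans.
have mg : measurable_fun U g by have /integrableP[/measurable_EFinP] := Ig.
have mb k : measurable_fun U (box_bump a b k).
  apply: measurable_funTS; apply: continuous_rV_measurable => x.
  by apply: differentiable_continuous; exact: (box_bump_smooth a b k [::] x).
have tb k : test_function U (box_bump a b k).
  apply: (test_functionI (box_bump_smooth a b k) _ KU).
    rewrite (_ : [set x | _] = [set x : E | forall i, `[a ord0 i, b ord0 i]%classic (x ord0 i)]).
      exact: (@rV_compact _ n (fun i => `[a ord0 i, b ord0 i]%classic) (fun i => @segment_compact _ _ _)).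
    by apply/seteqP; split=> x h i; have := h i; rewrite /= in_itv.
  move=> x nK; apply: box_bump_out => // bx; apply: nK => i.
  by have /andP[/ltW -> /ltW ->] := bx i.
have mf k : measurable_fun U (fun x => (g x * box_bump a b k x)%:E).
  by apply/measurable_EFinP; exact: measurable_funM.
have mf0 : measurable_fun U (fun x => (g x * \1_(box a b) x)%:E).
  by apply/measurable_EFinP; apply: measurable_funM => //; exact: measurable_indic.
have [||_ _ cv] := @dominated_convergence _ _ _ leb U mU _ _ _ mf mf0 _ (integrable_abse Ig).
- apply: aeW => x Ux; apply: cvg_EFin; first exact: nearW.
  by apply: cvgM; [exact: cvg_cst | exact: box_bump_cvg].
- apply: aeW => x k Ux /=.
  by rewrite lee_fin normrM ler_piMr // box_bump_norm.
rewrite integral_mkcond.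
transitivity (\int[leb]_(x in U) (g x * \1_(box a b) x)%:E)%E.
  rewrite [RHS]integral_mkcond; apply: eq_integral => x _; rewrite !patchE.
  case: ifPn => [|]; rewrite ?notin_setE ?in_setE => bx.
    rewrite mem_set ?indicE ?mem_set ?mulr1 //.
    by apply: KU => i; have /andP[/ltW -> /ltW ->] := bx i.
  by case: ifP => // _; rewrite indicE memNset // mulr0.
have E0 k : (\int[leb]_(x in U) (g x * box_bump a b k x)%:E = 0)%E.
  have := g0 (tb k); rewrite /Rintegral => h.
  rewrite -[LHS]fineK ?h //; apply: integrable_fin_num => //.
  apply: (le_integrable mU (mf k) _ (integrable_abse Ig)) => x _ /=.
  by rewrite lee_fin normr_id normrM ler_piMr // box_bump_norm.
apply: cvg_unique cv _ => //; rewrite /=.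
by under eq_fun do rewrite E0; exact: cvg_cst.
Qed.

Let ae0_ball (c : E) (r : R) : 0 < r -> cube c r `<=` U ->
  ae_eq leb (ball c r) (EFin \o g) (cst 0%E).
Proof.
move=> r0 cU.
have mB : measurable (ball c r) by exact: rV_ball_measurable.
have BU : ball c r `<=` U.
  by rewrite rV_ballE // => x xc; apply: cU => i; exact: ltW.
have IB (A : set E) : measurable A -> leb.-integrable (A `&` ball c r) (EFin \o g).
  move=> mA; apply: (integrableS mU _ _ Ig); first exact: measurableI.
  by move=> x [_ /BU].
pose P (A : set E) := (\int[leb]_(x in A `&` ball c r) (g x)%:E = 0)%E.
have PT : P setT.
  rewrite /P setTI (_ : ball c r = box (c - const_mx r) (c + const_mx r)).
    by apply: integral_box => x h; apply: cU => i; have := h i; rewrite !mxE ler_distl.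
  rewrite rV_ballE //.
  by apply/seteqP; split=> x h i; have := h i; rewrite !mxE /= ltr_distl.
have key A : measurable A -> P A.
  move=> mA; have sA : <<s G >> A by rewrite -orthant_generates.
  move: A sA {mA}; apply: (dynkin_induction orthant_generates) => //.
  - move=> _ _ [a ->] [b ->]; exists (\row_i Num.max (a ord0 i) (b ord0 i)).
    apply/seteqP; split=> x.
      by move=> [h1 h2] i; rewrite mxE gt_max h1 h2.
    by move=> h; split=> i; have := h i; rewrite mxE gt_max => /andP[].
  - move=> _ [a ->]; rewrite /P.
    rewrite (_ : _ `&` _ = box (\row_i Num.max (a ord0 i) (c ord0 i - r)) (c + const_mx r)).
      apply: integral_box => x h; apply: cU => i.
      by have := h i; rewrite !mxE ler_distl ge_max => /andP[/andP[_ -> ->]].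
    rewrite rV_ballE //; apply/seteqP; split=> x.
      move=> [h1 h2] i; rewrite !mxE gt_max h1 /=.
      by have := h2 i; rewrite /= ltr_distl.
    move=> h; split=> i; have := h i; rewrite !mxE gt_max => /andP[/andP[h1 h2] h3] //.
    by rewrite ltr_distl h2.
  - move=> S mS S0; rewrite /P.
    have : (\int[leb]_(x in S `&` ball c r) (g x)%:E + \int[leb]_(x in ~` S `&` ball c r) (g x)%:E = 0)%E.
      rewrite -integral_setU.
      + by rewrite -setIUl setUv.
      + exact: measurableI.
      + by apply: measurableI => //; exact: measurableC.
      + rewrite -setIUl setUv; have /integrableP[] := IB setT measurableT; done.
      + by apply/disj_setPS => x [[Sx _] [nSx _]].
    by rewrite S0 add0e.
  - move=> F mF tF F0; rewrite /P setI_bigcupl integral_bigcup.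
    + by apply: eseries0 => i _ _; exact: F0.
    + exact: trivIset_setIr.
    + by move=> k; exact: measurableI.
    + by rewrite -setI_bigcupl; apply: IB; exact: bigcup_measurable.
apply: (integral_ae_eq mB) => //.
- by have := IB setT measurableT; rewrite setTI.
- move=> A AB mA; rewrite integral0 -(key A mA).
  by rewrite setIidl.
Qed.

Hypothesis oU : open U.

(** By dominated convergence along bump functions, g has integral zero over every
box with closure in U.  Dynkin's lemma extends this to all Borel subsets of a
ball, and U is a countable union of balls. *)
Theorem test_ae_eq0 : ae_eq leb U g (fun=> 0).
Proof.
have [B [UB hB]] := open_bigcup_balls oU.
have null k : leb.-negligible (B k `&` [set x | g x != 0]).
  have [->|[c [r [r0 Bk cU]]]] := hB k; first by rewrite set0I; exact: negligible_set0.
  have := ae0_ball r0 cU; rewrite Bk; apply: negligibleS => x [bx gx] /= h.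
  by have := h bx => -[] /eqP; rewrite (negbTE gx).
apply: (negligibleS _ (negligible_bigcup null)) => x /= /not_implyP[].
rewrite {1}UB => -[k _ Bx] gx; exists k => //; split=> //.
exact/eqP.
Qed.

End local.
End fundamental_lemma.

(** * Bounded bilinear forms *)

Section bounded_forms.
Context {R : realType} {X : lmodType R} (H : hilbert X).
Local Notation dom := (hdom H).
Local Notation nm := (hnorm H).

Record bform (c : X -> X -> R) : Prop := BForm {
  bform_linl : forall a x y z, dom x -> dom y -> dom z ->
    c (a *: x + y) z = a * c x z + c y z;
  bform_linr : forall a x y z, dom x -> dom y -> dom z ->
    c z (a *: x + y) = a * c z x + c z y;
  bform_bnd : exists2 M, 0 <= M & forall x y, dom x -> dom y ->
    `|c x y| <= M * nm x * nm y }.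

Lemma bformD c c' : bform c -> bform c' -> bform (fun x y => c x y + c' x y).
Proof.
move=> [l r [M M0 hM]] [l' r' [M' M0' hM']]; split.
- by move=> a x y z dx dy dz; rewrite l // l' //; ring.
- by move=> a x y z dx dy dz; rewrite r // r' //; ring.
exists (M + M'); first exact: addr_ge0.
move=> x y dx dy; apply: le_trans (ler_normD _ _) _.
by rewrite !mulrDl lerD // ?hM ?hM'.
Qed.

Lemma bformZ k c : bform c -> bform (fun x y => k * c x y).
Proof.
move=> [l r [M M0 hM]]; split.
- by move=> a x y z dx dy dz; rewrite l //; ring.
- by move=> a x y z dx dy dz; rewrite r //; ring.
exists (`|k| * M); first exact: mulr_ge0.
by move=> x y dx dy; rewrite normrM -!mulrA ler_wpM2l // mulrA hM.
Qed.

Lemma bform_sum (I : finType) (c : I -> X -> X -> R) : (forall i, bform (c i)) ->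
  bform (fun x y => \sum_i c i x y).
Proof.
move=> bc; elim: (index_enum I) => [|i s IH].
  split=> [a x y z _ _ _|a x y z _ _ _|]; rewrite ?big_nil ?mulr0 ?addr0 //.
  by exists 0 => // x y _ _; rewrite big_nil normr0 !mul0r.
rewrite (_ : (fun x y => _) = fun x y => c i x y + \sum_(j <- s) c j x y); first exact: bformD.
by apply/funext => x; apply/funext => y; rewrite big_cons.
Qed.

Variable S : set X.
Hypothesis S_dom : S `<=` dom.

(** By continuity; inequalities between bounded forms therefore need to be proved
for test functions only. *)
Lemma bform_closure_ge0 c x : bform c -> (forall y, S y -> 0 <= c y y) ->
  hclosure H S x -> 0 <= c x x.
Proof.
move=> [l r [M M0 hM]] c0 [dx hx].
apply/ler_addgt0Pr => e e0.
(* The two errors are at most nm (x - y) times M * nm x and M * nm y, where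
   nm y <= nm x + 1. *)
pose K := M * (2 * nm x + 1) + 1.
have n0 := hnorm_ge0 H x.
have K0 : 0 < K by rewrite ltr_wpDl // mulr_ge0 // addr_ge0 // mulr_ge0.
have [|y Sy xy] := hx (Num.min 1 (e / K)).
  by rewrite lt_min ltr01 divr_gt0.
have dy := S_dom Sy; have dxy := hdomB dx dy.
have dN : dom (y - x) by exact: hdomB.
have [xy1 xy2] : nm (x - y) < 1 /\ nm (x - y) < e / K.
  by move: xy; rewrite lt_min => /andP[].
have ny : nm y <= nm x + nm (x - y).
  by have := hnormD dx dN; rewrite addrC subrK hnormBC.
have E : c y y = c x x - c (x - y) x - c y (x - y).
  have -> : c (x - y) x = c x x - c y x.
    by have := l (-1) y x x dy dx dx; rewrite scaleN1r addrC => ->; ring.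
  have -> : c y (x - y) = c y x - c y y.
    by have := r (-1) y x y dy dx dy; rewrite scaleN1r addrC => ->; ring.
  ring.
have := c0 _ Sy; rewrite E => h.
have h1 := hM _ _ dxy dx; have h2 := hM _ _ dy dxy.
have := ler_norm (- c (x - y) x); rewrite normrN => h3.
have := ler_norm (- c y (x - y)); rewrite normrN => h4.
have h5 := le_trans h3 (hM _ _ dxy dx); have h6 := le_trans h4 h2.
move: xy2; rewrite ltr_pdivlMr // /K => xy2.
have := hnorm_ge0 H (x - y); have := hnorm_ge0 H y.
have h7 : M * nm y * nm (x - y) <= M * (nm x + 1) * nm (x - y).
  by rewrite ler_wpM2r ?hnorm_ge0 // ler_wpM2l //; lra.
have := hnorm_ge0 H (x - y); lra.
Qed.

Lemma linear_closure_eq0 (l : X -> R) (C : R) x :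
  (forall a x y, dom x -> dom y -> l (a *: x + y) = a * l x + l y) ->
  (forall x, dom x -> `|l x| <= C * nm x) ->
  (forall y, S y -> l y = 0) -> hclosure H S x -> l x = 0.
Proof.
move=> llin lC l0 [dx hx].
apply/eqP; rewrite -normr_eq0 eq_le normr_ge0 andbT.
apply/ler_addgt0Pr => e e0; rewrite add0r.
have C0 : 0 < `|C| + 1 by rewrite ltr_wpDl.
have [|y Sy xy] := hx (e / (`|C| + 1)); first exact: divr_gt0.
have dy := S_dom Sy.
have -> : l x = l (x - y).
  have := llin (-1) y x dy dx; rewrite scaleN1r addrC => ->.
  by rewrite (l0 _ Sy) mulr0 add0r.
apply: le_trans (lC _ (hdomB dx dy)) _.
move: xy; rewrite ltr_pdivlMr // => /ltW; apply: le_trans.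
rewrite mulrC ler_wpM2l ?hnorm_ge0 //.
by rewrite (le_trans (ler_norm _)) // lerDl.
Qed.

End bounded_forms.

Section l2_forms.
Context d (T : measurableType d) (R : realType) (I : finType).
Variables (mu : {measure set T -> \bar R}) (D : set T).
Hypothesis mD : measurable D.
Local Notation Z := (l2_hilbert I mu mD).
Local Notation ip := (l2ip mu D).

Lemma l2_CS f g : sqint mu D f -> sqint mu D g -> ip f g ^+ 2 <= ip f f * ip g g.
Proof.
move=> sf sg; apply: quad_disc => t.
have := l2ip_ge0 mu D (fun x => t * g x + f x).
have st := sqint_lin mD t sg sf.
rewrite l2ip_lin // ![l2ip _ _ _ (fun x => t * g x + f x)]l2ipC !l2ip_lin //.
by rewrite (l2ipC _ _ g f); lra.
Qed.

Lemma l2_comp_le (x : I -> T -> R) i : ip (x i) (x i) <= hnorm Z x ^+ 2.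
Proof.
rewrite l2_hnorm_sqr (bigD1 i) //= lerDl.
by apply: sumr_ge0 => j _; exact: l2ip_ge0.
Qed.

Lemma l2ip_mul_le (beta f : T -> R) (B : R) : measurable_fun D beta ->
  (forall x, D x -> `|beta x| <= B) -> sqint mu D f ->
  ip (fun x => beta x * f x) (fun x => beta x * f x) <= B ^+ 2 * ip f f.
Proof.
move=> mb bB sf; have [mf If] := sf.
rewrite -lee_fin EFinM !l2ip_EFin //; last exact: sqint_bounded_mul bB sf.
rewrite -ge0_integralZl //; last 3 first.
- by apply/measurable_EFinP; exact: measurable_funX.
- by move=> t _; rewrite lee_fin sqr_ge0.
- by rewrite lee_fin sqr_ge0.
apply: ge0_le_integral => //.
- by move=> t _; rewrite lee_fin sqr_ge0.
- by apply/measurable_EFinP; apply: measurable_funX; exact: measurable_funM.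
- apply: measurable_funeM; apply/measurable_EFinP; exact: measurable_funX.
- move=> t Dt; rewrite -EFinM lee_fin exprMn ler_wpM2r ?sqr_ge0 //.
  rewrite -[leLHS]real_normK ?num_real //.
  by rewrite ler_pXn2r // ?nnegrE ?bB //; exact: le_trans (bB _ Dt).
Qed.

Lemma l2_bform_comp (beta : T -> R) (B : R) i j : measurable_fun D beta ->
  (forall x, D x -> `|beta x| <= B) ->
  bform Z (fun x y => ip (fun t => beta t * x i t) (y j)).
Proof.
move=> mb bB; pose B' := `|B|; have B'0 : 0 <= B' by exact: normr_ge0.
have bB' x : D x -> `|beta x| <= B' by move=> Dx; exact: le_trans (bB _ Dx) (ler_norm _).
have sb x : sqint mu D x -> sqint mu D (fun t => beta t * x t).
  by move=> sx; exact: (sqint_bounded_mul mD mb bB).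
split.
- move=> a x y z dx dy dz; rewrite -(l2ip_lin mD a (sb _ (dx i)) (sb _ (dy i)) (dz j)).
  congr (l2ip _ _ _ _); apply/funext => t /=; rewrite !fctE /GRing.scale /=; ring.
- move=> a x y z dx dy dz; rewrite !(l2ipC _ _ (fun t => beta t * z i t)).
  exact: (l2ip_lin mD a (dx j) (dy j) (sb _ (dz i))).
exists B' => // x y dx dy.
rewrite -(@ler_pXn2r _ 2) // ?nnegrE ?mulr_ge0 ?hnorm_ge0 //.
rewrite real_normK ?num_real // !exprMn.
apply: le_trans (l2_CS (sb _ (dx i)) (dy j)) _.
apply: ler_pM; rewrite ?l2ip_ge0 ?l2_comp_le //.
apply: le_trans (l2ip_mul_le mb bB' (dx i)) _.
by rewrite ler_wpM2l ?sqr_ge0 ?l2_comp_le.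
Qed.

Lemma l2_functional_bnd (i : I) g : sqint mu D g ->
  (forall a x y, hdom Z x -> hdom Z y -> ip g ((a *: x + y) i) = a * ip g (x i) + ip g (y i))
  /\ forall x, hdom Z x -> `|ip g (x i)| <= Num.sqrt (ip g g) * hnorm Z x.
Proof.
move=> sg; split=> [a x y dx dy|x dx].
  by rewrite !(l2ipC _ _ g); exact: (l2ip_lin mD a (dx i) (dy i) sg).
rewrite -(@ler_pXn2r _ 2) // ?nnegrE ?mulr_ge0 ?hnorm_ge0 ?sqrtr_ge0 //.
rewrite real_normK ?num_real // exprMn sqr_sqrtr ?l2ip_ge0 //.
apply: le_trans (l2_CS sg (dx i)) _.
by rewrite ler_wpM2l ?l2ip_ge0 ?l2_comp_le.
Qed.

End l2_forms.

(** * Norms of L^2 and integration by parts *)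

Lemma normr_powR2 (R : realType) (x : R) : `|x| `^ 2 = x ^+ 2.
Proof. by rewrite powR_mulrn // real_normK ?num_real. Qed.

Section L2_bridge.
Context {R : realType} {d : nat}.
Local Notation E := 'rV[R]_d.
Local Notation leb := (@lebesgue_rV R d).
Variable D : set E.
Hypothesis mD : measurable D.

Lemma L2_sqint v : L2 D v <-> sqint leb D v.
Proof.
have sqr_patch : (fun x => (v x ^+ 2)%:E) \_ D = (fun x => ((v \_ D) x ^+ 2)%:E).
  by apply/funext => x; rewrite !patchE; case: ifP => //; rewrite expr0n.
split=> [h|[mv Iv]].
  have I2 := Lfun2_integrable_sqr h.
  split.
    apply/(measurable_restrictT _ mD).
    by move: h; rewrite /L2 inE => /andP[/[!inE]].
  by rewrite integrable_mkcond // sqr_patch.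
rewrite /L2 inE; apply/andP; split; rewrite inE /=.
  exact/(measurable_restrictT _ mD).
move: Iv; rewrite integrable_mkcond // sqr_patch => /integrableP[_ foo].
rewrite /finite_norm unlock; apply: poweR_lty.
apply: le_lt_trans foo; rewrite le_eqVlt; apply/orP; left; apply/eqP.
apply: eq_integral => x _ /=.
by rewrite normr_powR2 ger0_norm ?sqr_ge0.
Qed.

Lemma L2norm_ge0 v : 0 <= L2norm D v.
Proof. by apply: fine_ge0; exact: Lnorm_ge0. Qed.

Lemma L2norm_sqr v : sqint leb D v -> L2norm D v ^+ 2 = l2ip leb D v v.
Proof.
move=> sv; have h : L2 D v by exact/L2_sqint.
have Nfin : ('N[leb]_2%:E [EFin \o v \_ D] \is a fin_num)%E.
  rewrite ge0_fin_numE ?Lnorm_ge0 //.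
  by move: h; rewrite /L2 inE => /andP[_]; rewrite inE.
apply: EFin_inj; rewrite l2ip_EFin // -powR_mulrn ?L2norm_ge0 //.
rewrite -poweR_EFin /L2norm fineK // poweR_Lnorm // [RHS]integral_mkcond.
apply: eq_integral => x _ /=; rewrite !patchE; case: ifP => _ /=.
  by rewrite normr_powR2.
by rewrite normr0 powR0.
Qed.

End L2_bridge.

Section l2_ae.
Context dd (T : measurableType dd) (R : realType).
Variables (mu : {measure set T -> \bar R}) (D : set T).
Hypothesis mD : measurable D.

Lemma ae_eq_Rintegral (f g : T -> R) : measurable_fun D f -> measurable_fun D g ->
  ae_eq mu D f g -> \int[mu]_(x in D) f x = \int[mu]_(x in D) g x.
Proof.
move=> mf mg fg; congr fine; apply: ae_eq_integral => //.
- exact/measurable_EFinP.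
- exact/measurable_EFinP.
- by apply: filterS fg => x h Dx; rewrite /= h.
Qed.

Lemma ae_eq_l2ip (f f' g g' : T -> R) : measurable_fun D f -> measurable_fun D f' ->
  measurable_fun D g -> measurable_fun D g' ->
  ae_eq mu D f f' -> ae_eq mu D g g' -> l2ip mu D f g = l2ip mu D f' g'.
Proof.
move=> mf mf' mg mg' ff gg; apply: ae_eq_Rintegral; try exact: measurable_funM.
by apply: filterS2 ff gg => x h1 h2 Dx; rewrite h1 ?h2.
Qed.

End l2_ae.

Section test_functions.
Context {R : realType} {d : nat}.
Local Notation E := 'rV[R]_d.
Local Notation leb := (@lebesgue_rV R d).
Variables (D : set E) (L : R).
Hypothesis oD : open D.
Hypothesis DL : forall x, D x -> forall j, `|x ord0 j| <= L.
Let mD : measurable D := open_rV_measurable oD.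

Lemma smooth_partial i (phi : E -> R) : smooth phi -> smooth (partial i phi).
Proof. by move=> sp s; have := sp (rcons s i); rewrite foldr_rcons. Qed.

Lemma smooth_continuous (phi : E -> R) : smooth phi -> continuous phi.
Proof. by move=> sp x; apply: differentiable_continuous; exact: (sp [::] x). Qed.

Lemma partial_out U i (phi : E -> R) x : test_function U phi ->
  ~ closure [set x | phi x != 0] x -> partial i phi x = 0.
Proof.
move=> _ nx; rewrite /partial.
have E0 : \near x, phi x = (cst 0 : _ -> R) x.
  have oC : open (~` closure [set x | phi x != 0]).
    by rewrite openC; exact: closed_closure.
  have : nbhs x (~` closure [set x | phi x != 0]) by exact: open_nbhs_nbhs.
  apply: filterS => y ny; apply: contrapT => /eqP py; apply: ny.
  exact: subset_closure.
by rewrite (near_eq_derive _ E0) derive_cst.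
Qed.

Lemma test_partial U i (phi : E -> R) : test_function U phi ->
  test_function U (partial i phi).
Proof.
move=> tp; have [sp cp sU] := tp.
apply: (test_functionI (smooth_partial i sp) cp sU) => x nx.
exact: partial_out tp nx.
Qed.

Lemma test_vanish (phi : E -> R) : test_function D phi -> vanish_outside L phi.
Proof.
move=> tp x [j Lx]; apply: (test_function_out tp) => Dx.
by have := DL Dx j; rewrite leNgt Lx.
Qed.

Lemma continuous_sqint (g : E -> R) : continuous g -> vanish_outside L g -> sqint leb D g.
Proof.
move=> cg gL; split.
  by apply: measurable_funTS; exact: continuous_rV_measurable.
apply: (@integrableS _ _ _ leb setT D) => //.
apply: (@continuous_vanish_integrable R d L (fun x => g x ^+ 2)).
  have : continuous (fun x => g x * g x) by move=> x; exact: (cvgM (cg x) (cg x)).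
  exact.
by move=> x hx; rewrite gL // expr0n.
Qed.

Lemma test_sqint (phi : E -> R) : test_function D phi -> sqint leb D phi.
Proof.
move=> tp; apply: continuous_sqint; last exact: test_vanish.
by case: tp => sp _ _; exact: smooth_continuous.
Qed.

(** The partial derivative of the compactly supported product f * psi has integral
zero. *)
Lemma integral_parts i (f psi : E -> R) : (forall x, differentiable f x) ->
  continuous (partial i f) -> test_function D psi ->
  \int[leb]_(x in D) (f x * partial i psi x) = - \int[leb]_(x in D) (partial i f x * psi x).
Proof.
move=> df cpf tp; have [sp _ _] := tp.
have dpsi x : differentiable psi x by exact: (sp [::] x).
have tpi := test_partial i tp.
have cf : continuous f by move=> x; exact: differentiable_continuous.
have cpsi := smooth_continuous sp.
have cpi : continuous (partial i psi) by apply: smooth_continuous; exact: smooth_partial.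
have vpsi := test_vanish tp.
have c1 : continuous (fun x => f x * partial i psi x) by move=> x; exact: (cvgM (cf x) (cpi x)).
have c2 : continuous (fun x => psi x * partial i f x) by move=> x; exact: (cvgM (cpsi x) (cpf x)).
have I1 : leb.-integrable D (EFin \o (fun x => f x * partial i psi x)).
  apply: (@integrableS _ _ _ leb setT D) => //.
  apply: (continuous_vanish_integrable c1 (L := L)) => x hx.
  by rewrite (test_vanish tpi) // mulr0.
have I2 : leb.-integrable D (EFin \o (fun x => psi x * partial i f x)).
  apply: (@integrableS _ _ _ leb setT D) => //.
  by apply: (continuous_vanish_integrable c2 (L := L)) => x hx; rewrite vpsi // mul0r.
have pE := partialM i df dpsi.
have int0 : (\int[leb]_x (partial i (fun x => (f x * psi x)%R) x)%:E = 0)%E.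
  apply: (@integral_partial_eq0 R d i _ L).
  - by move=> x; apply: diff_derivable; exact: (@differentiableM _ _ f psi).
  - by rewrite pE => x; exact: (cvgD (c1 x) (c2 x)).
  - by move=> x hx; rewrite vpsi // mulr0.
apply/eqP; rewrite -addr_eq0.
rewrite [X in _ + X](_ : _ = \int[leb]_(x in D) (psi x * partial i f x)); last first.
  by apply: eq_Rintegral => x _; rewrite mulrC.
rewrite -RintegralD //.
rewrite Rintegral_mkcond.
apply/eqP; rewrite /Rintegral.
rewrite (_ : (\int[leb]_x _)%E = 0%E) //.
rewrite -[RHS]int0 pE; apply: eq_integral => x _; rewrite patchE; case: ifPn => //.
rewrite notin_setE => nD; rewrite (test_function_out tp nD) mul0r.
by rewrite (test_function_out tpi nD) mulr0 addr0.
Qed.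

End test_functions.

(** * Weak gradients and the space of functions vanishing on the boundary *)

Section sums.
Context dd (T : measurableType dd) (R : realType).
Variables (mu : {measure set T -> \bar R}) (D : set T).
Hypothesis mD : measurable D.

Lemma integrable_Rsum (I : Type) (s : seq I) (F : I -> T -> R) :
  (forall i, mu.-integrable D (EFin \o F i)) ->
  mu.-integrable D (EFin \o (fun x => \sum_(i <- s) F i x)) /\
  \int[mu]_(x in D) (\sum_(i <- s) F i x) = \sum_(i <- s) \int[mu]_(x in D) F i x.
Proof.
move=> IF; elim: s => [|i s [IH1 IH2]].
  split; last by rewrite big_nil; under eq_Rintegral do rewrite big_nil;
    rewrite Rintegral_cst // mul0r.
  rewrite (_ : _ \o _ = cst 0%E); first exact: integrable0.
  by apply/funext => x /=; rewrite big_nil.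
rewrite big_cons -IH2 -RintegralD //; split.
  rewrite (_ : _ \o _ = (EFin \o F i) \+ (EFin \o (fun x => (\sum_(i <- s) F i x)%R)))%E.
    exact: integrableD.
  by apply/funext => x /=; rewrite big_cons EFinD.
by apply: eq_Rintegral => x _; rewrite big_cons.
Qed.

Lemma sqint_integrable (f : T -> R) : (mu D < +oo)%E -> sqint mu D f ->
  mu.-integrable D (EFin \o f).
Proof.
move=> Dfin [mf If].
have I1 : mu.-integrable D (EFin \o (fun=> 1)).
  apply/integrableP; split; first exact: measurable_cst.
  under eq_integral do rewrite /= normr1.
  by rewrite integral_cst // mul1e.
apply: (le_integrable mD _ _ (integrableD mD I1 If)).
  exact/measurable_EFinP.
move=> x _ /=; rewrite lee_fin [leRHS]ger0_norm ?addr_ge0 ?sqr_ge0 //.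
have [h|h] := leP `|f x| 1; first by rewrite (le_trans h) // lerDl sqr_ge0.
rewrite -[f x ^+ 2]real_normK ?num_real //; nra.
Qed.

Lemma sqint_cst (c : R) : (mu D < +oo)%E -> sqint mu D (fun=> c).
Proof.
move=> Dfin; split; first exact: measurable_cst.
apply/integrableP; split; first exact: measurable_cst.
by rewrite integral_cst // lte_mul_pinfty // lee_fin.
Qed.

End sums.

Section weak_gradients.
Context {R : realType} {d : nat}.
Local Notation E := 'rV[R]_d.
Local Notation leb := (@lebesgue_rV R d).
Variables (D : set E) (L : R).
Hypothesis oD : open D.
Hypothesis DL : forall x, D x -> forall j, `|x ord0 j| <= L.
Let mD : measurable D := open_rV_measurable oD.
Local Notation ip := (l2ip leb D).
Local Notation Z := (l2_hilbert (option 'I_d) leb mD).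

Lemma domain_lty : (leb D < +oo)%E.
Proof.
apply: (le_lt_trans (le_measure _ _ _ (_ : D `<=` ball 0 (`|L| + 1)))); rewrite ?inE //.
- exact: rV_ball_measurable.
- by move=> x Dx; rewrite rV_ballE // => i; rewrite mxE subr0;
    apply: le_lt_trans (DL Dx i) _; rewrite (le_lt_trans (ler_norm _)) // ltrDl.
- by rewrite [ltLHS](lebesgue_rV_ball 0 (_ : 0 < `|L| + 1)) ?ltry // ltr_wpDl.
Qed.

(** The index None refers to the function itself, Some i to its i-th partial
derivative. *)
Definition jet (phi : E -> R) : option 'I_d -> E -> R :=
  fun o => if o is Some i then partial i phi else phi.

Definition with_grad (v : E -> R) (G : E -> E) : option 'I_d -> E -> R :=
  fun o => if o is Some i then (fun x => G x ord0 i) else v.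

Definition gradient_part (z : option 'I_d -> E -> R) : E -> E :=
  fun x => \row_i z (Some i) x.

Lemma with_gradK z : with_grad (z None) (gradient_part z) = z.
Proof.
by apply/funext => -[i|] //=; apply/funext => x; rewrite mxE.
Qed.

Lemma smooth_lin a (phi psi : E -> R) : smooth phi -> smooth psi ->
  smooth (fun x => a * phi x + psi x) /\
  forall s, foldr partial (fun x => a * phi x + psi x) s =
     fun x => a * foldr partial phi s x + foldr partial psi s x.
Proof.
move=> sp sq.
have dlin s x : differentiable (fun x => a * foldr partial phi s x + foldr partial psi s x) x.
  apply: (@differentiableD _ _ _ (fun x => a * foldr partial phi s x) (foldr partial psi s)) => //.
  by apply: (@differentiableM _ _ (fun=> a) (foldr partial phi s)).
have fE s : foldr partial (fun x => a * phi x + psi x) s =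
     fun x => a * foldr partial phi s x + foldr partial psi s x.
  elim: s => //= i s ->.
  rewrite partialD //; last first.
    by move=> x; apply: (@differentiableM _ _ (fun=> a) (foldr partial phi s)).
  rewrite (@partialM _ _ i (fun=> a)) // partial_cst.
  by apply/funext => x; rewrite mulr0 addr0.
by split=> // s x; rewrite fE.
Qed.

Lemma test_lin a (phi psi : E -> R) : test_function D phi -> test_function D psi ->
  test_function D (fun x => a * phi x + psi x).
Proof.
move=> [sp cp Dp] [sq cq Dq].
apply: (test_functionI (smooth_lin a sp sq).1 (compactU cp cq)).
  by move=> x [/Dp|/Dq].
move=> x /not_orP[n1 n2].
have -> : phi x = 0 by apply: contrapT => /eqP h; apply: n1; exact: subset_closure.
have -> : psi x = 0 by apply: contrapT => /eqP h; apply: n2; exact: subset_closure.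
by rewrite mulr0 addr0.
Qed.

Lemma test0 : test_function D (fun=> 0).
Proof.
apply: (@test_functionI _ _ D set0) => //.
- by apply: elementary_smooth; exact: elem_cst.
- exact: compact0.
Qed.

Definition jets : set (option 'I_d -> E -> R) := [set jet phi | phi in test_function D].

Lemma jets0 : jets 0.
Proof.
exists (fun=> 0); first exact: test0.
by apply/funext => -[i|] //=; rewrite partial_cst.
Qed.

Lemma jets_lin a x y : jets x -> jets y -> jets (a *: x + y).
Proof.
move=> [phi tp <-] [psi tq <-]; exists (fun x => a * phi x + psi x); first exact: test_lin.
have [sp _ _] := tp; have [sq _ _] := tq.
by apply/funext => -[i|] //=; have := (smooth_lin a sp sq).2 [:: i].
Qed.

Lemma jets_dom : jets `<=` hdom Z.
Proof.
move=> _ [phi tp <-]; have : forall o, sqint leb D (jet phi o); last exact.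
by move=> [i|]; apply: (test_sqint oD DL) => //; exact: test_partial.
Qed.

(** The space H^1_0 as a Hilbert space of pairs (function, gradient).  Since a weak
gradient is determined only almost everywhere, it is carried along as a
datum, which makes all the forms below honest bounded bilinear forms. *)
Definition H10_graph : hilbert (option 'I_d -> E -> R) :=
  hilbert_closure jets0 jets_lin jets_dom.

Local Notation W := (hclosure Z jets).

(** The pairs (phi, grad phi) satisfy the defining identity by integration by
parts, and for a fixed test function both of its sides are continuous. *)
Lemma jet_closure_weak_grad z : W z -> is_weak_grad D (z None) (gradient_part z).
Proof.
move=> Wz; have [dz _] := Wz; split=> [i|phi tp i].
  apply/(L2_sqint mD).
  have -> : (fun x => gradient_part z x ord0 i) = z (Some i).
    by apply/funext => x; rewrite mxE.
  exact: (dz (Some i)).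
have sphi := test_sqint oD DL tp; have spi := test_sqint oD DL (test_partial i tp).
have [l1 b1] := @l2_functional_bnd _ _ _ (option 'I_d) leb D mD None _ spi.
have [l2 b2] := @l2_functional_bnd _ _ _ (option 'I_d) leb D mD (Some i) _ sphi.
(* For fixed phi the defining identity of the weak gradient is l z = 0. *)
pose l (z : option 'I_d -> E -> R) := ip (partial i phi) (z None) + ip phi (z (Some i)).
have lz : l z = 0.
  apply: (@linear_closure_eq0 _ _ Z jets jets_dom l (Num.sqrt (ip (partial i phi) (partial i phi)) + Num.sqrt (ip phi phi)) z _ _ _ Wz).
  - by move=> a x y dx dy; rewrite /l l1 // l2 //; ring.
  - move=> x dx; apply: le_trans (ler_normD _ _) _.
    by rewrite mulrDl lerD ?b1 ?b2.
  - move=> _ [psi tq <-]; rewrite /l /=; apply/eqP; rewrite addr_eq0; apply/eqP.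
    rewrite l2ipC /l2ip (integral_parts oD DL) //.
    + by congr (- _); apply: eq_Rintegral => x _; rewrite mulrC.
    + by move=> x; case: tq => sq _ _; exact: (sq [::] x).
    + by apply: smooth_continuous; apply: smooth_partial; case: tq.
move/eqP: lz; rewrite /l addr_eq0 => /eqP.
rewrite (l2ipC _ _ (partial i phi)) (l2ipC _ _ phi) /l2ip => ->.
by congr (- _); apply: eq_Rintegral => x _; rewrite mxE.
Qed.

(** The difference of the two gradients is orthogonal to all test functions. *)
Lemma weak_grad_unique v v' G G' : sqint leb D v -> sqint leb D v' ->
  ae_eq leb D v v' -> is_weak_grad D v G -> is_weak_grad D v' G' ->
  forall i, ae_eq leb D (fun x => G x ord0 i) (fun x => G' x ord0 i).
Proof.
move=> sv sv' vv' [sG gG] [sG' gG'] i.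
have sGi : sqint leb D (fun x => G x ord0 i) by exact/(L2_sqint mD).
have sGi' : sqint leb D (fun x => G' x ord0 i) by exact/(L2_sqint mD).
have sd := sqintB mD sGi sGi'.
have := @test_ae_eq0 _ _ D (fun x => G x ord0 i - G' x ord0 i) mD
  (sqint_integrable mD domain_lty sd).
move=> /(_ _ oD) h; have : ae_eq leb D (fun x => G x ord0 i - G' x ord0 i) (fun=> 0).
  apply: h => phi tp.
  have sp := test_sqint oD DL tp; have spi := test_sqint oD DL (test_partial i tp).
  have := l2ip_lin mD (-1) sGi' sGi sp.
  rewrite /l2ip => E0.
  transitivity (\int[leb]_(x in D) ((-1 * G' x ord0 i + G x ord0 i) * phi x)).
    by apply: eq_Rintegral => x _; rewrite mulN1r addrC.
  rewrite E0.
  have := gG _ tp i; have := gG' _ tp i.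
  have -> : \int[leb]_(x in D) (v x * partial i phi x) = \int[leb]_(x in D) (v' x * partial i phi x).
    have [mv _] := sv; have [mv' _] := sv'; have [mp _] := spi.
    apply: (@ae_eq_l2ip _ _ _ leb D mD) => //; exact: ae_eq_refl.
  move=> -> /oppr_inj ->; ring.
by apply: filterS => x hx Dx; apply/eqP; rewrite -subr_eq0; apply/eqP; exact: hx.
Qed.

Lemma weak_gradP v : H1 D v -> is_weak_grad D v (weak_grad D v).
Proof. by move=> [_ [G hG]]; exact: (xgetPex _ (ex_intro _ G hG)). Qed.

Lemma weak_grad_comp v G i : is_weak_grad D v G -> sqint leb D (fun x => G x ord0 i).
Proof. by move=> [sG _]; apply/(L2_sqint mD); exact: sG. Qed.

Lemma with_grad_dom v G : sqint leb D v -> is_weak_grad D v G -> hdom Z (with_grad v G).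
Proof.
move=> sv wG; have : forall o, sqint leb D (with_grad v G o); last exact.
by move=> [i|] //; exact: (weak_grad_comp i wG).
Qed.

Lemma weak_grad_H1 v G : sqint leb D v -> is_weak_grad D v G -> H1 D v.
Proof. by move=> sv wG; split; [apply/(L2_sqint mD) | exists G]. Qed.

Lemma l2ip_grad_eq v G G' w K K' i j : sqint leb D v -> sqint leb D w ->
  is_weak_grad D v G -> is_weak_grad D v G' -> is_weak_grad D w K -> is_weak_grad D w K' ->
  ip (fun x => G x ord0 i) (fun x => K x ord0 j) = ip (fun x => G' x ord0 i) (fun x => K' x ord0 j).
Proof.
move=> sv sw wG wG' wK wK'.
apply: ae_eq_l2ip => //.
- by case: (weak_grad_comp i wG).
- by case: (weak_grad_comp i wG').
- by case: (weak_grad_comp j wK).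
- by case: (weak_grad_comp j wK').
- exact: (weak_grad_unique sv sv (ae_eq_refl _ _ _) wG wG' i).
- exact: (weak_grad_unique sw sw (ae_eq_refl _ _ _) wK wK' j).
Qed.

Lemma H1seminorm_sqr v G : sqint leb D v -> is_weak_grad D v G ->
  H1seminorm D v ^+ 2 = \sum_i ip (fun x => G x ord0 i) (fun x => G x ord0 i).
Proof.
move=> sv wG; have wK := weak_gradP (weak_grad_H1 sv wG).
set K := weak_grad D v in wK.
have sK i := weak_grad_comp i wK.
have [Id dE] := @integrable_Rsum _ _ _ leb D mD 'I_d (index_enum _)
  (fun i x => K x ord0 i * K x ord0 i) (fun i => sqint_mul mD (sK i) (sK i)).
have md : measurable_fun D (fun x => dot (K x) (K x)).
  by have /integrableP[/measurable_EFinP] := Id.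
have d0 x : 0 <= dot (K x) (K x).
  by apply: sumr_ge0 => i _; rewrite -expr2 sqr_ge0.
have sE : sqint leb D (enorm \o K).
  split.
    apply: (@measurableT_comp _ _ _ _ _ _ (@Num.sqrt R)) => //.
    by apply: continuous_measurable_fun; exact: sqrt_continuous.
  by apply: eq_integrable Id => // x _ /=; rewrite sqr_sqrtr.
rewrite L2norm_sqr // /l2ip.
transitivity (\int[leb]_(x in D) dot (K x) (K x)).
  by apply: eq_Rintegral => x _; rewrite /= -expr2 sqr_sqrtr.
rewrite [LHS]dE; apply: eq_bigr => i _.
exact: (l2ip_grad_eq i i sv sv wK wG wK wG).
Qed.

Lemma hnorm_with_grad v G : hnorm Z (with_grad v G) ^+ 2 =
  ip v v + \sum_i ip (fun x => G x ord0 i) (fun x => G x ord0 i).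
Proof.
rewrite l2_hnorm_sqr (bigD1 None) //=; congr (_ + _).
rewrite (reindex_omap Some id) /=; last by case.
by apply: eq_bigl => i; rewrite eqxx.
Qed.

Lemma H1normE v G : sqint leb D v -> is_weak_grad D v G ->
  H1norm D v = hnorm Z (with_grad v G).
Proof.
move=> sv wG; rewrite /H1norm L2norm_sqr // (H1seminorm_sqr sv wG) -hnorm_with_grad.
by rewrite sqrtr_sqr ger0_norm // hnorm_ge0.
Qed.

Lemma weak_grad_lin a v w G K : sqint leb D v -> sqint leb D w ->
  is_weak_grad D v G -> is_weak_grad D w K ->
  is_weak_grad D (fun x => a * v x + w x) (fun x => a *: G x + K x).
Proof.
move=> sv sw wG wK; split=> [i|phi tp i].
  apply/(L2_sqint mD).
  have := sqint_lin mD a (weak_grad_comp i wG) (weak_grad_comp i wK).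
  by congr sqint; apply/funext => x; rewrite !mxE.
have sphi := test_sqint oD DL tp; have spi := test_sqint oD DL (test_partial i tp).
have := l2ip_lin mD a sv sw spi; rewrite /l2ip => ->.
have := l2ip_lin mD a (weak_grad_comp i wG) (weak_grad_comp i wK) sphi; rewrite /l2ip.
rewrite (wG.2 _ tp i) (wK.2 _ tp i).
rewrite (_ : \int[leb]_(x in D) ((a *: G x + K x) ord0 i * phi x) =
  \int[leb]_(x in D) ((a * G x ord0 i + K x ord0 i) * phi x)); last first.
  by apply: eq_Rintegral => x _; rewrite !mxE.
by move=> ->; ring.
Qed.

Lemma test_weak_grad phi : test_function D phi ->
  is_weak_grad D phi (fun x => \row_i partial i phi x).
Proof.
move=> tp; have : W (jet phi) by apply: sub_hclosure; [exact: jets_dom | exists phi].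
by move/jet_closure_weak_grad.
Qed.

Lemma H10_jet_closure v G : H10 D v -> is_weak_grad D v G -> W (with_grad v G).
Proof.
move=> [[/(L2_sqint mD) sv _] hv] wG; split; first exact: with_grad_dom.
move=> e e0; have [phi tp pe] := hv e e0.
exists (jet phi); first by exists phi.
have sp := test_sqint oD DL tp.
have wd := weak_grad_lin (-1) sp sv (test_weak_grad tp) wG.
move: pe; rewrite (_ : v \- phi = fun x => -1 * phi x + v x); last first.
  by apply/funext => x /=; rewrite mulN1r addrC.
rewrite (H1normE (sqint_lin mD (-1) sp sv) wd); congr (hnorm _ _ < _).
apply/funext => -[i|] /=; apply/funext => x /=.
  by rewrite !mxE mulN1r addrC.
by rewrite mulN1r addrC.
Qed.

Lemma jet_closure_H10 z : W z -> H10 D (z None).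
Proof.
move=> Wz; have [dz hz] := Wz; have sv := dz None; have wG := jet_closure_weak_grad Wz.
split; first exact: weak_grad_H1 wG.
move=> e e0; have [_ [phi tp <-] pe] := hz e e0; exists phi => //.
have sp := test_sqint oD DL tp.
have wd := weak_grad_lin (-1) sp sv (test_weak_grad tp) wG.
move: pe; rewrite (_ : z None \- phi = fun x => -1 * phi x + z None x); last first.
  by apply/funext => x /=; rewrite mulN1r addrC.
rewrite (H1normE (sqint_lin mD (-1) sp sv) wd); congr (hnorm _ _ < _).
apply/funext => -[i|] /=; apply/funext => x /=.
  by rewrite !mxE mulN1r addrC.
by rewrite mulN1r addrC.
Qed.

End weak_gradients.

(** * The convection-diffusion form *)

Section affine_fields.
Context {R : realType} {d : nat}.
Local Notation E := 'rV[R]_d.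
Variable b : E -> E.
Hypothesis ab : affine b.

Lemma affine_elementary i : elementary (fun x => b x ord0 i).
Proof.
have [A [c bE]] := ab.
rewrite (_ : (fun x => _) = fun x : E => \sum_(j < d) x ord0 j * A j i + c ord0 i); last first.
  by apply/funext => x; rewrite bE !mxE.
apply: elem_add; last exact: elem_cst.
elim: (index_enum _) => [|j s IH].
  rewrite (_ : (fun x => _) = fun=> 0); first exact: elem_cst.
  by apply/funext => x; rewrite big_nil.
rewrite (_ : (fun x => _) = fun x : E => x ord0 j * A j i + \sum_(j <- s) x ord0 j * A j i).
  apply: elem_add => //; apply: elem_mul; [exact: elem_coord | exact: elem_cst].
by apply/funext => x; rewrite big_cons.
Qed.

Lemma affine_bounded (L : R) i : exists B, forall x : E, (forall j, `|x ord0 j| <= L) ->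
  `|b x ord0 i| <= B.
Proof.
have [A [c bE]] := ab.
exists (\sum_j L * `|A j i| + `|c ord0 i|) => x xL.
rewrite bE !mxE (le_trans (ler_normD _ _)) // lerD2r (le_trans (ler_norm_sum _ _ _)) //.
by apply: ler_sum => j _; rewrite normrM ler_wpM2r.
Qed.

End affine_fields.

Section convection_diffusion_form.
Context {R : realType} {d : nat}.
Local Notation E := 'rV[R]_d.
Local Notation leb := (@lebesgue_rV R d).
Variables (D : set E) (L : R).
Hypothesis oD : open D.
Hypothesis DL : forall x, D x -> forall j, `|x ord0 j| <= L.
Hypothesis d_gt0 : (0 < d)%N.
Variable b : E -> E.
Hypothesis ab : affine b.
Hypothesis b_div : forall x, D x -> div b x = 0.
Let mD : measurable D := open_rV_measurable oD.
Local Notation ip := (l2ip leb D).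
Local Notation Z := (l2_hilbert (option 'I_d) leb mD).
Local Notation jets := (jets D).
Local Notation W := (hclosure Z jets).

Lemma field_continuous i : continuous (fun x => b x ord0 i).
Proof. by apply: smooth_continuous; apply: elementary_smooth; exact: affine_elementary. Qed.

Lemma field_measurable i : measurable_fun D (fun x => b x ord0 i).
Proof. by apply: measurable_funTS; apply: continuous_rV_measurable; exact: field_continuous. Qed.

Lemma field_mul_sqint i f : sqint leb D f -> sqint leb D (fun x => b x ord0 i * f x).
Proof.
have [B hB] := affine_bounded ab L i.
move=> sf; apply: (sqint_bounded_mul mD (field_measurable i) _ sf) => x Dx.
by apply: hB; exact: DL.
Qed.

Lemma measurable_coorD (j : 'I_d) : measurable_fun D (fun x : E => x ord0 j).
Proof. by apply: measurable_funTS; exact: measurable_coor. Qed.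

(** Integrating x_i * d_i (phi^2) by parts, the integral of phi^2 is that of
-2 * x_i * phi * d_i phi, where |x_i| <= L. *)
Lemma test_poincare phi i : test_function D phi ->
  ip phi phi <= (2 * L) ^+ 2 * ip (partial i phi) (partial i phi).
Proof.
move=> tp; have [sp _ _] := tp.
have dphi x : differentiable phi x by exact: (sp [::] x).
have dx x : differentiable (fun x : E => x ord0 i) x by exact: differentiable_coord.
have cp := smooth_continuous sp.
have cpi : continuous (partial i phi) by apply: smooth_continuous; exact: smooth_partial.
have cx : continuous (fun x : E => x ord0 i) by move=> x; exact: differentiable_continuous.
have sphi := test_sqint oD DL tp; have spi := test_sqint oD DL (test_partial i tp).
have sx f : sqint leb D f -> sqint leb D (fun x => x ord0 i * f x).
  by move=> sf; apply: (sqint_bounded_mul mD (measurable_coorD i) _ sf) => x Dx; exact: DL.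
have sxp := sx _ sphi; have sxpi := sx _ spi.
have pE : partial i (fun x : E => x ord0 i * phi x) =
    fun x => x ord0 i * partial i phi x + phi x.
  by rewrite partialM // partial_coord; apply/funext => x; rewrite eqxx mulr1.
have := @integral_parts _ _ D L oD DL i (fun x : E => x ord0 i * phi x) phi.
rewrite pE => /(_ _ _ tp) h.
have {h} : ip (fun x => x ord0 i * phi x) (partial i phi) =
    - ip (fun x => 1 * (x ord0 i * partial i phi x) + phi x) phi.
  rewrite /l2ip h //.
  - by congr (- _); apply: eq_Rintegral => x _; rewrite mul1r.
  - by move=> x; exact: (@differentiableM _ _ (fun x : E => x ord0 i) phi).
  - by move=> x; exact: (cvgD (cvgM (cx x) (cpi x)) (cp x)).
rewrite l2ip_lin // mul1r.
have -> : ip (fun x => x ord0 i * partial i phi x) phi =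
    ip (fun x => x ord0 i * phi x) (partial i phi).
  by apply: eq_Rintegral => x _; ring.
set t := ip (fun x => x ord0 i * phi x) (partial i phi).
set p := ip phi phi; set q := ip (partial i phi) (partial i phi) => h.
have pt : p = - 2 * t by lra.
have tp2 : 4 * t ^+ 2 = p ^+ 2 by rewrite pt; ring.
have p0 : 0 <= p by exact: l2ip_ge0.
have q0 : 0 <= q by exact: l2ip_ge0.
have t2 : t ^+ 2 <= L ^+ 2 * p * q.
  apply: le_trans (l2_CS mD sxp spi) _; rewrite ler_wpM2r //.
  by apply: (l2ip_mul_le mD (measurable_coorD i) _ sphi) => x Dx; exact: DL.
have [->|pn0] := eqVneq p 0; first by rewrite mulr_ge0 ?sqr_ge0.
have {}p0 : 0 < p by rewrite lt_neqAle eq_sym pn0.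
rewrite -(ler_pM2r p0); lra.
Qed.

Definition gradsq (z y : option 'I_d -> E -> R) : R := \sum_i ip (z (Some i)) (y (Some i)).

Definition convect (z y : option 'I_d -> E -> R) : R :=
  \sum_i ip (fun x => b x ord0 i * z (Some i) x) (y None).

(** The form of the problem, read on pairs (function, gradient). *)
Definition aform (eps : R) z y : R := eps * gradsq z y + convect z y.

Lemma comp_bform i j : bform Z (fun x y => ip (x i) (y j)).
Proof.
have := @l2_bform_comp _ _ _ (option 'I_d) leb D mD (fun=> 1) 1 i j (measurable_cst _).
rewrite (_ : (fun x y : option 'I_d -> E -> R => ip (fun t => 1 * x i t) (y j)) =
  fun x y => ip (x i) (y j)); first by apply=> x _; rewrite normr1.
apply/funext => x; apply/funext => y.
by apply: eq_Rintegral => t _; rewrite mul1r.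
Qed.

Lemma gradsq_bform : bform Z gradsq.
Proof. by apply: bform_sum => i; exact: comp_bform. Qed.

Lemma convect_bform : bform Z convect.
Proof.
apply: bform_sum => i; have [B hB] := affine_bounded ab L i.
apply: (@l2_bform_comp _ _ _ _ leb D mD _ B); first exact: field_measurable.
by move=> x Dx; apply: hB; exact: DL.
Qed.

Lemma aform_bform eps : bform Z (aform eps).
Proof. by apply: bformD; [apply: bformZ; exact: gradsq_bform | exact: convect_bform]. Qed.

Lemma poincare z : W z -> ip (z None) (z None) <= (2 * L) ^+ 2 * gradsq z z.
Proof.
move=> Wz; rewrite -subr_ge0.
pose c x y := (2 * L) ^+ 2 * gradsq x y + (-1) * ip (x None) (y None).
have -> : (2 * L) ^+ 2 * gradsq z z - ip (z None) (z None) = c z z.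
  by rewrite /c mulN1r.
apply: (bform_closure_ge0 (jets_dom oD DL) _ _ Wz).
  by apply: bformD; apply: bformZ; [exact: gradsq_bform | exact: comp_bform].
move=> _ [phi tp <-]; rewrite /c mulN1r subr_ge0.
apply: le_trans (test_poincare (Ordinal d_gt0) tp) _.
rewrite ler_wpM2l ?sqr_ge0 // /gradsq (bigD1 (Ordinal d_gt0)) //= lerDl.
by apply: sumr_ge0 => i _; exact: l2ip_ge0.
Qed.

(** Twice the integrand is b . grad (phi^2), which integrates to that of
- (div b) * phi^2. *)
Lemma test_skew phi : test_function D phi -> convect (jet phi) (jet phi) = 0.
Proof.
move=> tp; have [sp _ _] := tp.
have dphi x : differentiable phi x by exact: (sp [::] x).
have sphi := test_sqint oD DL tp.
have cp := smooth_continuous sp.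
have eb i := affine_elementary ab i.
have db i x := elementary_diff (eb i) x.
have cb i := field_continuous i.
have cpb i : continuous (partial i (fun x => b x ord0 i)).
  by apply: smooth_continuous; apply: elementary_smooth; exact: elementary_partial.
have sd i : sqint leb D (fun x => phi x * partial i (fun x => b x ord0 i) x).
  apply: (continuous_sqint oD (L := L)).
    by move=> x; exact: (cvgM (cp x) (cpb i x)).
  by move=> x hx; rewrite (test_vanish DL tp) // mul0r.
have main i : 2 * ip (fun x => b x ord0 i * partial i phi x) phi =
    - ip (fun x => phi x * partial i (fun x => b x ord0 i) x) phi.
  have spi := test_sqint oD DL (test_partial i tp).
  have cpi : continuous (partial i phi) by apply: smooth_continuous; exact: smooth_partial.
  have pE := partialM i (db i) dphi.
  have := @integral_parts _ _ D L oD DL i (fun x : E => b x ord0 i * phi x) phi.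
  rewrite pE => /(_ _ _ tp) h.
  have {h} : ip (fun x => b x ord0 i * phi x) (partial i phi) =
      - ip (fun x => 1 * (b x ord0 i * partial i phi x) + phi x * partial i (fun x => b x ord0 i) x) phi.
    rewrite /l2ip h //.
    - by congr (- _); apply: eq_Rintegral => x _; rewrite mul1r.
    - by move=> x; exact: (@differentiableM _ _ (fun x : E => b x ord0 i) phi).
    - by move=> x; exact: (cvgD (cvgM (cb i x) (cpi x)) (cvgM (cp x) (cpb i x))).
  rewrite l2ip_lin //; last exact: field_mul_sqint.
  have -> : ip (fun x => b x ord0 i * phi x) (partial i phi) =
     ip (fun x => b x ord0 i * partial i phi x) phi.
    by apply: eq_Rintegral => x _; ring.
  set p := ip _ phi; set q := ip _ phi; move: p q => p q; lra.
have : 2 * convect (jet phi) (jet phi) = 0.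
  rewrite /convect mulr_sumr (eq_bigr _ (fun i _ => main i)) sumrN.
  have [_ <-] := integrable_Rsum mD (index_enum 'I_d) (fun i => sqint_mul mD (sd i) sphi).
  apply/eqP; rewrite oppr_eq0; apply/eqP.
  transitivity (\int[leb]_(x in D) (0 : R)); last by rewrite Rintegral_cst // mul0r.
  apply: eq_Rintegral => x /set_mem Dx.
  rewrite -mulr_suml -mulr_sumr.
  by have := b_div Dx; rewrite /div => ->; rewrite mulr0 mul0r.
lra.
Qed.

Lemma skew z : W z -> convect z z = 0.
Proof.
move=> Wz; apply/eqP; rewrite eq_le; apply/andP; split.
  have : 0 <= (-1) * convect z z; last by lra.
  apply: (bform_closure_ge0 (jets_dom oD DL) _ _ Wz (c := fun x y => (-1) * convect x y)).
    by apply: bformZ; exact: convect_bform.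
  by move=> _ [phi tp <-]; rewrite test_skew // mulr0.
apply: (bform_closure_ge0 (jets_dom oD DL) convect_bform _ Wz).
by move=> _ [phi tp <-]; rewrite test_skew.
Qed.

Lemma aform_diag eps z : W z -> aform eps z z = eps * gradsq z z.
Proof. by move=> Wz; rewrite /aform skew // addr0. Qed.

Lemma hip_split z : hip Z z z = ip (z None) (z None) + gradsq z z.
Proof.
rewrite /= (bigD1 None) //=; congr (_ + _).
rewrite (reindex_omap Some id) /=; last by case.
by apply: eq_bigl => i; rewrite eqxx.
Qed.

(** Convection does not contribute to the diagonal of the form, so the Poincare
inequality makes it coercive and Lax-Milgram applies. *)
Lemma graph_solution eps g : 0 < eps -> sqint leb D g ->
  exists2 w, W w & forall v, W v -> aform eps w v = ip g (v None).
Proof.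
move=> e0 sg.
pose H := H10_graph oD DL.
have [l r [M M0 hM]] := aform_bform eps.
have K0 : 0 < (2 * L) ^+ 2 + 1 by rewrite ltr_wpDl // sqr_ge0.
have [lg bg] := @l2_functional_bnd _ _ _ (option 'I_d) leb D mD None _ sg.
apply: (@lax_milgram _ _ H (aform eps) M (eps / ((2 * L) ^+ 2 + 1)) _ _ _ _ _
  (fun v => ip g (v None)) (Num.sqrt (ip g g))).
- by move=> c x y z [dx _] [dy _] [dz _]; exact: l.
- by move=> c x y z [dx _] [dy _] [dz _]; exact: r.
- by move=> x y [dx _] [dy _]; exact: hM.
- exact: divr_gt0.
- move=> x Wx; rewrite aform_diag // -[hip H x x]/(hip Z x x) hip_split.
  rewrite mulrAC ler_pdivrMr // -mulrA ler_wpM2l ?(ltW e0) //.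
  have := poincare Wx; lra.
- by move=> c x y [dx _] [dy _]; exact: lg.
- by move=> x [dx _]; exact: bg.
Qed.

Lemma graph_unique eps z : 0 < eps -> W z -> aform eps z z = 0 ->
  ip (z None) (z None) = 0 /\ gradsq z z = 0.
Proof.
move=> e0 Wz; rewrite aform_diag // => /eqP; rewrite mulf_eq0 gt_eqF //= => /eqP g0.
split=> //; apply/eqP; rewrite eq_le l2ip_ge0 andbT.
by rewrite (le_trans (poincare Wz)) // g0 mulr0.
Qed.

(** The value of the form does not depend on the choice of the weak gradients. *)
Lemma bilinE eps v G w K : sqint leb D v -> sqint leb D w ->
  is_weak_grad D v G -> is_weak_grad D w K ->
  bilin D b eps v w = aform eps (with_grad v G) (with_grad w K).
Proof.
move=> sv sw wG wK.
have wG' := weak_gradP (weak_grad_H1 oD sv wG).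
have wK' := weak_gradP (weak_grad_H1 oD sw wK).
rewrite /bilin /aform; set G' := weak_grad D v in wG' *; set K' := weak_grad D w in wK' *.
have sG' i := weak_grad_comp oD i wG'; have sK' i := weak_grad_comp oD i wK'.
congr (_ * _ + _).
  have [_ ->] := integrable_Rsum mD (index_enum 'I_d) (fun i => sqint_mul mD (sG' i) (sK' i)).
  by apply: eq_bigr => i _; exact: (l2ip_grad_eq oD DL i i sv sw wG' wG wK' wK).
transitivity (\int[leb]_(x in D) \sum_i (b x ord0 i * G' x ord0 i * w x)).
  by apply: eq_Rintegral => x _; rewrite mulr_suml.
have [_ ->] := integrable_Rsum mD (index_enum 'I_d)
   (fun i => sqint_mul mD (field_mul_sqint i (sG' i)) sw).
apply: eq_bigr => i _; have [mw _] := sw.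
have [m1 _] := field_mul_sqint i (sG' i).
have [m2 _] := field_mul_sqint i (weak_grad_comp oD i wG).
apply: ae_eq_l2ip => //; last exact: ae_eq_refl.
have := weak_grad_unique oD DL sv sv (ae_eq_refl _ _ _) wG' wG i.
by apply: filterS => x h Dx; rewrite /= h.
Qed.

End convection_diffusion_form.

(** * The discrete solution is the exact solution for projected data *)

Section null_vectors.
Context {R : realType} {X : lmodType R} (H : hilbert X).
Local Notation dom := (hdom H).

(** Solutions are unique up to null vectors only, and bounded forms do not see
these. *)
Lemma bform_nulll c n y : bform H c -> dom n -> dom y -> hip H n n = 0 -> c n y = 0.
Proof.
move=> [_ _ [M M0 hM]] dn dy n0; apply/eqP; rewrite -normr_eq0 eq_le normr_ge0 andbT.
by rewrite (le_trans (hM _ _ dn dy)) // /hnorm n0 sqrtr0 mulr0 mul0r.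
Qed.

Lemma bform_nullr c n y : bform H c -> dom n -> dom y -> hip H n n = 0 -> c y n = 0.
Proof.
move=> [_ _ [M M0 hM]] dn dy n0; apply/eqP; rewrite -normr_eq0 eq_le normr_ge0 andbT.
by rewrite (le_trans (hM _ _ dy dn)) // /hnorm n0 sqrtr0 mulr0.
Qed.

Lemma bform_diag_null c x y : bform H c -> dom x -> dom y ->
  hip H (x - y) (x - y) = 0 -> c x x = c y y.
Proof.
move=> bc dx dy n0; have dn := hdomB dx dy; have [l r _] := bc.
have h1 : c x x = c y x.
  have := bform_nulll bc dn dx n0.
  by have := l (-1) y x x dy dx dx; rewrite scaleN1r addrC => ->; lra.
have h2 : c y x = c y y.
  have := bform_nullr bc dn dy n0.
  by have := r (-1) y x y dy dx dy; rewrite scaleN1r addrC => ->; lra.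
by rewrite h1.
Qed.

Lemma hip_null_sub x y z : dom x -> dom y -> dom z -> hip H (x - y) (x - y) = 0 ->
  hip H (y - z) (y - z) = 0 -> hip H (x - z) (x - z) = 0.
Proof.
move=> dx dy dz n1 n2; have d1 := hdomB dx dy; have d2 := hdomB dy dz.
have := hnormD d1 d2; rewrite subrKA /hnorm n1 n2 !sqrtr0 addr0 => h.
have d3 := hdomB dx dz; apply/eqP; rewrite eq_le hip_ge0 // andbT.
by rewrite -sqrtr_eq0 eq_le h sqrtr_ge0.
Qed.

End null_vectors.

Section galerkin.
Context {R : realType} {d : nat}.
Local Notation E := 'rV[R]_d.
Local Notation leb := (@lebesgue_rV R d).
Variables (D : set E) (L : R).
Hypothesis oD : open D.
Hypothesis DL : forall x, D x -> forall j, `|x ord0 j| <= L.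
Hypothesis d_gt0 : (0 < d)%N.
Variable b : E -> E.
Hypothesis ab : affine b.
Hypothesis b_div : forall x, D x -> div b x = 0.
Variable eps : R.
Hypothesis eps_gt0 : 0 < eps.
Let mD : measurable D := open_rV_measurable oD.
Local Notation ip := (l2ip leb D).
Local Notation Z := (l2_hilbert (option 'I_d) leb mD).
Local Notation W := (hclosure Z (jets D)).
Local Notation H := (H10_graph oD DL).
Local Notation solves := (solves D b eps).
Local Notation Ainv := (Ainv D b eps).
Local Notation aform := (aform D b eps).
Local Notation graph v := (with_grad v (weak_grad D v)).

Let WZ z : W z -> hdom Z z. Proof. by case. Qed.
Let Wlin a x y : W x -> W y -> W (a *: x + y). Proof. exact: (@hdom_lin _ _ H). Qed.
Let WB x y : W x -> W y -> W (x - y). Proof. exact: (@hdomB _ _ H). Qed.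
Let aB : bform Z aform. Proof. exact: (aform_bform oD DL ab). Qed.

Lemma H10_sqint v : H10 D v -> sqint leb D v.
Proof. by move=> [[/(L2_sqint mD) sv _] _]. Qed.

Lemma H10_weak v : H10 D v -> is_weak_grad D v (weak_grad D v).
Proof. by move=> hv; apply: weak_gradP; case: hv. Qed.

Lemma graph_jet_closure v : H10 D v -> W (graph v).
Proof. by move=> hv; apply: (H10_jet_closure oD DL hv); apply: weak_gradP; case: hv. Qed.

Lemma solves_graph g w : solves g w ->
  W (graph w) /\ forall v, W v -> aform (graph w) v = ip g (v None).
Proof.
move=> [hw sw]; split; first exact: graph_jet_closure.
move=> v Wv; have := sw _ (jet_closure_H10 DL Wv); rewrite /L2inner /l2ip => <-.
rewrite (bilinE oD DL ab eps (H10_sqint hw) (H10_sqint (jet_closure_H10 DL Wv)) (H10_weak hw) (jet_closure_weak_grad DL Wv)).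
by rewrite with_gradK.
Qed.

Lemma graph_solves g w : W w -> (forall v, W v -> aform w v = ip g (v None)) ->
  solves g (w None).
Proof.
move=> Ww hw; split; first exact: (jet_closure_H10 DL Ww).
move=> v hv; have := hw _ (graph_jet_closure hv); rewrite /L2inner /l2ip /= => <-.
rewrite (bilinE oD DL ab eps (H10_sqint (jet_closure_H10 DL Ww)) (H10_sqint hv) (jet_closure_weak_grad DL Ww) (H10_weak hv)).
by rewrite with_gradK.
Qed.

(** A solution exists, so the choice in the definition of Ainv is not the default
value. *)
Lemma Ainv_solves g : sqint leb D g -> solves g (Ainv g).
Proof.
move=> sg; have [w Ww hw] := graph_solution oD DL d_gt0 ab b_div eps_gt0 sg.
exact: (xgetPex _ (ex_intro _ (w None) (graph_solves Ww hw))).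
Qed.

Lemma graph_null z : W z -> (forall v, W v -> aform z v = 0) -> hip Z z z = 0.
Proof.
move=> Wz z0; rewrite hip_split.
by have [-> ->] := graph_unique DL d_gt0 ab b_div eps_gt0 Wz (z0 _ Wz); rewrite addr0.
Qed.

(** Functions that agree almost everywhere have weak gradients that agree almost
everywhere. *)
Lemma ae_graph_null v w : H10 D v -> W w -> ae_eq leb D v (w None) ->
  hip Z (graph v - w) (graph v - w) = 0.
Proof.
move=> hv Ww vw; have sv := H10_sqint hv; have sw := H10_sqint (jet_closure_H10 DL Ww).
have wv : is_weak_grad D v (weak_grad D v) by exact: H10_weak.
have z0 (x : E -> R) : ae_eq leb D x (fun=> 0) -> measurable_fun D x -> ip x x = 0.
  move=> x0 mx; rewrite (@ae_eq_l2ip _ _ _ leb D mD _ (fun=> 0) _ (fun=> 0)) //.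
  by rewrite /l2ip; under eq_Rintegral do rewrite mulr0; rewrite Rintegral_cst // mul0r.
rewrite hip_split [X in X + _]z0 ?add0r.
- apply: big1 => i _; apply: z0.
    have := weak_grad_unique oD DL sv sw vw wv (jet_closure_weak_grad DL Ww) i.
    apply: filterS => x h Dx; have := h Dx; rewrite mxE => E0.
    by rewrite !fctE /= E0 subrr.
  apply: measurable_funB; first by case: (weak_grad_comp oD i wv).
  by have [] := WZ Ww (Some i).
- by apply: filterS vw => x h Dx; rewrite !fctE /= h ?subrr.
- by apply: measurable_funB; [case: sv | case: sw].
Qed.

Section mesh_space.
Variables (N : nat) (T : 'I_N -> set E).
Hypothesis mT : forall k, measurable (T k).

Lemma indic_sqint k : sqint leb D (\1_(T k)).
Proof.
split; first exact: measurable_indic.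
have [_ I1] := sqint_cst mD 1 (domain_lty oD DL).
apply: (le_integrable mD _ _ I1).
  by apply/measurable_EFinP; apply: measurable_funX; exact: measurable_indic.
move=> x _ /=; rewrite lee_fin expr1n normr1 ger0_norm ?sqr_ge0 //.
Qed.

Definition basis_graph (k : 'I_N) := graph (Ainv (\1_(T k))).
Definition comb (c : 'I_N -> R) := \sum_k c k *: basis_graph k.
Definition step (c : 'I_N -> R) : E -> R := fun x => \sum_k c k * \1_(T k) x.

(** By linearity, A^-1 of a piecewise constant function is the corresponding
combination of the generators of the discrete space. *)
Lemma comb_solves c : W (comb c) /\ sqint leb D (step c) /\
  forall v, W v -> aform (comb c) v = ip (step c) (v None).
Proof.
rewrite /comb /step; elim: (index_enum _) => [|k s [IH1 [IH2 IH3]]].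
  rewrite big_nil; split; first exact: (hdom0 H).
  rewrite (_ : (fun x => _) = fun=> 0); last by apply/funext => x; rewrite big_nil.
  split; first exact: sqint0.
  move=> v Wv; rewrite (bform_nulll aB (hdom0 Z) (WZ Wv)) ?hip0l //; last exact: hdom0.
  by rewrite /l2ip; under eq_Rintegral do rewrite mul0r; rewrite Rintegral_cst // mul0r.
have [Wk hk] := solves_graph (Ainv_solves (indic_sqint k)).
rewrite big_cons (_ : (fun x => _) =
    fun x => c k * \1_(T k) x + \sum_(k <- s) c k * \1_(T k) x); last first.
  by apply/funext => x; rewrite big_cons.
split; first exact: (Wlin (c k) Wk IH1).
split; first by apply: sqint_lin => //; exact: indic_sqint.
move=> v Wv; have [l _ _] := aB.
rewrite (l _ _ _ _ (WZ Wk) (WZ IH1) (WZ Wv)) (IH3 _ Wv) (hk _ Wv).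
by rewrite (l2ip_lin mD (c k) (indic_sqint k) IH2 (WZ Wv None)).
Qed.

Lemma combE c x : comb c None x = \sum_k c k * Ainv (\1_(T k)) x.
Proof.
rewrite /comb; elim: (index_enum _) => [|k s IH]; first by rewrite !big_nil.
by rewrite !big_cons -IH.
Qed.

Lemma comb_VH c : VH D b eps T (comb c None).
Proof.
split; first exact: (jet_closure_H10 DL (comb_solves c).1).
by exists c; apply: aeW => x _; rewrite combE.
Qed.

Lemma combB c c' : comb (fun k => c k - c' k) = comb c - comb c'.
Proof. by rewrite /comb -sumrB; apply: eq_bigr => k _; rewrite scalerBl. Qed.

(** Testing the discrete problem with the difference of u_H and A^-1 (Pi_H f),
which belongs to the discrete space, leaves eps times the squared norm of its
gradient.  Hence the two coincide and u - u_H = A^-1 (f - Pi_H f), to which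
the stability estimate applies. *)
Lemma galerkin_error C f u uH : stability_constant D b C -> admissible D b eps ->
  sqint leb D f -> solves f u -> solvesH D b eps T (PiH T f) uH ->
  Vnorm D eps (u \- uH) <= C * L2norm D (f \- PiH T f).
Proof.
move=> [_ stab] adm sf su [[hH [c cE]] gal].
pose pk k := (fine (leb (T k)))^-1 * \int[leb]_(y in T k) f y.
have PE : PiH T f = step pk by [].
have [Wc [sc ac]] := comb_solves c; have [Wp [sp ap]] := comb_solves pk.
have [Wu au] := solves_graph su; have WH := graph_jet_closure hH.
have nH : hip Z (graph uH - comb c) (graph uH - comb c) = 0.
  apply: (ae_graph_null hH Wc); apply: filterS cE => x h Dx.
  by rewrite (h Dx) combE.
pose v := comb (fun k => c k - pk k).
have Wv : W v := (comb_solves _).1.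
have vE : v = comb c - comb pk by exact: combB.
have [l r _] := aB.
have aBl x y z : W x -> W y -> W z -> aform (x - y) z = aform x z - aform y z.
  by move=> Wx Wy Wz; have := l (-1) y x z (WZ Wy) (WZ Wx) (WZ Wz); rewrite scaleN1r addrC => ->; ring.
have npc : hip Z (comb c - comb pk) (comb c - comb pk) = 0.
  have av : aform v v = 0.
    rewrite {1}vE (aBl _ _ _ Wc Wp Wv) (ap _ Wv) -PE.
    have := gal _ (comb_VH (fun k => c k - pk k)).
    have wH : is_weak_grad D uH (weak_grad D uH) by exact: H10_weak.
    rewrite -/v (bilinE oD DL ab eps (H10_sqint hH) (H10_sqint (jet_closure_H10 DL Wv)) wH (jet_closure_weak_grad DL Wv)).
    rewrite with_gradK => E0.
    have := bform_nulll aB (hdomB (WZ WH) (WZ Wc)) (WZ Wv) nH.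
    rewrite (aBl _ _ _ WH Wc Wv) E0 => /eqP; rewrite subr_eq0 => /eqP <-.
    exact: subrr.
  rewrite -vE hip_split.
  by have [-> ->] := graph_unique DL d_gt0 ab b_div eps_gt0 Wv av; rewrite addr0.
have nHp := hip_null_sub (WZ WH) (WZ Wc) (WZ Wp) nH npc.
have sfp : sqint leb D (f \- PiH T f) by rewrite PE; exact: sqintB.
have sA := Ainv_solves sfp; have [WA aA] := solves_graph sA.
set A := Ainv _ in sA WA aA.
have nA : hip Z (graph u - comb pk - graph A) (graph u - comb pk - graph A) = 0.
  have Wup := WB Wu Wp; apply: (graph_null (WB Wup WA)) => y Wy.
  rewrite (aBl _ _ _ Wup WA Wy) (aBl _ _ _ Wu Wp Wy).
  rewrite (au _ Wy) (ap _ Wy) (aA _ Wy) -PE.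
  have sy := WZ Wy None.
  have := l2ip_lin mD (-1) sp sf sy; rewrite -PE.
  rewrite (_ : (fun x => -1 * PiH T f x + f x) = f \- PiH T f) => [->|]; first by ring.
  by apply/funext => x /=; rewrite mulN1r addrC.
have nfin : hip Z (graph u - graph uH - graph A) (graph u - graph uH - graph A) = 0.
  have dHp := WZ (WB WH Wp).
  apply: (hip_null_sub (WZ (WB Wu WH)) (WZ (WB Wu Wp)) (WZ WA) _ nA).
  rewrite (_ : _ - _ = -1 *: (graph uH - comb pk)); last first.
    by rewrite opprB addrC subrKA scaleN1r opprB.
  by rewrite (hipZl _ dHp (hdomZ _ dHp)) (hipZr _ dHp dHp) nHp !mulr0.
have hu : H10 D u by case: su.
have hA : H10 D A by case: sA.
have Vn v0 G : sqint leb D v0 -> is_weak_grad D v0 G -> Vnorm D eps v0 =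
   Num.sqrt (eps * gradsq D (with_grad v0 G) (with_grad v0 G) + ip v0 v0).
  by move=> s0 w0; rewrite /Vnorm (H1seminorm_sqr oD DL s0 w0) L2norm_sqr.
have wu : is_weak_grad D u (weak_grad D u) by exact: H10_weak.
have wuH : is_weak_grad D uH (weak_grad D uH) by exact: H10_weak.
have wA : is_weak_grad D A (weak_grad D A) by exact: H10_weak.
have su1 := H10_sqint hu; have suH := H10_sqint hH.
have wd := weak_grad_lin oD DL (-1) suH su1 wuH wu.
have dE : u \- uH = fun x => -1 * uH x + u x by apply/funext => x /=; rewrite mulN1r addrC.
have gE : with_grad (fun x => -1 * uH x + u x) (fun x => -1 *: weak_grad D uH x + weak_grad D u x)
    = graph u - graph uH.
  apply/funext => -[i|]; apply/funext => x; rewrite !fctE /=.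
    by rewrite !mxE mulN1r addrC.
  by rewrite mulN1r addrC.
rewrite dE (Vn _ _ (sqint_lin mD (-1) suH su1) wd) gE.
have -> : ip (fun x => -1 * uH x + u x) (fun x => -1 * uH x + u x) =
    ip ((graph u - graph uH) None) ((graph u - graph uH) None) by rewrite -gE.
have qB : bform Z (fun x y => eps * gradsq D x y + ip (x None) (y None)).
  by apply: bformD; [apply: bformZ; exact: gradsq_bform | exact: comp_bform].
have dW : hdom Z (graph u - graph uH) := WZ (WB Wu WH).
rewrite (bform_diag_null qB dW (WZ WA) nfin).
apply: le_trans (stab _ adm (f \- PiH T f) _); last by apply/(L2_sqint mD).
by rewrite -/A (Vn _ _ (H10_sqint hA) wA).
Qed.

End mesh_space.
End galerkin.

(** * Convex elements and meshes *)

Section convex_sets.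
Context {R : realType} {d : nat}.
Local Notation E := 'rV[R]_d.
Local Notation leb := (@lebesgue_rV R d).

Definition is_convex (A : set E) := forall x y t, A x -> A y -> 0 <= t <= 1 ->
  A (t *: x + (1 - t) *: y).

Lemma hull_convex (I : finType) (p : I -> E) : is_convex (hull p).
Proof.
move=> x y t [w [w0 w1 ->]] [w' [w0' w1' ->]] /andP[t0 t1].
exists (fun i => t * w i + (1 - t) * w' i); split.
- by move=> i; rewrite addr_ge0 // mulr_ge0 // subr_ge0.
- by rewrite big_split /= -!mulr_sumr w1 w1' !mulr1 addrC subrK.
- rewrite !scaler_sumr -big_split /=; apply: eq_bigr => i _.
  by rewrite [RHS]scalerDl -!scalerA.
Qed.

(** A small displacement of a convex combination is the same combination of
displaced points. *)
Lemma interior_convex (A : set E) : is_convex A -> is_convex (interior A).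
Proof.
move=> cA x y t; rewrite /interior /= => nx ny t01.
have /nbhs_ballP[r /= r0 rA] := nx; have /nbhs_ballP[r' /= r0' rA'] := ny.
pose m := Num.min r r'; have m0 : 0 < m by rewrite lt_min r0.
apply/nbhs_ballP; exists m => //= z.
set c := t *: x + (1 - t) *: y => cz.
have -> : z = t *: (x + (z - c)) + (1 - t) *: (y + (z - c)).
  have -> w : t *: (x + w) + (1 - t) *: (y + w) = c + w.
    by rewrite !scalerDr addrACA -/c -scalerDl [t + _]addrC subrK scale1r.
  by rewrite addrC subrK.
have zc i : `|z ord0 i - c ord0 i| < m by move: cz; rewrite rV_ballE.
apply: cA => //.
- apply: rA; apply: (@le_ball _ _ x m); first by rewrite ge_min lexx.
  by rewrite rV_ballE // => i; rewrite !mxE [x _ _ + _]addrC addrK; have := zc i; rewrite !mxE.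
- apply: rA'; apply: (@le_ball _ _ y m); first by rewrite ge_min lexx orbT.
  by rewrite rV_ballE // => i; rewrite !mxE [y _ _ + _]addrC addrK; have := zc i; rewrite !mxE.
Qed.

(** A point y of the closure is close to some y' in T.  Shifting the error y - y'
to the interior point x0 leaves a convex combination of points of T. *)
Lemma convex_closure_shrink (T : set E) x0 l : open T -> is_convex T -> T x0 ->
  0 < l < 1 -> closure T `<=` [set y | T (l *: y + (1 - l) *: x0)].
Proof.
move=> oT cT Tx0 /andP[l0 l1] y cy /=.
have : nbhs x0 T by exact: open_nbhs_nbhs.
move=> /nbhs_ballP[r /= r0 rT].
have l1' : 0 < 1 - l by lra.
have k0 : 0 < (1 - l) * r / l by rewrite divr_gt0 // mulr_gt0.
have [y' [Ty' yy']] := cy (ball y ((1 - l) * r / l)) (nbhsx_ballx _ _ k0).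
have -> : l *: y + (1 - l) *: x0 = l *: y' + (1 - l) *: (x0 + (l / (1 - l)) *: (y - y')).
  rewrite scalerDr scalerA mulrCA divff ?gt_eqF // mulr1 scalerBr.
  by rewrite [LHS]addrC [RHS]addrC -addrA subrK.
apply: cT => //; last by rewrite !ltW.
apply: rT; rewrite rV_ballE // => i; rewrite !mxE [x0 _ _ + _]addrC addrK.
move: yy'; rewrite rV_ballE // => /(_ i); rewrite distrC => h.
rewrite normrM gtr0_norm ?divr_gt0 // mulrAC ltr_pdivrMr // mulrC -ltr_pdivlMr //.
by rewrite [r * _]mulrC.
Qed.

(** Shrinking the closure towards a point of T by a factor l < 1 maps it into T,
so that l^d |closure T| <= |T|; then l tends to 1. *)
Lemma lebesgue_convex_boundary (T : set E) : open T -> is_convex T -> bounded_set T ->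
  leb (closure T `\` T) = 0%E.
Proof.
move=> oT cT bT.
have [->|/set0P[x0 Tx0]] := eqVneq T set0.
  by rewrite closure0 set0D measure0.
have mT := open_rV_measurable oT.
have mC : measurable (closure T) by apply: closed_rV_measurable; exact: closed_closure.
have Tfin : (leb T < +oo)%E by exact: bounded_rV_lty.
have scaled l : 0 < l < 1 -> (leb (closure T) <= (l ^- d)%:E * leb T)%E.
  move=> l01; have l0 : 0 < l by case/andP: l01.
  pose P := [set y | T (l *: y + (1 - l) *: x0)].
  have mf : measurable_fun setT (fun x : E => (\1_T x)%:E : \bar R).
    by apply/measurable_EFinP; exact: measurable_indic.
  have mP : measurable P.
    have := measurable_affine_rV l ((1 - l) *: x0) measurableT mT.
    by rewrite setTI.
  apply: (@le_trans _ _ (leb P)).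
    by apply: le_measure; rewrite ?inE //; exact: convex_closure_shrink.
  have f0 (x : E) : (0 <= (\1_T x)%:E :> \bar R)%E by rewrite lee_fin.
  have := ge0_integral_affine ((1 - l) *: x0) l0 mf f0.
  have -> : (\int[leb]_x (\1_T x)%:E = leb T)%E by rewrite integral_indic // setIT.
  move=> <-; rewrite le_eqVlt; apply/orP; left; apply/eqP.
  transitivity (\int[leb]_x (\1_P x)%:E)%E; first by rewrite integral_indic // setIT.
  by apply: eq_integral => x _; rewrite !indicE.
have le : (leb (closure T) <= leb T)%E.
  rewrite -(fineK (_ : leb T \is a fin_num)) ?ge0_fin_numE ?measure_ge0 //.
  set m := fine (leb T); have m0 : 0 <= m by apply: fine_ge0; exact: measure_ge0.
  (* The factors 1 - 1 / (k + 2), unlike 1 - 1 / (k + 1), are all positive. *)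
  have cv : (fun k : nat => ((1 - k.+2%:R^-1) ^- d * m)%:E) @ \oo --> m%:E.
    apply: cvg_EFin; first exact: nearW.
    rewrite -[X in _ --> X]mul1r; apply: cvgM; last exact: cvg_cst.
    rewrite -[X in _ --> X]invr1; apply: cvgV; first exact: oner_neq0.
    rewrite -[X in _ --> X](expr1n R d).
    have : (fun k : nat => 1 - k.+2%:R^-1 : R) @ \oo --> (1 : R).
      rewrite -[X in _ --> X]subr0; apply: cvgB; first exact: cvg_cst.
      have := @cvg_harmonic R; rewrite -cvg_shiftS; exact.
    by move=> h; exact: (cvg_comp _ _ h (@exprn_continuous R d 1)).
  apply: cvge_to_ge cv _; apply: nearW => k.
  have := scaled (1 - k.+2%:R^-1); rewrite EFinM fineK ?ge0_fin_numE ?measure_ge0 //; apply.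
  rewrite subr_gt0 invf_lt1 ?ltr0n // ltr1n /= gtrBl invr_gt0 //.
rewrite measureD //; last exact: le_lt_trans Tfin.
rewrite setIidr; last exact: subset_closure.
apply/eqP; rewrite eq_le; apply/andP; split.
  by rewrite leeBlDr ?add0e ?ge0_fin_numE ?measure_ge0.
rewrite sube_ge0; last by rewrite ge0_fin_numE ?measure_ge0 // Tfin.
by apply: le_measure; rewrite ?inE //; exact: subset_closure.
Qed.

End convex_sets.

Section mesh.
Context {R : realType} {d : nat}.
Local Notation E := 'rV[R]_d.
Local Notation leb := (@lebesgue_rV R d).
Variables (D : set E) (N : nat) (T : 'I_N -> set E).
Hypothesis pD : polygonal_domain D.
Hypothesis hT : is_mesh D T.

Lemma polygonal_open : open D.
Proof. by case: pD. Qed.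

Lemma polygonal_bounded : bounded_set D.
Proof. by case: pD. Qed.

Lemma polygonal_bound : exists L, forall x, D x -> forall j, `|x ord0 j| <= L.
Proof.
have [r r0 Dr] := bounded_rV_ball polygonal_bounded.
exists r => x /Dr; rewrite rV_ballE // => h j.
by have := h j; rewrite mxE subr0 => /ltW.
Qed.

Lemma element_open_convex k : open (T k) /\ is_convex (T k).
Proof.
have [[sT|qT] _ _] := hT.
  have [p [_ ->]] := sT k; split; first exact: open_interior.
  by apply: interior_convex; exact: hull_convex.
have [p [_ ->]] := qT k; split; first exact: open_interior.
by apply: interior_convex; exact: hull_convex.
Qed.

Lemma element_open k : open (T k). Proof. by case: (element_open_convex k). Qed.
Lemma element_measurable k : measurable (T k).
Proof. by apply: open_rV_measurable; exact: element_open. Qed.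

Lemma element_sub k : T k `<=` D.
Proof.
have [_ _ cD] := hT; have [_ _ _ _ [iD _]] := pD.
rewrite -iD => x Tx; have : nbhs x (T k) by apply: open_nbhs_nbhs; split=> //; exact: element_open.
apply: filterS => y Ty; rewrite cD; exists k => //; exact: subset_closure.
Qed.

Lemma element_bounded k : bounded_set (T k).
Proof.
have [M [rM hM]] := polygonal_bounded.
by exists M; split=> // x Mx y Ty; apply: (hM x Mx); exact: element_sub Ty.
Qed.

Definition mesh_union : set E := \big[setU/set0]_(k <- enum 'I_N) T k.

Lemma mesh_unionP x : mesh_union x <-> exists k, T k x.
Proof.
rewrite /mesh_union -bigcup_seq; split=> [[k _ Tx]|[k Tx]]; first by exists k.
by exists k => //=; rewrite mem_enum.
Qed.

Lemma null_bigsetU (s : seq 'I_N) (F : 'I_N -> set E) : (forall k, measurable (F k)) ->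
  (forall k, leb (F k) = 0%E) -> measurable (\big[setU/set0]_(k <- s) F k) /\
  leb (\big[setU/set0]_(k <- s) F k) = 0%E.
Proof.
move=> mF F0; elim: s => [|k s [IH1 IH2]]; first by rewrite big_nil measure0.
rewrite big_cons; split; first exact: measurableU.
apply/eqP; rewrite eq_le measure_ge0 andbT.
apply: le_trans (measureU2 _ (mF k) IH1) _.
by rewrite [X in (_ + X)%E]IH2 adde0 [leLHS](F0 k).
Qed.

Lemma mesh_covers : leb (D `\` mesh_union) = 0%E.
Proof.
have mU : measurable mesh_union by apply: bigsetU_measurable => k _; exact: element_measurable.
have mB k : measurable (closure (T k) `\` T k).
  apply: measurableD; last exact: element_measurable.
  by apply: closed_rV_measurable; exact: closed_closure.
have B0 k : leb (closure (T k) `\` T k) = 0%E.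
  have [oT cT] := element_open_convex k.
  exact: (lebesgue_convex_boundary oT cT (element_bounded k)).
have [mV V0] := null_bigsetU (enum 'I_N) mB B0.
apply: (@subset_measure0 _ _ _ leb _ _ _ mV _ V0).
  by apply: measurableD => //; apply: open_rV_measurable; exact: polygonal_open.
have [_ _ cD] := hT; move=> x [Dx nT].
have : closure D x by exact: subset_closure.
rewrite cD -bigcup_seq => -[k _ ck]; exists k; first by rewrite /= mem_enum.
by split=> // Tx; apply: nT; apply/mesh_unionP; exists k.
Qed.

(** The elements are disjoint and leave out at most their boundaries, which are
null sets. *)
Lemma ge0_integral_mesh (g : E -> \bar R) : measurable_fun D g ->
  (forall x, D x -> (0 <= g x)%E) ->
  (\int[leb]_(x in D) g x = \sum_k \int[leb]_(x in T k) g x)%E.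
Proof.
move=> mg g0.
have mD : measurable D by apply: open_rV_measurable; exact: polygonal_open.
have mU : measurable mesh_union by apply: bigsetU_measurable => k _; exact: element_measurable.
have UD : mesh_union `<=` D by move=> x /mesh_unionP[k]; exact: element_sub.
rewrite (ge0_negligible_integral _ mD mg g0 mesh_covers); last exact: measurableD.
have -> : D `\` (D `\` mesh_union) = mesh_union.
  apply/seteqP; split=> x.
    by move=> [Dx nn]; apply: contrapT => nU; apply: nn.
  by move=> Ux; split; [exact: UD | case].
rewrite /mesh_union ge0_integral_bigsetU //=.
- by rewrite big_enum.
- exact: element_measurable.
- exact: enum_uniq.
- by have [_ tT _] := hT; apply: sub_trivIset tT.
- exact: (measurable_funS mD UD mg).
- by move=> x Ux; apply: g0; exact: UD.
Qed.

End mesh.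

(** * Approximation by piecewise constants *)

Section mean_value.
Context dd (T : measurableType dd) (R : realType).
Variables (mu : {measure set T -> \bar R}) (A : set T).
Hypothesis mA : measurable A.
Hypothesis A_lty : (mu A < +oo)%E.
Let m : R := fine (mu A).
Hypothesis m_gt0 : 0 < m.
Local Notation ip := (l2ip mu A).

Definition average (f : T -> R) : R := m^-1 * \int[mu]_(x in A) f x.

Let ip11 : ip (fun=> 1) (fun=> 1) = m.
Proof. by rewrite /l2ip mulr1 Rintegral_cst // mul1r. Qed.

Let s1 : sqint mu A (fun=> 1). Proof. exact: sqint_cst. Qed.

Let ip1 f : ip (fun=> 1) f = m * average f.
Proof.
rewrite /average mulrA divff ?gt_eqF // mul1r.
by apply: eq_Rintegral => x _; rewrite mul1r.
Qed.

(** The mean value is the orthogonal projection onto the constants. *)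
Lemma average_contraction f : sqint mu A f ->
  ip (fun x => f x - average f) (fun x => f x - average f) <= ip f f.
Proof.
move=> sf; set c := average f.
have cE : (fun x => f x - c) = fun x => (- c) * 1 + f x.
  by apply/funext => x; rewrite mulr1 addrC.
have sc := sqint_lin mA (- c) s1 sf.
rewrite cE l2ip_lin // ![ip _ (fun x => - c * 1 + f x)]l2ipC !l2ip_lin //.
rewrite ip11 (l2ipC _ _ f) ip1 -/c.
have := mulr_ge0 (ltW m_gt0) (sqr_ge0 c); lra.
Qed.

(** Jensen's inequality for the square, that is, Cauchy-Schwarz against the
constant 1. *)
Lemma average_pointwise f (t : R) : sqint mu A f ->
  (((t - average f) ^+ 2)%:E <= (m^-1)%:E * \int[mu]_(y in A) ((t - f y) ^+ 2)%:E)%E.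
Proof.
move=> sf; set c := average f.
have sh : sqint mu A (fun y => t - f y).
  by apply: sqintB => //; exact: sqint_cst.
rewrite -l2ip_EFin // -EFinM lee_fin.
have := l2_CS mA s1 sh; rewrite ip11.
have -> : ip (fun=> 1) (fun y => t - f y) = m * (t - c).
  rewrite (_ : (fun y => t - f y) = fun y => (-1) * f y + t * 1); last first.
    by apply/funext => y; rewrite mulN1r mulr1 addrC.
  rewrite l2ipC l2ip_lin //; last by apply: sqintZ.
  rewrite (l2ipC _ _ f) ip1 -/c.
  have -> : ip (fun=> t * 1) (fun=> 1) = t * m.
    by rewrite -ip11 /l2ip !mulr1 !Rintegral_cst // mul1r.
  ring.
set w := ip _ _ => h.
have : m * (m * (t - c) ^+ 2) <= m * w by rewrite (le_trans _ h) // expr2; lra.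
by rewrite ler_pM2l // => h2; rewrite -(ler_pM2l m_gt0) mulrA divff ?gt_eqF // mul1r.
Qed.

End mean_value.

Section inner_integral.
Context dd (T : measurableType dd) (R : realType).
Variable mu : {sigma_finite_measure set T -> \bar R}.

Lemma measurable_inner_integral (B : set T) (k : T * T -> \bar R) : measurable B ->
  measurable_fun setT k -> (forall z, (0 <= k z)%E) ->
  measurable_fun setT (fun x => \int[mu]_(y in B) k (x, y))%E.
Proof.
move=> mB mk k0.
pose k' z := (k z * (\1_B z.2)%:E)%E.
have mk' : measurable_fun setT k'.
  apply: emeasurable_funM => //; apply/measurable_EFinP.
  by apply: (measurableT_comp (measurable_indic mB)); exact: measurable_snd.
have k0' z : (0 <= k' z)%E by rewrite /k' mule_ge0 // lee_fin.
have := @measurable_fun_fubini_tonelli_F _ _ _ _ R mu _ mk' k0'.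
rewrite (_ : fubini_F mu k' = fun x => \int[mu]_(y in B) k (x, y))%E //.
apply/funext => x; rewrite [RHS]integral_mkcond; apply: eq_integral => y _.
rewrite patchE /k' /= indicE; case: ifPn => _; by rewrite ?mule1 ?mule0.
Qed.

End inner_integral.

Section euclidean_norm.
Context {R : realType} {d : nat}.
Local Notation E := 'rV[R]_d.
Implicit Types x y : E.

Lemma dotxx_ge0 x : 0 <= dot x x.
Proof. by apply: sumr_ge0 => i _; rewrite -expr2 sqr_ge0. Qed.

Lemma enorm_ge0 x : 0 <= enorm x. Proof. exact: sqrtr_ge0. Qed.

Lemma enorm_sqr x : enorm x ^+ 2 = dot x x.
Proof. by rewrite sqr_sqrtr // dotxx_ge0. Qed.

Lemma coord_le_enorm x i : `|x ord0 i| <= enorm x.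
Proof.
rewrite -(@ler_pXn2r _ 2) // ?nnegrE ?enorm_ge0 // enorm_sqr real_normK ?num_real //.
rewrite /dot (bigD1 i) //= expr2 lerDl.
by apply: sumr_ge0 => j _; rewrite -expr2 sqr_ge0.
Qed.

Lemma enorm_le_coord x r : 0 <= r -> (forall i, `|x ord0 i| <= r) -> enorm x <= d%:R * r.
Proof.
move=> r0 xr; rewrite -(@ler_pXn2r _ 2) // ?nnegrE ?enorm_ge0 ?mulr_ge0 //.
rewrite enorm_sqr; apply: (@le_trans _ _ (\sum_(i < d) r ^+ 2)).
  apply: ler_sum => i _; rewrite -expr2 -real_normK ?num_real //.
  by rewrite ler_pXn2r // nnegrE.
rewrite sumr_const card_ord -[leLHS]mulr_natl exprMn.
apply: ler_wpM2r; first exact: sqr_ge0.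
rewrite -natrX ler_nat.
by case: (d) => // n; rewrite expnS expn1 leq_pmulr.
Qed.

Lemma enorm_eq0 x : enorm x = 0 -> x = 0.
Proof.
move=> x0; apply/rowP => i; rewrite mxE; apply/eqP; rewrite -normr_eq0 eq_le normr_ge0 andbT.
by rewrite -x0 coord_le_enorm.
Qed.

Lemma enorm_le_diam (A : set E) x y : bounded_set A -> A x -> A y -> enorm (x - y) <= diam A.
Proof.
move=> /bounded_rV_ball[r r0 Ar] Ax Ay.
apply: ub_le_sup; last by exists x, y.
exists (d%:R * (2 * r)) => _ [u [v [/Ar Au /Ar Av ->]]].
apply: enorm_le_coord; first by rewrite mulr_ge0 // ltW.
move: Au Av; rewrite !rV_ballE // => Au Av i; rewrite !mxE.
have := Au i; have := Av i; rewrite !mxE !subr0 => h1 h2.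
by rewrite (le_trans (ler_normB _ _)) // ltW // mulr2n mulrDl mul1r ltrD.
Qed.

Lemma measurable_enormB : measurable_fun setT (fun z : E * E => enorm (z.1 - z.2)).
Proof.
apply: (@measurableT_comp _ _ _ _ _ _ (@Num.sqrt R)).
  by apply: continuous_measurable_fun; exact: sqrt_continuous.
rewrite (_ : (fun z => _) = fun z : E * E => \sum_(i < d) ((z.1 ord0 i - z.2 ord0 i) * (z.1 ord0 i - z.2 ord0 i))).
  apply: measurable_sum => i.
  have m1 : measurable_fun setT (fun z : E * E => z.1 ord0 i).
    by apply: (measurableT_comp (measurable_coor i)); exact: measurable_fst.
  have m2 : measurable_fun setT (fun z : E * E => z.2 ord0 i).
    by apply: (measurableT_comp (measurable_coor i)); exact: measurable_snd.
  by apply: measurable_funM; apply: measurable_funB.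
by apply/funext => z; apply: eq_bigr => i _; rewrite !mxE.
Qed.

End euclidean_norm.

Section mesh_projection.
Context {R : realType} {d : nat}.
Local Notation E := 'rV[R]_d.
Local Notation leb := (@lebesgue_rV R d).
Variables (D : set E) (N : nat) (T : 'I_N -> set E) (sigma : R).
Hypothesis d_gt0 : (0 < d)%N.
Hypothesis pD : polygonal_domain D.
Hypothesis hT : is_mesh D T.
Hypothesis srT : shape_regular sigma T.
Let mD : measurable D := open_rV_measurable (polygonal_open pD).
Let mT k : measurable (T k) := element_measurable hT k.
Let TD k : T k `<=` D := element_sub pD hT (k := k).

Lemma element_lty k : (leb (T k) < +oo)%E.
Proof. by apply: bounded_rV_lty => //; exact: element_bounded pD hT k. Qed.

(** The Euclidean ball of shape regularity contains a ball of the max-norm of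
radius r / (2 * d), whose volume is (r / d)^d. *)
Lemma element_volume k : exists r, [/\ 0 < r, (r / d%:R) ^+ d <= fine (leb (T k)),
  diam (T k) <= sigma * r & 0 < diam (T k)].
Proof.
have [x [r [r0 xr dr]]] := srT k.
have dR : 0 < d%:R :> R by rewrite ltr0n.
have d1 : 1 <= d%:R :> R by rewrite ler1n.
(* Balls refer to the max-norm, and enorm is at most d times the max-norm. *)
pose rho := r / (2 * d%:R).
have rho0 : 0 < rho by rewrite divr_gt0 // mulr_gt0.
have bT : ball x rho `<=` T k.
  move=> y; rewrite rV_ballE // => hy; apply: xr => /=.
  apply: (@le_lt_trans _ _ (d%:R * rho)).
    apply: enorm_le_coord; first exact: ltW.
    by move=> i; rewrite !mxE; exact: ltW.
  rewrite /rho (_ : d%:R * (r / (2 * d%:R)) = r / 2); last by field; lra.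
  lra.
exists r; split=> //.
  have := le_measure leb (_ : ball x rho \in measurable) (_ : T k \in measurable) bT.
  rewrite !inE => /(_ (rV_ball_measurable _ rho0) (mT k)).
  rewrite [X in (X <= _)%E](lebesgue_rV_ball x rho0).
  rewrite [X in (_ <= X)%E](_ : _ = (fine (leb (T k)))%:E); last first.
    by rewrite fineK // ge0_fin_numE ?measure_ge0 ?element_lty.
  rewrite lee_fin.
  by congr (_ ^+ _ <= _); rewrite /rho; field; lra.
have Tx : T k x by apply: bT; exact: ballxx.
pose y := x + (rho / 2) *: delta_mx ord0 (Ordinal d_gt0).
have Ty : T k y.
  apply: bT; rewrite rV_ballE // => i; rewrite !mxE [x _ _ + _]addrC addrK eqxx /=.
  case: (i == _); rewrite ?mulr0 ?normr0 // mulr1 gtr0_norm ?divr_gt0 //; lra.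
apply: lt_le_trans (enorm_le_diam (element_bounded pD hT k) Ty Tx).
apply: lt_le_trans (coord_le_enorm _ (Ordinal d_gt0)).
by rewrite !mxE [x _ _ + _]addrC addrK !eqxx mulr1 gtr0_norm divr_gt0.
Qed.

Lemma element_gt0 k : 0 < fine (leb (T k)).
Proof.
have [r [r0 h _ _]] := element_volume k; apply: lt_le_trans h.
by rewrite exprn_gt0 // divr_gt0 // ltr0n.
Qed.

Lemma diam_volume k : diam (T k) ^+ d * (fine (leb (T k)))^-1 <= (`|sigma| * d%:R) ^+ d.
Proof.
have [r [r0 h1 h2 d0]] := element_volume k.
have dR : 0 < d%:R :> R by rewrite ltr0n.
rewrite ler_pdivrMr ?element_gt0 //.
apply: (@le_trans _ _ ((`|sigma| * r) ^+ d)).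
  rewrite lerXn2r ?nnegrE ?mulr_ge0 ?(ltW r0) ?(ltW d0) // (le_trans h2) //.
  by rewrite ler_wpM2r ?(ltW r0) // ler_norm.
rewrite (_ : `|sigma| * r = `|sigma| * d%:R * (r / d%:R)); last by field; lra.
by rewrite exprMn ler_wpM2l // exprn_ge0 // mulr_ge0.
Qed.

Lemma PiHE f k x : T k x -> PiH T f x = average leb (T k) f.
Proof.
move=> Tx; rewrite /PiH (bigD1 k) //= indicE mem_set // mulr1 big1 ?addr0 // => j jk.
rewrite indicE memNset ?mulr0 // => Tjx.
have [_ /trivIsetP tT _] := hT.
have := tT j k I I jk; rewrite -subset0 => /(_ x); exact.
Qed.

Lemma measurable_PiH f : measurable_fun setT (PiH T f).
Proof.
by apply: measurable_sum => k; apply: measurable_funM.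
Qed.

Lemma sqint_element f k : sqint leb D f -> sqint leb (T k) f.
Proof.
move=> [mf If]; split; first exact: measurable_funS (TD (k:=k)) mf.
exact: (integrableS mD (mT k) (TD (k:=k)) If).
Qed.

Lemma PiH_error f : sqint leb D f -> sqint leb D (f \- PiH T f) ->
  l2ip leb D (f \- PiH T f) (f \- PiH T f) =
  \sum_k l2ip leb (T k) (fun x => f x - average leb (T k) f) (fun x => f x - average leb (T k) f).
Proof.
move=> sf sfp; have [mfp _] := sfp.
apply: EFin_inj; rewrite l2ip_EFin // (ge0_integral_mesh pD hT); first last.
- by move=> x _; rewrite lee_fin sqr_ge0.
- by apply/measurable_EFinP; exact: measurable_funX.
rewrite -sumEFin; apply: eq_bigr => k _; rewrite l2ip_EFin.
  by apply: eq_integral => x /set_mem Tx; rewrite /= (PiHE _ Tx).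
  exact: mT.
exact: (sqintB (mT k) (sqint_element k sf) (sqint_cst (mT k) _ (element_lty k))).
Qed.

Lemma PiH_error_le f : sqint leb D f -> sqint leb D (f \- PiH T f) ->
  l2ip leb D (f \- PiH T f) (f \- PiH T f) <= l2ip leb D f f.
Proof.
move=> sf sfp; rewrite PiH_error //.
rewrite -lee_fin l2ip_EFin // (ge0_integral_mesh pD hT); first last.
- by move=> x _; rewrite lee_fin sqr_ge0.
- by case: sf => mf _; apply/measurable_EFinP; exact: measurable_funX.
rewrite -sumEFin; apply: lee_sum => k _.
have sk := sqint_element k sf.
rewrite -l2ip_EFin // lee_fin.
exact: (average_contraction (mT k) (element_lty k) (element_gt0 k) sk).
Qed.

End mesh_projection.

(** * Fractional smoothness *)

Lemma powR_volume_bound (R : realType) (n : nat) (s h H v c : R) : 0 < s -> 0 < h ->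
  h <= H -> 0 <= v -> h ^+ n * v <= c -> v * h `^ (n%:R + 2 * s) <= c * (H `^ s) ^+ 2.
Proof.
move=> s0 h0 hH v0 hc.
rewrite powRD; last by apply/implyP => _; rewrite gt_eqF.
rewrite powR_mulrn ?(ltW h0) // mulrA [v * _]mulrC [2 * s]mulrC powRrM powR_mulrn ?powR_ge0 //.
apply: ler_pM => //; rewrite ?sqr_ge0 //; first by rewrite mulr_ge0 // exprn_ge0 // ltW.
rewrite lerXn2r ?nnegrE ?powR_ge0 //.
by apply: ge0_ler_powR; rewrite ?nnegrE ?(ltW s0) ?(ltW h0) // (le_trans (ltW h0)).
Qed.

Section fractional.
Context {R : realType} {d : nat}.
Local Notation E := 'rV[R]_d.
Local Notation leb := (@lebesgue_rV R d).
Variables (D : set E) (N : nat) (T : 'I_N -> set E) (sigma : R).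
Hypothesis d_gt0 : (0 < d)%N.
Hypothesis pD : polygonal_domain D.
Hypothesis hT : is_mesh D T.
Hypothesis srT : shape_regular sigma T.
Let mD : measurable D := open_rV_measurable (polygonal_open pD).
Let mT k : measurable (T k) := element_measurable hT k.
Let TD k : T k `<=` D := element_sub pD hT (k := k).

Lemma measurable_pair_diff (f : E -> R) : measurable_fun setT f ->
  measurable_fun setT (fun z : E * E => f z.1 - f z.2).
Proof.
move=> mf; apply: measurable_funB.
  by apply: (measurableT_comp mf); exact: measurable_fst.
by apply: (measurableT_comp mf); exact: measurable_snd.
Qed.

(** On each element f x - Pi_H f x is the mean of f x - f y over y. *)
Lemma PiH_error_double f : sqint leb D f -> sqint leb D (f \- PiH T f) ->
  ((l2ip leb D (f \- PiH T f) (f \- PiH T f))%:E <=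
  \sum_k ((fine (leb (T k)))^-1)%:E *
     \int[leb]_(x in T k) \int[leb]_(y in T k) ((f x - f y) ^+ 2)%:E)%E.
Proof.
move=> sf sfp; rewrite (PiH_error pD hT) // -sumEFin; apply: lee_sum => k _.
have sk := sqint_element pD hT k sf.
have sd : sqint leb (T k) (fun x => f x - average leb (T k) f).
  exact: (sqintB (mT k) sk (sqint_cst (mT k) _ (element_lty pD hT k))).
rewrite (l2ip_EFin (mT k) sd).
have vol0 := element_gt0 d_gt0 pD hT srT k.
pose f' := f \_ D.
have mf' : measurable_fun setT f' by case: sf => mf _; apply/(measurable_restrictT _ mD).
have ff' x : T k x -> f' x = f x by move=> Tx; rewrite /f' patchE mem_set //; exact: TD Tx.
pose ker (z : E * E) : \bar R := ((f' z.1 - f' z.2) ^+ 2)%:E.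
have mker : measurable_fun setT ker.
  by apply/measurable_EFinP; apply: measurable_funX; exact: measurable_pair_diff.
have ker0 z : (0 <= ker z)%E by rewrite lee_fin sqr_ge0.
have minn := measurable_inner_integral leb (mT k) mker ker0.
have innE x : T k x -> (\int[leb]_(y in T k) ((f x - f y) ^+ 2)%:E = \int[leb]_(y in T k) ker (x, y))%E.
  by move=> Tx; apply: eq_integral => y /set_mem Ty; rewrite /ker /= !ff'.
have -> : (\int[leb]_(x in T k) \int[leb]_(y in T k) ((f x - f y) ^+ 2)%:E =
   \int[leb]_(x in T k) \int[leb]_(y in T k) ker (x, y))%E.
  by apply: eq_integral => x /set_mem Tx; exact: innE.
have mi := measurable_funTS minn : measurable_fun (T k) _.
rewrite -(ge0_integralZl leb (mT k) mi); last 2 first.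
- by move=> x _; apply: integral_ge0.
- by rewrite lee_fin invr_ge0 ltW.
apply: ge0_le_integral => //.
- by move=> x _; rewrite lee_fin sqr_ge0.
- by case: sd => md _; apply/measurable_EFinP; exact: measurable_funX.
- exact: measurable_funeM.
- move=> x Tx; rewrite -innE //.
  exact: (average_pointwise (mT k) (element_lty pD hT k) vol0 _ sk).
Qed.

Definition slob_kernel (p : R) (f : E -> R) (z : E * E) : \bar R :=
  ((f z.1 - f z.2) ^+ 2 / enorm (z.1 - z.2) `^ p)%:E.

Lemma slob_kernel_measurable p f : measurable_fun setT f ->
  measurable_fun setT (slob_kernel p f).
Proof.
move=> mf; apply/measurable_EFinP; apply: measurable_funM.
  by apply: measurable_funX; exact: measurable_pair_diff.
rewrite (_ : (fun z : E * E => _) = fun z : E * E => enorm (z.1 - z.2) `^ (- p)).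
  apply: (@measurableT_comp _ _ _ _ _ _ (fun t : R => t `^ (- p))).
    exact: measurable_powR.
  exact: measurable_enormB.
by apply/funext => z; rewrite powRN.
Qed.

Lemma slob_kernel_ge0 p f z : (0 <= slob_kernel p f z)%E.
Proof. by rewrite lee_fin mulr_ge0 ?sqr_ge0 // invr_ge0 powR_ge0. Qed.

Lemma slob_kernel_bound p f k x y : 0 <= p -> T k x -> T k y ->
  (((f x - f y) ^+ 2)%:E <= (diam (T k) `^ p)%:E * slob_kernel p f (x, y))%E.
Proof.
move=> p0 Tx Ty; rewrite -EFinM lee_fin /=.
have [->|xy] := eqVneq x y.
  by rewrite subrr expr0n /= mul0r mulr0.
have e0 : 0 < enorm (x - y).
  rewrite lt_neqAle enorm_ge0 andbT eq_sym.
  by apply: contraNneq xy => /enorm_eq0 /eqP; rewrite subr_eq0.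
have ep0 : 0 < enorm (x - y) `^ p by rewrite powR_gt0.
rewrite mulrA ler_pdivlMr // mulrC ler_wpM2r ?sqr_ge0 //.
have dxy := enorm_le_diam (element_bounded pD hT k) Tx Ty.
apply: ge0_ler_powR => //; rewrite nnegrE; first exact: ltW.
by rewrite (le_trans _ dxy) // ltW.
Qed.

(** On an element |x - y| <= diam T, so (f x - f y)^2 is at most
diam T ^ (d + 2 s) times the kernel; the factor diam T ^ d is absorbed by
|T|^-1. *)
Lemma PiH_error_slobodeckij (s : R) f : 0 < s -> sqint leb D f ->
  sqint leb D (f \- PiH T f) -> (slobodeckij D s f < +oo)%E ->
  l2ip leb D (f \- PiH T f) (f \- PiH T f) <=
  (`|sigma| * d%:R) ^+ d * (mesh_size T `^ s) ^+ 2 * fine (slobodeckij D s f).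
Proof.
move=> s0 sf sfp slob.
pose p := d%:R + 2 * s : R.
have p0 : 0 <= p by rewrite addr_ge0 // mulr_ge0 // ltW.
(* Outside the domain f need not be measurable. *)
pose f' := f \_ D.
have mf' : measurable_fun setT f' by case: sf => mf _; apply/(measurable_restrictT _ mD).
have ff' x : D x -> f' x = f x by move=> Dx; rewrite /f' patchE mem_set.
have mq := slob_kernel_measurable p mf'.
have q0 := slob_kernel_ge0 p f'.
have slobE : slobodeckij D s f = (\int[leb]_(x in D) \int[leb]_(y in D) slob_kernel p f' (x, y))%E.
  apply: eq_integral => x /set_mem Dx; apply: eq_integral => y /set_mem Dy.
  by rewrite /slob_kernel /= !ff'.
have minn B (mB : measurable B) := measurable_inner_integral leb mB mq q0.
have inn0 B x : (0 <= \int[leb]_(y in B) slob_kernel p f' (x, y))%E.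
  by apply: integral_ge0 => y _; exact: q0.
have slob0 : (0 <= slobodeckij D s f)%E by rewrite slobE; apply: integral_ge0.
have Hd k : diam (T k) <= mesh_size T by rewrite /mesh_size le_bigmax.
pose K := (`|sigma| * d%:R) ^+ d * (mesh_size T `^ s) ^+ 2.
have K0 : 0 <= K by rewrite mulr_ge0 ?sqr_ge0 // exprn_ge0 // mulr_ge0.
have slobK : (fine (slobodeckij D s f))%:E = slobodeckij D s f.
  by apply: fineK; rewrite (ge0_fin_numE slob0).
rewrite -lee_fin EFinM slobK.
apply: le_trans (PiH_error_double sf sfp) _.
apply: (@le_trans _ _ (\sum_k K%:E * \int[leb]_(x in T k) \int[leb]_(y in D) slob_kernel p f' (x, y))%E); last first.
  rewrite -ge0_sume_distrr; last by move=> k _; apply: integral_ge0.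
  rewrite slobE (ge0_integral_mesh pD hT) //.
  exact: (measurable_funTS (minn D mD)).
apply: lee_sum => k _.
have [r [r0 _ _ dm0]] := element_volume d_gt0 pD hT srT k.
have vol0 := element_gt0 d_gt0 pD hT srT k.
have mi B (mB : measurable B) := measurable_funTS (minn B mB) : measurable_fun (T k) _.
have cK : (fine (leb (T k)))^-1 * diam (T k) `^ p <= K.
  apply: powR_volume_bound => //; first by rewrite invr_ge0 ltW.
  exact: (diam_volume d_gt0 pD hT srT k).
have cv0 : 0 <= (fine (leb (T k)))^-1 by rewrite invr_ge0 ltW.
have cd0 : 0 <= diam (T k) `^ p by rewrite powR_ge0.
have mik := mi _ (mT k).
have mker : measurable_fun setT (fun z : E * E => ((f' z.1 - f' z.2) ^+ 2)%:E).
  by apply/measurable_EFinP; apply: measurable_funX; exact: measurable_pair_diff.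
have ker0 z : (0 <= ((f' z.1 - f' z.2) ^+ 2)%:E :> \bar R)%E by rewrite lee_fin sqr_ge0.
have mkk := measurable_inner_integral leb (mT k) mker ker0.
have step : (\int[leb]_(x in T k) \int[leb]_(y in T k) ((f x - f y) ^+ 2)%:E <=
    (diam (T k) `^ p)%:E * \int[leb]_(x in T k) \int[leb]_(y in D) slob_kernel p f' (x, y))%E.
  rewrite -(ge0_integralZl leb (mT k) (mi D mD)); last 2 first.
  - by move=> x _; exact: inn0.
  - by rewrite lee_fin.
  apply: (@le_trans _ _ (\int[leb]_(x in T k) \int[leb]_(y in T k) ((f' (x, y).1 - f' (x, y).2) ^+ 2)%:E)%E).
    rewrite le_eqVlt; apply/orP; left; apply/eqP.
    by apply: eq_integral => x /set_mem Tx; apply: eq_integral => y /set_mem Ty; rewrite /= (ff' _ (TD Tx)) (ff' _ (TD Ty)).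
  apply: ge0_le_integral; [exact: mT| | | |].
  - by move=> x _; apply: integral_ge0 => y _; exact: (ker0 (x, y)).
  - exact: measurable_funTS mkk.
  - exact: measurable_funeM (mi D mD).
  - move=> x Tx.
    have mqx B : measurable_fun B (fun y => slob_kernel p f' (x, y)).
      by apply: measurable_funTS; exact: (measurableT_comp mq (measurable_pair1 x)).
    have q0x y : (0 <= slob_kernel p f' (x, y))%E := q0 (x, y).
    apply: (@le_trans _ _ ((diam (T k) `^ p)%:E * \int[leb]_(y in T k) slob_kernel p f' (x, y))%E).
      rewrite -(ge0_integralZl leb (mT k) (mqx (T k))); last 2 first.
      - by move=> y _; exact: q0x.
      - by rewrite lee_fin.
      apply: ge0_le_integral; [exact: mT| | | |].
      - by move=> y _; exact: (ker0 (x, y)).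
      - by apply: measurable_funTS; exact: (measurableT_comp mker (measurable_pair1 x)).
      - exact: measurable_funeM (mqx (T k)).
      - by move=> y Ty; exact: slob_kernel_bound.
    apply: lee_wpmul2l; first by rewrite lee_fin.
    apply: ge0_subset_integral; [exact: mT|exact: mD|exact: mqx| |exact: TD].
    by move=> y _; exact: q0x.
apply: (@le_trans _ _ (((fine (leb (T k)))^-1)%:E * ((diam (T k) `^ p)%:E * \int[leb]_(x in T k) \int[leb]_(y in D) slob_kernel p f' (x, y)))%E).
  by apply: lee_wpmul2l; rewrite ?lee_fin.
rewrite muleA -EFinM; apply: lee_wpmul2r; last by rewrite lee_fin.
by apply: integral_ge0 => x _; exact: inn0.
Qed.

End fractional.

(** * Translations *)

Section dense_dual.
Context {R : realType} {X : lmodType R} (H : hilbert X) (S : set X).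
Local Notation dom := (hdom H).
Local Notation ip := (hip H).
Hypothesis S0 : S 0.
Hypothesis S_lin : forall a x y, S x -> S y -> S (a *: x + y).
Hypothesis S_dom : S `<=` dom.
Hypothesis S_dense : forall n, dom n -> (forall y, S y -> ip n y = 0) -> ip n n = 0.

(** Let w in the closure of S have the same products with S as x.  Then x - w is
orthogonal to S, hence null, and the bound extends to w by continuity. *)
Lemma dense_dual_bound x (K : R) : dom x -> 0 <= K ->
  (forall y, S y -> ip x y ^+ 2 <= K * ip y y) -> ip x x <= K.
Proof.
move=> dx K0 hS.
have [w Ww wE] := @riesz _ _ (hilbert_closure S0 S_lin S_dom) (ip x) (hnorm H x)
  (fun a y z (dy : hclosure H S y) (dz : hclosure H S z) =>
     etrans (hipDr (hdomZ a dy.1) dz.1 dx) (congr1 (+%R^~ _) (hipZr a dy.1 dx)))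
  (fun y (dy : hclosure H S y) => hip_CS dx dy.1).
have dw : dom w := Ww.1.
have wE' y : hclosure H S y -> ip w y = ip x y := wE y.
have nS : ip (x - w) (x - w) = 0.
  apply: S_dense; first exact: hdomB.
  move=> y Sy; rewrite (hipBl dx dw (S_dom Sy)) wE' ?subrr //.
  exact: (sub_hclosure S_dom Sy).
have xw : ip x w = ip w w by rewrite (wE' w Ww).
have xx : ip x x = ip w w.
  move: nS; rewrite (hipBl dx dw (hdomB dx dw)) (hipBr dx dw dx) (hipBr dx dw dw).
  rewrite xw (hipC H w x) xw; lra.
(* Its diagonal is nonnegative on S, hence at w, where ip x w = ip w w. *)
have cB : bform H (fun y z => K * ip y z - ip x y * ip x z).
  split.
  - move=> a y z t dy dz dt.
    rewrite (hip_lin a dy dz dt) (hipDr (hdomZ a dy) dz dx) (hipZr a dy dx); ring.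
  - move=> a y z t dy dz dt.
    rewrite (hipDr (hdomZ a dy) dz dt) (hipZr a dy dt) (hipDr (hdomZ a dy) dz dx) (hipZr a dy dx); ring.
  - exists (K + hnorm H x ^+ 2); first by rewrite addr_ge0 // sqr_ge0.
    move=> y z dy dz.
    have h1 := hip_CS dy dz; have h2 := hip_CS dx dy; have h3 := hip_CS dx dz.
    have h4 := ler_pM (normr_ge0 _) (normr_ge0 _) h2 h3.
    rewrite (le_trans (ler_normB _ _)) // !normrM (ger0_norm K0).
    rewrite -[(K + _) * _ * _]mulrA mulrDl; apply: lerD; first exact: ler_wpM2l.
    by rewrite (le_trans h4) // expr2 le_eqVlt; apply/orP; left; apply/eqP; ring.
have cS y : S y -> 0 <= K * ip y y - ip x y * ip x y.
  by move=> Sy; rewrite subr_ge0 -expr2; exact: hS.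
have := bform_closure_ge0 S_dom cB cS Ww; rewrite /= xw xx.
have [->//|w0] := eqVneq (ip w w) 0.
have wpos : 0 < ip w w by rewrite lt_neqAle eq_sym w0 hip_ge0.
by rewrite -mulrBl pmulr_lge0 // subr_ge0.
Qed.

End dense_dual.

Section translations.
Context {R : realType} {d : nat}.
Local Notation E := 'rV[R]_d.
Local Notation leb := (@lebesgue_rV R d).

Lemma partial_translate i (phi : E -> R) (c : E) :
  partial i (fun x => phi (x + c)) = fun x => partial i phi (x + c).
Proof.
apply/funext => x; pose v : E := delta_mx ord0 i.
have e : (fun t : R => t^-1 *: (((fun x => phi (x + c)) \o shift x) (t *: v) - phi (x + c))) =
    (fun t : R => t^-1 *: ((phi \o shift (x + c)) (t *: v) - phi (x + c))).
  by apply/funext => t /=; rewrite addrA.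
by rewrite /partial /derive e.
Qed.

Lemma smooth_translate (phi : E -> R) (c : E) : smooth phi -> smooth (fun x => phi (x + c)).
Proof.
move=> sp s x.
have -> : foldr partial (fun x => phi (x + c)) s = fun x => foldr partial phi s (x + c).
  by elim: s => //= i s ->; rewrite partial_translate.
apply: (@differentiable_comp _ _ _ _ (fun x => x + c) (foldr partial phi s)).
  by apply: differentiableD.
exact: sp.
Qed.

Lemma line_derive (phi : E -> R) (x h : E) (t : R) : smooth phi ->
  is_derive t (1 : R) (fun t : R => phi (x - t *: h))
    (- \sum_i h ord0 i * partial i phi (x - t *: h)).
Proof.
move=> sp; have dp : differentiable phi (x - t *: h) := sp [::] _.
have shiftE : (fun s : R => s^-1 *: (((fun t : R => phi (x - t *: h)) \o shift t) (s *: (1 : R)) - phi (x - t *: h)))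
   = (fun s : R => s^-1 *: ((phi \o shift (x - t *: h)) (s *: (- h)) - phi (x - t *: h))).
  apply/funext => s /=; congr (_ *: (phi _ - _)).
  by rewrite scalerDl /= [s *: 1]mulr1 scalerN opprD addrCA.
have dv : derivable phi (x - t *: h) (- h) by exact: diff_derivable.
apply: DeriveDef.
  by move: dv; rewrite /derivable -shiftE.
have -> : 'D_1 (fun t : R => phi (x - t *: h)) t = 'D_(- h) phi (x - t *: h).
  by rewrite /derive -shiftE.
rewrite deriveE // linearN /=; congr (- _).
set l := 'd phi _; rewrite {1}[h]row_sum_delta linear_sum /=; apply: eq_bigr => i _.
by rewrite linearZ /partial deriveE.
Qed.

Lemma test_translate (U V : set E) (phi : E -> R) (c : E) : test_function U phi ->
  (forall x, U x -> V (x + c)) -> test_function V (fun x => phi (x - c)).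
Proof.
move=> [sp cp pU] UV.
pose K := closure [set x | phi x != 0].
apply: (@test_functionI _ _ _ ((fun x => x + c) @` K)).
- exact: smooth_translate.
- apply: continuous_compact; last exact: cp.
  apply: continuous_subspaceT => x.
  by apply: differentiable_continuous; apply: differentiableD.
- by move=> _ [x Kx <-]; exact/UV/pU.
- move=> x nx; apply/eqP; apply: contra_notT nx => px; exists (x - c); last by rewrite subrK.
  exact: subset_closure.
Qed.

Lemma test_bounded (U : set E) (phi : E -> R) : test_function U phi ->
  exists2 B, 0 <= B & forall x, `|phi x| <= B.
Proof.
move=> tp; have [sp cp pU] := tp.
have /compact_bounded [B [_ hB]] : compact (phi @` closure [set x | phi x != 0]).
  apply: continuous_compact; last exact: cp.
  by apply: continuous_subspaceT => x; exact: smooth_continuous.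
exists (`|B| + 1) => [|x]; first by rewrite addr_ge0.
have [->|px] := eqVneq (phi x) 0; first by rewrite normr0 addr_ge0.
apply: hB; first by rewrite (le_lt_trans (ler_norm _)) // ltrDl.
by exists x => //; exact: subset_closure.
Qed.

Lemma measurable_translate (c : E) : measurable_fun setT (fun x : E => x + c).
Proof.
have := measurable_affine_rV 1 c; congr measurable_fun.
by apply/funext => x; rewrite scale1r.
Qed.

Lemma ge0_integral_translate (c : E) (g : E -> \bar R) : measurable_fun setT g ->
  (forall x, 0 <= g x)%E -> (\int[leb]_x g (x + c)%R = \int[leb]_x g x)%E.
Proof.
move=> mg g0; have := ge0_integral_affine c ltr01 mg g0.
rewrite expr1n invr1 mul1e => <-.
by apply: eq_integral => x _; rewrite scale1r.
Qed.

Lemma integral_translate (c : E) (g : E -> R) : measurable_fun setT g ->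
  \int[leb]_x g (x + c) = \int[leb]_x g x.
Proof.
move=> mg; have mG : measurable_fun setT (EFin \o g) by exact/measurable_EFinP.
rewrite /Rintegral; congr fine.
have pos := ge0_integral_translate c (measurable_funepos mG) (fun x => funepos_ge0 _ x).
have neg := ge0_integral_translate c (measurable_funeneg mG) (fun x => funeneg_ge0 _ x).
rewrite [LHS]integralE [RHS]integralE; congr (_ - _)%E.
  by rewrite -[RHS]pos; apply: eq_integral => x _; rewrite !funeposE.
by rewrite -[RHS]neg; apply: eq_integral => x _; rewrite !funenegE.
Qed.

Lemma sum_CS (I : finType) (a b : I -> R) :
  (\sum_i a i * b i) ^+ 2 <= (\sum_i a i ^+ 2) * (\sum_i b i ^+ 2).
Proof.
apply: quad_disc => t.
rewrite (_ : _ + _ = \sum_i (a i + t * b i) ^+ 2); last first.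
  rewrite !mulr_sumr -!big_split /=; apply: eq_bigr => i _; ring.
by apply: sumr_ge0 => i _; rewrite sqr_ge0.
Qed.

End translations.

Section translation_estimate.
Context {R : realType} {d : nat}.
Local Notation E := 'rV[R]_d.
Local Notation leb := (@lebesgue_rV R d).
Variables (T : set E) (L : R).
Hypothesis oT : open T.
Hypothesis TL : forall x, T x -> forall j, `|x ord0 j| <= L.
Hypothesis cT : is_convex T.
Let mT : measurable T := open_rV_measurable oT.
Variables (f : E -> R) (G : E -> E).
Hypothesis sf : sqint leb T f.
Hypothesis sG : forall i, sqint leb T (fun x => G x ord0 i).
Hypothesis fG : forall phi, test_function T phi -> forall i,
  \int[leb]_(x in T) (f x * partial i phi x) = - \int[leb]_(x in T) (G x ord0 i * phi x).
Variable h : E.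

Definition overlap : set E := T `&` [set x | T (x + h)].
Local Notation U := overlap.

Lemma overlap_open : open U.
Proof.
apply: openI => //; apply: open_comp => // x _.
by apply: differentiable_continuous; apply: differentiableD.
Qed.
Let oU := overlap_open.
Let mU : measurable U := open_rV_measurable oU.
Let UL x : U x -> forall j, `|x ord0 j| <= L. Proof. by move=> [Tx _]; exact: TL. Qed.

Let gradT := \sum_i l2ip leb T (fun x => G x ord0 i) (fun x => G x ord0 i).

Lemma overlap_segment (x : E) (t : R) : 0 <= t <= 1 -> U x -> T (x + t *: h).
Proof.
move=> t01 [Tx Txh]; rewrite (_ : x + t *: h = t *: (x + h) + (1 - t) *: x); first exact: cT.
by apply/rowP => j; rewrite !mxE; ring.
Qed.

Lemma overlap_sqint0 : sqint leb U f.
Proof.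
have [mf If] := sf; split.
  by apply: measurable_funS mf => // x [].
by apply: (integrableS mT mU _ If) => x [].
Qed.

Lemma overlap_sqint : sqint leb U (fun x : E => f (x + h)).
Proof.
pose f' := f \_ T.
have [mf If] := sf.
have mf' : measurable_fun setT f' by apply/(measurable_restrictT _ mT).
have ff' x : T x -> f' x = f x by move=> Tx; rewrite /f' patchE mem_set.
have mfh : measurable_fun setT (fun x : E => f' (x + h)).
  exact: (measurableT_comp mf' (measurable_translate h)).
have mfU : measurable_fun U (fun x : E => f (x + h)).
  apply: (eq_measurable_fun (fun x : E => f' (x + h))).
    by move=> x /set_mem [_ Txh]; rewrite ff'.
  exact: measurable_funTS.
split=> //; apply/integrableP; split.
  by apply/measurable_EFinP; exact: measurable_funX.
have m2 : measurable_fun setT (fun x => ((f' x) ^+ 2)%:E).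
  by apply/measurable_EFinP; exact: measurable_funX.
have e0 (x : E) : (0 <= ((f' x) ^+ 2)%:E :> \bar R)%E by rewrite lee_fin sqr_ge0.
have tr := ge0_integral_translate h m2 e0.
have fin : (\int[leb]_x ((f' x) ^+ 2)%:E < +oo)%E.
  have /integrableP[_] := If; rewrite [X in (X < _)%E -> _]integral_mkcond.
  apply: le_lt_trans; rewrite le_eqVlt; apply/orP; left; apply/eqP; apply: eq_integral => x _.
  rewrite patchE /f' patchE; case: ifPn => _; last by rewrite expr0n.
  by rewrite gee0_abs // lee_fin sqr_ge0.
apply: le_lt_trans fin; rewrite -tr.
rewrite (_ : (\int[leb]_(x in U) _ = \int[leb]_(x in U) ((f' (x + h)) ^+ 2)%:E)%E); last first.
  apply: eq_integral => x /set_mem [_ Txh].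
  by rewrite gee0_abs ?lee_fin ?sqr_ge0 // ff'.
apply: ge0_subset_integral => //.
by apply/measurable_EFinP; exact: measurable_funX.
Qed.

Section pairing.
Variable phi : E -> R.
Hypothesis tphi : test_function U phi.
Let sphi : smooth phi. Proof. by case: tphi. Qed.

(** This is where convexity is used: while moving by t * h with t in [0, 1], the
support stays in T. *)
Lemma test_along (t : R) : 0 <= t <= 1 -> test_function T (fun x => phi (x - t *: h)).
Proof. by move=> t01; apply: (test_translate tphi) => x; exact: overlap_segment. Qed.

Lemma l2ip_test_along (t : R) : 0 <= t <= 1 ->
  l2ip leb T (fun x => phi (x - t *: h)) (fun x => phi (x - t *: h)) = l2ip leb U phi phi.
Proof.
move=> t01; have tt := test_along t01.
have mphi : measurable_fun setT phi := continuous_rV_measurable (smooth_continuous sphi).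
apply: EFin_inj; rewrite (l2ip_EFin mT (test_sqint oT TL tt)) (l2ip_EFin mU (test_sqint oU UL tphi)).
have m2 : measurable_fun setT (fun x => ((phi x) ^+ 2)%:E).
  by apply/measurable_EFinP; exact: measurable_funX.
rewrite [LHS]integral_mkcond [RHS]integral_mkcond.
have e0 (x : E) : (0 <= ((phi x) ^+ 2)%:E :> \bar R)%E by rewrite lee_fin sqr_ge0.
have trans := ge0_integral_translate (- (t *: h)) m2 e0.
transitivity (\int[leb]_x ((phi (x - t *: h)) ^+ 2)%:E)%E.
  apply: eq_integral => x _; rewrite patchE; case: ifPn => // /negP nx.
  by rewrite (test_function_out tt) ?expr0n // => Tx; apply: nx; rewrite inE.
rewrite trans.
apply: eq_integral => x _; rewrite patchE; case: ifPn => // /negP nx.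
by rewrite (test_function_out tphi) ?expr0n // => Ux; apply: nx; rewrite inE.
Qed.

Let F (t : R) := \int[leb]_(x in T) (f x * phi (x - t *: h)).
Let F' (t : R) := \sum_i h ord0 i * l2ip leb T (fun x => G x ord0 i) (fun x => phi (x - t *: h)).

Lemma pairing_slope (t : R) : 0 <= t <= 1 ->
  F' t ^+ 2 <= enorm h ^+ 2 * gradT * l2ip leb U phi phi.
Proof.
move=> t01; rewrite -(l2ip_test_along t01) enorm_sqr.
have sp := test_sqint oT TL (test_along t01).
set psi := fun x => phi (x - t *: h) in sp *.
apply: le_trans (sum_CS _ _) _.
rewrite -mulrA /dot; apply: ler_pM.
- by apply: sumr_ge0 => i _; exact: sqr_ge0.
- by apply: sumr_ge0 => i _; exact: sqr_ge0.
- by apply: ler_sum => i _; rewrite expr2.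
rewrite /gradT mulr_suml; apply: ler_sum => i _.
exact: (l2_CS mT (sG i) sp).
Qed.

Let fint : leb.-integrable T (EFin \o f).
Proof. exact: (sqint_integrable mT (domain_lty oT TL) sf). Qed.

Let mul_int (g : E -> R) (B : R) : measurable_fun T g -> (forall x, T x -> `|g x| <= B) ->
  leb.-integrable T (EFin \o (fun x => f x * g x)).
Proof.
move=> mg gB; have sgf := sqint_bounded_mul mT mg gB sf.
have := sqint_integrable mT (domain_lty oT TL) sgf.
by apply: eq_integrable => // x _ /=; rewrite mulrC.
Qed.

(** Moving the test function instead of f makes the pairing differentiable, and
its derivative is a pairing with the weak gradient. *)
Lemma pairing_derive (t : R) : 0 <= t <= 1 -> is_derive t (1 : R) F (F' t).
Proof.
move=> t01.
have tp i : test_function U (partial i phi) := test_partial i tphi.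
have Bex i : exists B, 0 <= B /\ forall x, `|partial i phi x| <= B.
  by have [B B0 hB] := test_bounded (tp i); exists B.
have [B hB] := choice Bex.
have [B0 B00 hB0] := test_bounded tphi.
pose M := \sum_i `|h ord0 i| * B i.
have M0 : 0 <= M by apply: sumr_ge0 => i _; rewrite mulr_ge0 //; case: (hB i).
pose k (t : R) (x : E) := f x * phi (x - t *: h).
have mtr (g : E -> R) (s : R) : smooth g -> measurable_fun T (fun x => g (x - s *: h)).
  move=> sg; apply: measurable_funTS; apply: continuous_rV_measurable.
  exact: smooth_continuous (smooth_translate (- (s *: h)) sg).
have kd (x : E) (s : R) : is_derive s (1 : R) (k^~ x) (f x * - \sum_i h ord0 i * partial i phi (x - s *: h)).
  have hd := line_derive x h s sphi.
  exact: (is_deriveZ (f x) hd).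
have d1E (s : R) (x : E) : partial1of2 k s x = f x * - \sum_i h ord0 i * partial i phi (x - s *: h).
  by rewrite partial1of2E; have hh := kd x s; rewrite derive_val.
(* The derivative is dominated by a multiple of |f| for all real s; the
   interval only has to be a neighbourhood of [0, 1]. *)
have t12 : `](-1), 2[%classic t.
  by rewrite /= in_itv /=; apply/andP; split; case/andP: t01 => a b; lra.
have intk (s : R) : `](-1), 2[%classic s -> leb.-integrable T (EFin \o k s).
  move=> _; apply: (@mul_int (fun x => phi (x - s *: h)) B0); first exact: mtr.
  by move=> x _; exact: hB0.
have dk (s : R) x : `](-1), 2[%classic s -> T x -> derivable (k^~ x) s 1.
  by move=> _ _; have hh := kd x s; exact: ex_derive.
pose Gd x := M * `|f x|.
have Gd0 x : 0 <= Gd x by rewrite mulr_ge0.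
have intG : leb.-integrable T (EFin \o Gd).
  apply: (@eq_integrable _ _ _ _ _ mT (fun x => M%:E * `|(f x)%:E|)%E) => //.
  by apply: integrableZl => //; exact: integrable_abse.
have Gub (s : R) x : `](-1), 2[%classic s -> T x -> `|partial1of2 k s x| <= Gd x.
  move=> _ _; rewrite d1E normrM normrN mulrC ler_wpM2r // (le_trans (ler_norm_sum _ _ _)) //.
  by apply: ler_sum => i _; rewrite normrM ler_wpM2l //; case: (hB i).
have cvg := cvg_differentiation_under_integral mT t12 intk dk Gd0 intG Gub.
have der := derivable_under_integral mT t12 intk dk Gd0 intG Gub.
have eqd := differentiation_under_integral mT t12 intk dk Gd0 intG Gub.
apply: DeriveDef; first exact: der.
rewrite -derive1E eqd.
pose psi x := phi (x - t *: h).
have tpsi : test_function T psi := test_along t01.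
have pe i x : partial i phi (x - t *: h) = partial i psi x.
  by rewrite /psi (partial_translate i phi (- (t *: h))).
have int1 i : leb.-integrable T (EFin \o (fun x => - h ord0 i * (f x * partial i psi x))).
  have := @mul_int (fun x => - h ord0 i * partial i psi x) (`|h ord0 i| * B i) _ _.
  have m1 : measurable_fun T (fun x => - h ord0 i * partial i psi x).
    apply: measurable_funM => //.
    rewrite -(_ : (fun x => partial i phi (x - t *: h)) = partial i psi).
      by apply: mtr; exact: smooth_partial.
    by apply/funext => x; exact: pe.
  have b1 x : T x -> `|- h ord0 i * partial i psi x| <= `|h ord0 i| * B i.
    by move=> _; rewrite normrM normrN ler_wpM2l // -pe; case: (hB i).
  move=> /(_ m1 b1); apply: eq_integrable => // x _ /=; congr EFin; ring.
have [_ sumE] := integrable_Rsum mT (index_enum 'I_d) int1.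
transitivity (\int[leb]_(x in T) (\sum_i - h ord0 i * (f x * partial i psi x))).
  apply: eq_Rintegral => x _; rewrite d1E mulrN mulr_sumr -sumrN.
  by apply: eq_bigr => i _; rewrite pe; ring.
rewrite sumE; apply: eq_bigr => i _.
have -> : \int[leb]_(x in T) (- h ord0 i * (f x * partial i psi x)) =
    - h ord0 i * \int[leb]_(x in T) (f x * partial i psi x).
  apply: RintegralZl => //.
  apply: (@mul_int (partial i psi) (B i)) => [|x _].
    rewrite -(_ : (fun x => partial i phi (x - t *: h)) = partial i psi).
      by apply: mtr; exact: smooth_partial.
    by apply/funext => x; exact: pe.
  by rewrite -pe; case: (hB i).
by rewrite (fG tpsi) mulrNN.
Qed.

Lemma pairing_increment : F 1 - F 0 = l2ip leb U (fun x => f (x + h) - f x) phi.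
Proof.
pose f' := f \_ T.
have mf' : measurable_fun setT f' by case: sf => mf _; apply/(measurable_restrictT _ mT).
have ff' x : T x -> f' x = f x by move=> Tx; rewrite /f' patchE mem_set.
have f'0 x : ~ T x -> f' x = 0 by move=> Tx; rewrite /f' patchE memNset.
have mphi : measurable_fun setT phi := continuous_rV_measurable (smooth_continuous sphi).
have FE (t : R) : F t = \int[leb]_x (f' x * phi (x - t *: h)).
  rewrite /F [LHS]Rintegral_mkcond; apply: eq_Rintegral => x _; rewrite patchE.
  case: ifPn => [/set_mem Tx|/negP nT]; first by rewrite ff'.
  by rewrite f'0 ?mul0r // => Tx; apply: nT; rewrite inE.
have F1 : F 1 = \int[leb]_x (f' (x + h) * phi x).
  rewrite FE -(integral_translate h); last first.
    apply: measurable_funM => //.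
    exact: (measurableT_comp mphi (measurable_translate (- (1 *: h)))).
  by apply: eq_Rintegral => x _; rewrite scale1r addrK.
have F0 : F 0 = \int[leb]_x (f' x * phi x).
  by rewrite FE; apply: eq_Rintegral => x _; rewrite scale0r subr0.
have restr (g : E -> R) : \int[leb]_x (g x * phi x) = \int[leb]_(x in U) (g x * phi x).
  rewrite [RHS]Rintegral_mkcond; apply: eq_Rintegral => x _; rewrite patchE.
  case: ifPn => // /negP nU.
  by rewrite (test_function_out tphi) ?mulr0 // => Ux; apply: nU; rewrite inE.
rewrite F1 F0 !restr.
have su := sqint_mul mU overlap_sqint (test_sqint oU UL tphi).
have sv := sqint_mul mU overlap_sqint0 (test_sqint oU UL tphi).
rewrite (_ : l2ip leb U _ phi = \int[leb]_(x in U) (f (x + h) * phi x - f x * phi x)); last first.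
  by apply: eq_Rintegral => x _; rewrite mulrBl.
rewrite (RintegralB mU su sv).
by congr (_ - _); apply: eq_Rintegral => x /set_mem [Tx Txh]; rewrite ff'.
Qed.

Lemma pairing_bound :
  l2ip leb U (fun x => f (x + h) - f x) phi ^+ 2 <= enorm h ^+ 2 * gradT * l2ip leb U phi phi.
Proof.
have [c c01 cE] : exists2 c, c \in `]0, 1[%R & F 1 - F 0 = F' c * (1 - 0).
  apply: (@MVT _ F F' 0 1 ltr01) => [t|].
    rewrite in_itv /= => /andP[t0 t1]; apply: pairing_derive; rewrite !ltW //.
  apply: derivable_within_continuous => t; rewrite in_itv /= => t01.
  have hd := pairing_derive t01; exact: ex_derive.
rewrite -pairing_increment cE subr0 mulr1; apply: pairing_slope.
by move: c01; rewrite in_itv /= => /andP[/ltW -> /ltW ->].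
Qed.
End pairing.

(** By duality.  The pairing of the increment with a test function phi of the
overlap is F 1 - F 0, where F t pairs f with phi (. - t * h); the mean value
theorem bounds it by |h| |grad f| |phi|, and test functions are dense. *)
Theorem translation_estimate :
  l2ip leb U (fun x => f (x + h) - f x) (fun x => f (x + h) - f x) <= enorm h ^+ 2 * gradT.
Proof.
(* A single function is a family indexed by unit. *)
pose S : set (unit -> E -> R) := [set (fun=> phi) | phi in test_function U].
pose H := l2_hilbert unit leb mU.
have ipE (y z : unit -> E -> R) : hip H y z = l2ip leb U (y tt) (z tt).
  have e : hip H y z = \sum_i l2ip leb U (y i) (z i) by [].
  by rewrite e (big_pred1 tt) // => -[].
have S0 : S 0 by exists (fun=> 0) => //; exact: test0.
have S_lin a x y : S x -> S y -> S (a *: x + y).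
  by move=> [p tp <-] [q tq <-]; exists (fun x => a * p x + q x) => //; exact: test_lin.
have S_dom : S `<=` hdom H by move=> _ [p tp <-]; exact: (fun _ : unit => test_sqint oU UL tp).
have S_dense n : hdom H n -> (forall y, S y -> hip H n y = 0) -> hip H n n = 0.
  move=> dn nS; have sn : sqint leb U (n tt) := dn tt.
  have n0 : ae_eq leb U (n tt) (fun=> 0).
    apply: (test_ae_eq0 mU _ _ oU).
      exact: (sqint_integrable mU (domain_lty oU UL) sn).
    move=> phi tphi; rewrite -[LHS](ipE n (fun=> phi)); apply: nS; by exists phi.
  have [mn _] := sn.
  have m0 : measurable_fun U (fun _ : E => 0 : R) by exact: measurable_cst.
  rewrite ipE (ae_eq_l2ip mU mn m0 mn mn n0 (ae_eq_refl _ _ _)).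
  by rewrite /l2ip; under eq_Rintegral do rewrite mul0r; rewrite Rintegral_cst // mul0r.
have sd := sqintB mU overlap_sqint overlap_sqint0.
have K0 : 0 <= enorm h ^+ 2 * gradT.
  by rewrite mulr_ge0 ?sqr_ge0 //; apply: sumr_ge0 => i _; exact: l2ip_ge0.
have hb y : S y -> hip H (fun=> fun x => f (x + h) - f x) y ^+ 2 <= enorm h ^+ 2 * gradT * hip H y y.
  move=> [phi tphi <-]; rewrite !ipE.
  exact: pairing_bound.
have := dense_dual_bound S0 S_lin S_dom S_dense (fun=> sd) K0 hb.
by rewrite ipE.
Qed.

End translation_estimate.

Section double_integral.
Context {R : realType} {d : nat}.
Local Notation E := 'rV[R]_d.
Local Notation leb := (@lebesgue_rV R d).
Variables (T : set E) (L : R).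
Hypothesis oT : open T.
Hypothesis TL : forall x, T x -> forall j, `|x ord0 j| <= L.
Hypothesis bT : bounded_set T.
Hypothesis diam_gt0 : 0 < diam T.
Hypothesis cT : is_convex T.
Let mT : measurable T := open_rV_measurable oT.
Variables (f : E -> R) (G : E -> E).
Hypothesis sf : sqint leb T f.
Hypothesis sG : forall i, sqint leb T (fun x => G x ord0 i).
Hypothesis fG : forall phi, test_function T phi -> forall i,
  \int[leb]_(x in T) (f x * partial i phi x) = - \int[leb]_(x in T) (G x ord0 i * phi x).
Let gradT := \sum_i l2ip leb T (fun x => G x ord0 i) (fun x => G x ord0 i).

(** After the substitution y = x + h and an exchange of integrals, the inner
integral is the squared norm of an increment of f.  Only h with
|h| <= diam T contribute, and these lie in a ball of volume
(4 * diam T)^d. *)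
Lemma double_integral_grad :
  (\int[leb]_(x in T) \int[leb]_(y in T) ((f x - f y) ^+ 2)%:E <=
   ((4 * diam T) ^+ d * (diam T ^+ 2 * gradT))%:E)%E.
Proof.
pose f' := f \_ T.
have mf' : measurable_fun setT f' by case: sf => mf _; apply/(measurable_restrictT _ mT).
have ff' x : T x -> f' x = f x by move=> Tx; rewrite /f' patchE mem_set.
pose q (z : E * E) : R := (f' z.1 - f' z.2) ^+ 2 * (\1_T z.1 * \1_T z.2).
pose k (z : E * E) : \bar R := (q z)%:E.
have m1 : measurable_fun setT (fun z : E * E => \1_T z.1 : R).
  by apply: (measurableT_comp (measurable_indic mT)); exact: measurable_fst.
have m2 : measurable_fun setT (fun z : E * E => \1_T z.2 : R).
  by apply: (measurableT_comp (measurable_indic mT)); exact: measurable_snd.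
have mk : measurable_fun setT k.
  apply/measurable_EFinP; apply: measurable_funM; last exact: measurable_funM.
  by apply: measurable_funX; exact: measurable_pair_diff.
have k0 z : (0 <= k z)%E by rewrite lee_fin /q mulr_ge0 ?sqr_ge0 // mulr_ge0.
pose k2 (z : E * E) := k (z.1, z.2 + z.1).
have mk2 : measurable_fun setT k2.
  apply: (measurableT_comp mk).
  apply/measurable_fun_pairP; split; first exact: measurable_fst.
  apply: measurable_fun_rV => i.
  apply: (eq_measurable_fun (fun z : E * E => (z.2 ord0 i + z.1 ord0 i : R))).
    by move=> z _ /=; rewrite mxE.
  apply: measurable_funD.
    by apply: (measurableT_comp (measurable_coor i)); exact: measurable_snd.
  by apply: (measurableT_comp (measurable_coor i)); exact: measurable_fst.
have k20 z : (0 <= k2 z)%E := k0 _.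
have indT x : (x \in T) -> \1_T x = 1 :> R by move=> Tx; rewrite indicE Tx.
have indN x : (x \notin T) -> \1_T x = 0 :> R by move=> /negPf Tx; rewrite indicE Tx.
have -> : (\int[leb]_(x in T) \int[leb]_(y in T) ((f x - f y) ^+ 2)%:E =
    \int[leb]_x \int[leb]_h k2 (x, h))%E.
  rewrite integral_mkcond; apply: eq_integral => x _.
  have mkx : measurable_fun setT (fun y => k (x, y)) := measurableT_comp mk (measurable_pair1 x).
  rewrite (ge0_integral_translate x mkx); last by move=> y; exact: k0.
  rewrite patchE; case: ifPn => Tx; last first.
    by rewrite integral0_eq // => y _; rewrite /k /q /= (indN _ Tx) mul0r mulr0.
  rewrite integral_mkcond; apply: eq_integral => y _.
  rewrite patchE /k /q /= (indT _ Tx) mul1r; case: ifPn => Ty.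
    by rewrite (indT _ Ty) mulr1 !ff' //; exact: set_mem.
  by rewrite (indN _ Ty) mulr0.
rewrite (fubini_tonelli k2 mk2 k20) /fubini_G.
have gradT0 : 0 <= gradT by apply: sumr_ge0 => i _; exact: l2ip_ge0.
pose c := diam T ^+ 2 * gradT.
have c0 : 0 <= c by rewrite mulr_ge0 ?sqr_ge0.
have inner (h : E) : (\int[leb]_x k2 (x, h) <= (c * \1_(ball (0 : E) (2 * diam T)) h)%:E)%E.
  have mU := open_rV_measurable (overlap_open oT (h := h)).
  have sd := sqintB mU (overlap_sqint oT sf h) (overlap_sqint0 oT sf h).
  have -> : (\int[leb]_x k2 (x, h) =
      (l2ip leb (overlap T h) (fun x : E => f (x + h) - f x) (fun x : E => f (x + h) - f x))%:E)%E.
    rewrite (l2ip_EFin mU sd) [RHS]integral_mkcond; apply: eq_integral => x _.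
    rewrite patchE /k2 /k /q /= [h + x]addrC; case: ifPn => [/set_mem [Tx Txh]|nU].
      by rewrite !indT ?inE // !mulr1 !ff' // -sqrrN opprB.
    have [Tx|Tx] := boolP (x \in T); last by rewrite (indN _ Tx) mul0r mulr0.
    have [Th|Th] := boolP (x + h \in T); last by rewrite (indN _ Th) !mulr0.
    by case/negP: nU; rewrite inE; split; exact: set_mem.
  rewrite lee_fin.
  have [[x [Tx Txh]]|no] := pselect (overlap T h !=set0).
    have hd : enorm h <= diam T.
      by have := enorm_le_diam bT Txh Tx; rewrite [x + h]addrC addrK.
    rewrite indicE mem_set ?mulr1; last first.
      have D0 : 0 < 2 * diam T by rewrite mulr_gt0.
      rewrite rV_ballE // => i; rewrite mxE subr0.
      by rewrite (le_lt_trans (coord_le_enorm h i)) // (le_lt_trans hd) // ltr_pMl // ltr1n.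
    apply: le_trans (translation_estimate oT TL cT sf sG fG h) _.
    by apply: ler_wpM2r => //; rewrite lerXn2r // nnegrE ?enorm_ge0 // ltW.
  rewrite (_ : overlap T h = set0); last by apply/eqP; apply: contra_notT no => /set0P.
  by rewrite /l2ip /Rintegral integral_set0 /= mulr_ge0.

have D0 : 0 < 2 * diam T by rewrite mulr_gt0.
apply: (@le_trans _ _ (\int[leb]_h (c * \1_(ball (0 : E) (2 * diam T)) h)%:E)%E).
  apply: ge0_le_integral => //.
  - by move=> h _; apply: integral_ge0 => x _; exact: k20.
  - exact: (@measurable_fun_fubini_tonelli_G _ _ _ _ R leb k2 mk2 k20).
  - apply/measurable_EFinP; apply: measurable_funM => //.
    by apply: measurable_indic; exact: rV_ball_measurable.
under eq_integral do rewrite EFinM.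
have mI : measurable_fun setT (fun h : E => (\1_(ball (0 : E) (2 * diam T)) h : R)%:E).
  by apply/measurable_EFinP; apply: measurable_indic; exact: rV_ball_measurable.
rewrite (ge0_integralZl leb measurableT mI); last 2 first.
- by move=> h _; rewrite lee_fin.
- by rewrite lee_fin.
rewrite integral_indic //; last exact: rV_ball_measurable.
rewrite setIT [X in (_ * X)%E](lebesgue_rV_ball (0 : E) D0) -EFinM lee_fin.
by rewrite mulrC mulrA -natrM.
Qed.

End double_integral.

(** * The projection error and the theorem *)

Section first_order.
Context {R : realType} {d : nat}.
Local Notation E := 'rV[R]_d.
Local Notation leb := (@lebesgue_rV R d).
Variables (D : set E) (N : nat) (T : 'I_N -> set E) (sigma : R).
Hypothesis d_gt0 : (0 < d)%N.
Hypothesis pD : polygonal_domain D.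
Hypothesis hT : is_mesh D T.
Hypothesis srT : shape_regular sigma T.
Let mD : measurable D := open_rV_measurable (polygonal_open pD).
Let mT k : measurable (T k) := element_measurable hT k.
Let TD k : T k `<=` D := element_sub pD hT (k := k).

Lemma l2ip_mesh g : sqint leb D g -> l2ip leb D g g = \sum_k l2ip leb (T k) g g.
Proof.
move=> sg; apply: EFin_inj; rewrite (l2ip_EFin mD sg) (ge0_integral_mesh pD hT); first last.
- by move=> x _; rewrite lee_fin sqr_ge0.
- by case: sg => mg _; apply/measurable_EFinP; exact: measurable_funX.
rewrite -sumEFin; apply: eq_bigr => k _.
by rewrite (l2ip_EFin (mT k) (sqint_element pD hT k sg)).
Qed.

Lemma integral_test_local (A B : set E) (g phi : E -> R) : A `<=` B -> test_function A phi ->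
  \int[leb]_(x in B) (g x * phi x) = \int[leb]_(x in A) (g x * phi x).
Proof.
move=> AB tphi; rewrite [LHS]Rintegral_mkcond [RHS]Rintegral_mkcond.
apply: eq_Rintegral => x _; rewrite !patchE.
have [Ax|Ax] := boolP (x \in A).
  by rewrite (mem_set (AB _ (set_mem Ax))).
by case: ifP => // _; rewrite (test_function_out tphi) ?mulr0 // => /mem_set; exact/negP.
Qed.

Lemma mesh_size_ge k : diam (T k) <= mesh_size T.
Proof. by rewrite /mesh_size le_bigmax. Qed.

Lemma mesh_size_ge0 : 0 <= mesh_size T.
Proof. by rewrite /mesh_size; apply: bigmax_ge_id. Qed.

Lemma PiH_error_H1 f G : sqint leb D f -> sqint leb D (f \- PiH T f) ->
  is_weak_grad D f G ->
  l2ip leb D (f \- PiH T f) (f \- PiH T f) <=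
  (4 * (`|sigma| * d%:R)) ^+ d * mesh_size T ^+ 2 *
    \sum_i l2ip leb D (fun x => G x ord0 i) (fun x => G x ord0 i).
Proof.
move=> sf sfp wG; have [L DL] := polygonal_bound pD.
have sG i : sqint leb D (fun x => G x ord0 i) := weak_grad_comp (polygonal_open pD) i wG.
pose K := (4 * (`|sigma| * d%:R)) ^+ d * mesh_size T ^+ 2.
pose grad k := \sum_i l2ip leb (T k) (fun x => G x ord0 i) (fun x => G x ord0 i).
have -> : \sum_i l2ip leb D (fun x => G x ord0 i) (fun x => G x ord0 i) = \sum_k grad k.
  by rewrite exchange_big; apply: eq_bigr => i _; exact: l2ip_mesh.
rewrite -lee_fin; apply: le_trans (PiH_error_double d_gt0 pD hT srT sf sfp) _.
rewrite mulr_sumr -sumEFin; apply: lee_sum => k _.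
have [r [r0 _ _ dm0]] := element_volume d_gt0 pD hT srT k.
have vol0 := element_gt0 d_gt0 pD hT srT k.
have grad0 : 0 <= grad k by apply: sumr_ge0 => i _; exact: l2ip_ge0.
have [oT cT] := element_open_convex hT k.
have sGT i := sqint_element pD hT k (sG i).
have TL x : T k x -> forall j, `|x ord0 j| <= L by move=> /(@TD k); exact: DL.
have fGT phi : test_function (T k) phi -> forall i,
    \int[leb]_(x in T k) (f x * partial i phi x) = - \int[leb]_(x in T k) (G x ord0 i * phi x).
  move=> tphi i.
  rewrite -(integral_test_local f (@TD k) (test_partial i tphi)).
  rewrite -(integral_test_local _ (@TD k) tphi).
  exact: (wG.2 phi (test_functionS (@TD k) tphi)).
have db := double_integral_grad oT TL (element_bounded pD hT k) dm0 cT
  (sqint_element pD hT k sf) sGT fGT.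
apply: (@le_trans _ _ (((fine (leb (T k)))^-1)%:E *
    ((4 * diam (T k)) ^+ d * (diam (T k) ^+ 2 * grad k))%:E)%E).
  by apply: lee_wpmul2l => //; rewrite lee_fin invr_ge0 ltW.
rewrite -EFinM lee_fin.
rewrite [leLHS](_ : _ = 4 ^+ d * (diam (T k) ^+ d * (fine (leb (T k)))^-1) * diam (T k) ^+ 2 * grad k); last first.
  by rewrite exprMn; move: (4 ^+ d) (diam _ ^+ d) (_^-1) => p q v; ring.
apply: ler_wpM2r => //; rewrite /K exprMn; apply: ler_pM.
- by rewrite !mulr_ge0 ?exprn_ge0 ?invr_ge0 ?(ltW dm0) ?(ltW vol0).
- exact: sqr_ge0.
- by apply: ler_wpM2l; [rewrite exprn_ge0|exact: (diam_volume d_gt0 pD hT srT k)].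
- by rewrite lerXn2r ?nnegrE ?(ltW dm0) ?mesh_size_ge0 ?mesh_size_ge.
Qed.

(** The projection is bounded, being a finite combination of indicators. *)
Lemma PiH_error_sqint f : sqint leb D f -> sqint leb D (f \- PiH T f).
Proof.
move=> sf; apply: (sqintB mD sf).
have lD : (leb D < +oo)%E.
  by have [L DL] := polygonal_bound pD; exact: (domain_lty (polygonal_open pD) DL).
have hB : exists2 B, 0 <= B & forall x, `|PiH T f x| <= B.
  exists (\sum_(k < N) `|(fine (leb (T k)))^-1 * \int[leb]_(y in T k) f y|).
    by apply: sumr_ge0.
  move=> x; apply: le_trans (ler_norm_sum _ _ _) _; apply: ler_sum => k _.
  by rewrite normrM ler_piMr // indicE; case: (_ \in _); rewrite ?normr1 ?normr0.
have [B B0 PB] := hB.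
have := sqint_bounded_mul mD (measurable_funTS (measurable_PiH hT f)) (fun x _ => PB x) (sqint_cst mD 1 lD).
by under eq_fun do rewrite mulr1.
Qed.

Lemma Hs_error (s : R) f : 0 <= s <= 1 -> Hs D s f ->
  L2norm D (f \- PiH T f) ^+ 2 <=
  ((4 * (`|sigma| * d%:R)) ^+ d + 1) * (mesh_size T `^ s) ^+ 2 * Hsnorm D s f ^+ 2.
Proof.
move=> /andP[s0 s1]; set A := (4 * _) ^+ d.
have a0 : 0 <= `|sigma| * d%:R by rewrite mulr_ge0.
have A0 : 0 <= A by rewrite exprn_ge0 // mulr_ge0.
rewrite /Hs /Hsnorm; have [->|sn0] := eqVneq s 0.
  move=> /(L2_sqint mD) sf; have sfp := PiH_error_sqint sf.
  rewrite (L2norm_sqr mD sfp) (L2norm_sqr mD sf) powRr0 expr1n mulr1.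
  apply: le_trans (PiH_error_le d_gt0 pD hT srT sf sfp) _.
  by rewrite mulrDl mul1r lerDr mulr_ge0 // l2ip_ge0.
have [->|sn1] := eqVneq s 1.
  move=> [/(L2_sqint mD) sf [G wG]]; have sfp := PiH_error_sqint sf.
  rewrite (L2norm_sqr mD sfp) powRr1 ?mesh_size_ge0 //.
  apply: le_trans (PiH_error_H1 sf sfp wG) _.
  have [L DL] := polygonal_bound pD.
  rewrite /H1norm sqr_sqrtr ?addr_ge0 ?sqr_ge0 // (H1seminorm_sqr (polygonal_open pD) DL sf wG).
  set S := \sum_i _; have S0 : 0 <= S by apply: sumr_ge0 => i _; exact: l2ip_ge0.
  apply: ler_pM => //; first by rewrite mulr_ge0 ?sqr_ge0.
    by apply: ler_wpM2r; [exact: sqr_ge0|rewrite lerDl].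
  by rewrite lerDr sqr_ge0.
move=> [/(L2_sqint mD) sf slob]; have sfp := PiH_error_sqint sf.
have sp : 0 < s by rewrite lt_neqAle eq_sym sn0.
rewrite (L2norm_sqr mD sfp).
apply: le_trans (PiH_error_slobodeckij d_gt0 pD hT srT sp sf sfp slob) _.
have Sl : 0 <= fine (slobodeckij D s f).
  apply: fine_ge0; apply: integral_ge0 => x _; apply: integral_ge0 => y _.
  by rewrite lee_fin mulr_ge0 ?sqr_ge0 // invr_ge0 powR_ge0.
rewrite sqr_sqrtr ?addr_ge0 ?sqr_ge0 //.
apply: ler_pM => //; first by rewrite mulr_ge0 ?sqr_ge0 // exprn_ge0.
  apply: ler_wpM2r; first exact: sqr_ge0.
  apply: (@le_trans _ _ A); last by rewrite lerDl.
  rewrite /A [leRHS]exprMn ler_peMl ?exprn_ge0 // exprn_ege1 //.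
  by rewrite ler1n.
by rewrite lerDr sqr_ge0.
Qed.

End first_order.

Theorem lemma3p1 (R : realType) (d : nat) (hd : (1 <= d <= 3)%N)
    (Omega : set 'rV[R]_d) (hOmega : polygonal_domain Omega)
    (b : 'rV[R]_d -> 'rV[R]_d) (hb_affine : affine b)
    (hb_div : forall x, Omega x -> div b x = 0)
    (hb_neq0 : forall x, Omega x -> b x != 0)
    (s : R) (hs : 0 <= s <= 1) (sigma : R) :
  exists2 C : R, 0 < C &
    forall (Cstab : R) (hCstab : stability_constant Omega b Cstab)
      (eps : R) (heps : admissible Omega b eps)
      (N : nat) (T : 'I_N -> set 'rV[R]_d)
      (hT : is_mesh Omega T) (hsigma : shape_regular sigma T)
      (f : 'rV[R]_d -> R) (hf : Hs Omega s f)
      (u : 'rV[R]_d -> R) (hu : solves Omega b eps f u)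
      (uH : 'rV[R]_d -> R) (huH : solvesH Omega b eps T (PiH T f) uH),
      Vnorm Omega eps (u \- uH) <= Cstab * L2norm Omega (f \- PiH T f) /\
      Cstab * L2norm Omega (f \- PiH T f) <=
        C * Cstab * mesh_size T `^ s * Hsnorm Omega s f.
Proof.
have d_gt0 : (0 < d)%N by case/andP: hd.
pose A := (4 * (`|sigma| * d%:R)) ^+ d + 1.
have A0 : 0 < A by rewrite ltr_wpDl // exprn_ge0 // !mulr_ge0.
(* The power serves 0 < s <= 1, the summand 1 serves s = 0. *)
exists (Num.sqrt A); first by rewrite sqrtr_gt0.
move=> Cstab hCstab eps heps N T hT hsigma f hf u hu uH huH.
have oD := polygonal_open hOmega; have mD := open_rV_measurable oD.
have [L DL] := polygonal_bound hOmega.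
have eps_gt0 : 0 < eps by case/andP: heps.
have mT k : measurable (T k) := element_measurable hT k.
have C0 : 0 < Cstab by case: hCstab.
have sf : sqint (@lebesgue_rV R d) Omega f.
  apply/(L2_sqint mD); move: hf; rewrite /Hs; case: ifP => // _.
  by case: ifP => _ [].
split.
  exact: (galerkin_error oD DL d_gt0 hb_affine hb_div eps_gt0 mT hCstab heps sf hu huH).
have H0 : 0 <= Hsnorm Omega s f.
  rewrite /Hsnorm; case: ifP => _; first exact: L2norm_ge0.
  by case: ifP => _; exact: sqrtr_ge0.
rewrite [Num.sqrt A * Cstab]mulrC -!mulrA ler_pM2l //.
rewrite -(@ler_pXn2r _ 2) // ?nnegrE ?mulr_ge0 ?sqrtr_ge0 ?powR_ge0 ?L2norm_ge0 //.
rewrite !exprMn sqr_sqrtr ?(ltW A0) // mulrA.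
exact: Hs_error.
Qed.
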